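(* Let $a,b,c\in\mathbb{R}$ with $a>0$, $c>0$ and $\sigma:=\frac{b^2}{ac}<3$. Let $V\colon[0,+\infty)\to\mathbb{R}$ be the function with $V(0)=0$ and $s^2=aV(s)^3+bV(s)^2+cV(s)$ for all $s\ge0$, and let $G\colon[0,+\infty)\to\mathbb{R}$ be the continuously differentiable function $G(s)=-\frac{s^2V(s)}{2}$. Then: (i) if $0<\sigma\le 2$, there exists a unique positive symmetric minimum, that is, $|K_\lambda|=1$ for every $\lambda>0$; (ii) if $2<\sigma<3$, there exists a unique level $\lambda_2=\lambda_2(\sigma)>0$ such that $|K_{\lambda_2}|=2$, that is, there are two positive, symmetric minima of $E$ constrained to $S(\lambda_2)$; if $\lambda>0$ and $\lambda\ne\lambda_2$, then again $|K_\lambda|=1$.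
   Context: For $u\in H^1(\mathbb{R};\mathbb{C})$ set $$E(u):=\frac12\int_{-\infty}^{+\infty}|u'(x)|^2\,dx+\int_{-\infty}^{+\infty}G(|u(x)|)\,dx,\qquad M(u):=\int_{-\infty}^{+\infty}|u(x)|^2\,dx.$$ For $\lambda>0$ set $S(\lambda):=\{u\in H^1(\mathbb{R};\mathbb{C})\mid M(u)=\lambda\}$ and $\mathcal{G}_\lambda:=\{u\in S(\lambda)\mid E(u)=\inf_{S(\lambda)}E\}$. Let $H^1_{r,+}$ be the set of functions in $H^1(\mathbb{R};\mathbb{R})$ that are positive and symmetric (even, $u(-x)=u(x)$), and let $K_\lambda:=\mathcal{G}_\lambda\cap H^1_{r,+}$; $|K_\lambda|$ denotes its cardinality.
   Formalization: Part (ii) is false for b>0 (e.g. a=c=1, b=1.5), so the level λ_2 is asserted only for b<0; for 2<σ<3 and b>0 it is shown instead that |K_λ|=1 for every λ>0. λ_2 is a level for given a,b,c, since it cannot depend on σ alone. *)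

(* Defs.v *)
From HB Require Import structures.
From mathcomp Require Import all_boot all_order all_algebra.
From mathcomp Require Import all_classical all_reals all_analysis.
From mathcomp Require Import complex.

Set Implicit Arguments.
Unset Strict Implicit.
Unset Printing Implicit Defensive.

Import Order.TTheory GRing.Theory Num.Theory.
Import numFieldNormedType.Exports.

Local Open Scope classical_set_scope.
Local Open Scope ring_scope.
Local Open Scope complex_scope.

Section Defs.
Variable R : realType.

Local Notation mu := (@lebesgue_measure R).

(* The modulus as a real number: `|z| itself lives in R[i]. *)
Definition cabs (z : R[i]) : R := ComplexField.Normc.normc z.

Definition test_function (phi : R -> R) : Prop :=
  (forall (n : nat) (x : R), derivable (derive1n n phi) x 1) /\
  compact (closure [set x | phi x != 0]).

Definition L2 (f : R -> R) : Prop := f \in Lfun mu 2%:E.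

Definition L2C (u : R -> R[i]) : Prop :=
  L2 (fun x => complex.Re (u x)) /\ L2 (fun x => complex.Im (u x)).

Definition weak_derivative (f g : R -> R) : Prop :=
  forall phi : R -> R, test_function phi ->
    (\int[mu]_x (f x * derive1 phi x) = - \int[mu]_x (g x * phi x))%R.

Definition weak_derivativeC (u v : R -> R[i]) : Prop :=
  weak_derivative (fun x => complex.Re (u x)) (fun x => complex.Re (v x)) /\
  weak_derivative (fun x => complex.Im (u x)) (fun x => complex.Im (v x)).

Definition L2_derivatives (u : R -> R[i]) : set (R -> R[i]) :=
  [set v | L2C v /\ weak_derivativeC u v].

(* H^1(R; C), as a set of functions closed under a.e. equality. *)
Definition H1 : set (R -> R[i]) :=
  [set u | L2C u /\ L2_derivatives u !=set0].

(* u' is determined by u almost everywhere, so the choice of a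
   representative does not affect integrals. *)
Definition wderiv (u : R -> R[i]) : R -> R[i] :=
  xget (cst 0) (L2_derivatives u).

Definition energy (G : R -> R) (u : R -> R[i]) : R :=
  (2^-1 * \int[mu]_x (cabs (wderiv u x) ^+ 2) + \int[mu]_x G (cabs (u x)))%R.

Definition mass (u : R -> R[i]) : R := (\int[mu]_x (cabs (u x) ^+ 2))%R.

Definition mass_sphere (lambda : R) : set (R -> R[i]) :=
  [set u | H1 u /\ mass u = lambda].

(* The infimum is taken in the extended reals, because the infimum of an
   unbounded set of reals is a default value. *)
Definition ground_states (G : R -> R) (lambda : R) : set (R -> R[i]) :=
  [set u | mass_sphere lambda u /\
    (energy G u)%:E =
      ereal_inf [set (energy G v)%:E | v in mass_sphere lambda]].

(* An element of H^1 is represented here by its unique continuous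
   representative, so that positivity and symmetry are pointwise and
   counting functions is the same as counting elements of H^1. *)
Definition H1rp : set (R -> R[i]) :=
  [set u | [/\ H1 u,
               exists2 w : R -> R, continuous w & forall x, u x = (w x)%:C,
               forall x, 0 < complex.Re (u x)
             & forall x, u (- x) = u x]].

Definition positive_symmetric_minima (G : R -> R) (lambda : R) :
    set (R -> R[i]) :=
  ground_states G lambda `&` H1rp.

Definition potential (V : R -> R) (s : R) : R := - (s ^+ 2 * V s / 2).

End Defs.

(* Main.v *)
Require Import Defs.
From HB Require Import structures.
From mathcomp Require Import all_boot all_order all_algebra.
From mathcomp Require Import all_classical all_reals all_analysis.
From mathcomp Require Import measurable_realfun complex.
From mathcomp Require Import ring lra.
Import Order.TTheory GRing.Theory Num.Theory.
Import numFieldNormedType.Exports.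
Local Open Scope classical_set_scope.
Local Open Scope ring_scope.

(**
Write P(v) = a v^3 + b v^2 + c v, so that P(V(s)) = s^2, and for k > 0 let R_k be the
primitive of P'(k^2 - y^2) y^2 that vanishes at 0.

If k^2 is the value of V at the maximum of |u|, then
2 E(u) + k^2 M(u) is the integral of |u'|^2 + |u|^2 (k^2 - V(|u|)), and Bogomolny's trick
(complete the square on each side of the maximum) bounds it below by 4 R_k(k).
Hence E(u) >= h(k) := 2 R_k(k) - k^2 M(u) / 2, a polynomial in k. Along the solutions of
u' = - u sqrt(k^2 - V(u)) issued from the maximum there is equality, and the variable
y = sqrt(k^2 - V(u)) satisfies y' = P(k^2 - y^2) / P'(k^2 - y^2), so that the mass of this
profile is an explicit polynomial lam(k). Since h'(k) = k (lam(k) - M(u)), the profile that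
belongs to a minimiser k of h has mass M(u), and the elements of K_lambda are exactly the
profiles of the minimisers of h on (0, +oo). Finally lam'(k) / 2 = 8 a k^4 + 4 b k^2 + c: this
is positive when sigma < 2 or b > 0 (and vanishes at one point at most when sigma = 2), which
makes the minimiser unique; when sigma > 2 and b < 0, lam increases, decreases and increases
again, and the minimiser jumps across the decreasing branch at exactly one mass.
*)

Set Implicit Arguments.
Unset Strict Implicit.
Unset Printing Implicit Defensive.

(** * Derivatives and smooth test functions *)

Section Derivatives.
Variable R : realType.
Implicit Types (f g : R -> R) (x l : R).

(** Since $V$ is given only implicitly, everything is expressed in $y=\sqrt{k^2-V(|u|)}$: there
    $|u|^2=P(k^2-y^2)$ and $|u|\,d|u|=-P'(k^2-y^2)\,y\,dy$, so all integrals become polynomial.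
    $R_k$ comes from $|u|\,y\,d|u|=-P'(k^2-y^2)\,y^2\,dy$, the cross term of the completed square.
    The condition $\sigma<3$ says that $P'$ has negative discriminant, so $P$ is strictly
    increasing; at $\sigma=2$ the discriminant of $8aX^2+4bX+c$ changes sign. The bound involves the
    unknown $k$ of the competitor, so it is minimised over all $k$ at fixed mass. Existence thus
    concerns a polynomial on a half-line, and no compactness in $H^1$ is invoked. The obstacle is
    regularity: a competitor has only a weak derivative. Its modulus is therefore controlled through
    increments of primitives over intervals, and a minimiser is shown to be differentiable by
    equality in the bound, not by an Euler-Lagrange equation. Equality determines it only to the
    right of its last maximum; symmetry and mass then place that maximum at 0. *)

Lemma is_deriveE f x l : is_derive x 1 f l <-> derivable f x 1 /\ derive1 f x = l.
Proof.
rewrite derive1E; split=> [[? ?]|[? ?]]; first by split.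
exact: DeriveDef.
Qed.

Lemma is_derive_derive1 f x : derivable f x 1 -> is_derive x 1 f (derive1 f x).
Proof. by move=> df; apply/is_deriveE. Qed.

Lemma is_derive_add f g x a b : is_derive x 1 f a -> is_derive x 1 g b ->
  is_derive x 1 (fun t => f t + g t) (a + b).
Proof. by move=> fa gb; apply: is_deriveD. Qed.

Lemma is_derive_opp f x a : is_derive x 1 f a ->
  is_derive x 1 (fun t => - f t) (- a).
Proof. by move=> fa; apply: is_deriveN. Qed.

Lemma is_derive_sub f g x a b : is_derive x 1 f a -> is_derive x 1 g b ->
  is_derive x 1 (fun t => f t - g t) (a - b).
Proof. by move=> fa gb; apply: is_deriveB. Qed.

Lemma is_derive_mul f g x a b : is_derive x 1 f a -> is_derive x 1 g b ->
  is_derive x 1 (fun t => f t * g t) (a * g x + f x * b).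
Proof.
move=> fa gb.
by have := is_deriveM fa gb; rewrite /GRing.scale/= addrC [g x * a]mulrC.
Qed.

Lemma is_derive_comp1 f g x a b : is_derive (g x) 1 f a -> is_derive x 1 g b ->
  is_derive x 1 (fun t => f (g t)) (a * b).
Proof. exact: is_derive1_comp. Qed.

Lemma is_derive_pow f n x a : is_derive x 1 f a ->
  is_derive x 1 (fun t => f t ^+ n) (n%:R * f x ^+ n.-1 * a).
Proof.
move=> fa; have -> : (fun t => f t ^+ n) = f ^+ n by apply/funext => t; rewrite exprfctE.
exact: is_deriveX.
Qed.

Lemma is_derive_inv f x a : f x != 0 -> is_derive x 1 f a ->
  is_derive x 1 (fun t => (f t)^-1) (- a / f x ^+ 2).
Proof.
move=> f0 fa.
by have := is_deriveV f0 fa; rewrite /GRing.scale/= !mulNr [a / _]mulrC.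
Qed.

Lemma is_derive_expR_comp f x a : is_derive x 1 f a ->
  is_derive x 1 (fun t => expR (f t)) (expR (f x) * a).
Proof. by move=> fa; apply: (@is_derive_comp1 expR f _ _ _) => //; exact: is_derive_expR. Qed.

Lemma is_derive_continuous f x l : is_derive x 1 f l -> {for x, continuous f}.
Proof.
by case=> df _; apply: differentiable_continuous; apply/derivable1_diffP.
Qed.

(** The quadratic remainder makes the Caratheodory quotient [g] continuous at [x]. This serves where
    no calculus rule applies, as at the gluing point of [flat]. *)
Lemma is_derive_quadratic_bound f x l (C e : R) : 0 < e ->
  (forall y, `|y - x| < e -> `|f y - f x - l * (y - x)| <= C * (y - x) ^+ 2) ->
  is_derive x 1 f l.
Proof.
move=> e0 H; apply/is_derive1_caratheodory.
pose g z := if z == x then l else (f z - f x) / (z - x).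
exists g; split; last by rewrite /g eqxx.
  move=> z; rewrite /g; have [->|zx] := eqVneq z x; first by rewrite !subrr mulr0.
  by rewrite divfK // subr_eq0.
have C0 : 0 <= `|C| + 1 by rewrite addr_ge0.
apply/cvgrPdist_lt => r r0; rewrite near_simpl/=.
apply/nbhs_ballP; exists (Num.min e (r / (`|C| + 1))) => /=.
  by rewrite lt_min e0 divr_gt0// ltr_wpDl.
move=> y; rewrite /ball/= lt_min => /andP[ye yr].
rewrite /g eqxx; have [_|yx] := eqVneq y x; first by rewrite subrr normr0.
have yx0 : 0 < `|y - x| by rewrite normr_gt0 subr_eq0.
have -> : l - (f y - f x) / (y - x) = - ((f y - f x - l * (y - x)) / (y - x)).
  by field; rewrite subr_eq0.
rewrite normrN normrM normfV ltr_pdivrMr//.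
rewrite distrC in ye yr.
apply: (le_lt_trans (H y ye)).
rewrite -real_normK ?num_real//.
apply: (@le_lt_trans _ _ ((`|C| + 1) * `|y - x| * `|y - x|)).
  rewrite expr2 !mulrA -!mulrA ler_wpM2r ?mulr_ge0//.
  by rewrite (le_trans (ler_norm C))// lerDl.
rewrite ltr_pM2r//.
by rewrite mulrC -ltr_pdivlMr// ltr_wpDl.
Qed.

End Derivatives.

(** * Smooth functions and a compactly supported bump *)

Section Smooth.
Variable R : realType.
Implicit Types (f g : R -> R) (p : {poly R}) (x : R).

(** The recursion peels off the innermost derivative, so closure under products and affine
    substitutions is an induction on [n] with [f] varying. *)
Fixpoint nsmooth (n : nat) f : Prop :=
  if n is m.+1 then (forall x, derivable f x 1) /\ nsmooth m (derive1 f) else True.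

Definition smooth f := forall n, nsmooth n f.

Lemma smooth_derive1n f : smooth f ->
  forall n x, derivable (derive1n n f) x 1.
Proof.
move=> sf n; move: (sf n.+1); elim: n f {sf} => [f [] //|n IH f [_ H]] x.
by rewrite derive1Sn; apply: IH.
Qed.

Lemma nsmoothS n f : nsmooth n.+1 f -> nsmooth n f.
Proof. by elim: n f => [//|n IH] f [df /IH]. Qed.

Lemma nsmoothD n f g : nsmooth n f -> nsmooth n g ->
  nsmooth n (fun x => f x + g x).
Proof.
elim: n f g => [//|n IH] f g [df sf] [dg sg]; split.
  by move=> x; apply: derivableD.
rewrite (_ : derive1 _ = fun x => derive1 f x + derive1 g x); first exact: IH.
apply/funext => x.
have /is_deriveE[_ ->]// := is_derive_add (is_derive_derive1 (df x)) (is_derive_derive1 (dg x)).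
Qed.

Lemma nsmoothM n f g : nsmooth n f -> nsmooth n g ->
  nsmooth n (fun x => f x * g x).
Proof.
elim: n f g => [//|n IH] f g sf sg; have [df sf'] := sf; have [dg sg'] := sg.
split; first by move=> x; apply: derivableM.
rewrite (_ : derive1 _ = fun x => derive1 f x * g x + f x * derive1 g x).
  by apply: nsmoothD; apply: IH => //; exact: nsmoothS.
apply/funext => x.
have /is_deriveE[_ ->]// := is_derive_mul (is_derive_derive1 (df x)) (is_derive_derive1 (dg x)).
Qed.

Lemma nsmooth_cst n (r : R) : nsmooth n (cst r).
Proof.
by elim: n r => [//|n IH] r; split=> //;
  rewrite (_ : derive1 _ = cst 0) ?funeqE// => x; rewrite derive1_cst.
Qed.

Lemma nsmoothB n f g : nsmooth n f -> nsmooth n g ->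
  nsmooth n (fun x => f x - g x).
Proof.
move=> sf sg; apply: nsmoothD => //.
rewrite (_ : (fun x => - g x) = fun x => cst (-1) x * g x).
  by apply: nsmoothM => //; exact: nsmooth_cst.
by apply/funext => x; rewrite /= mulN1r.
Qed.

Lemma nsmooth_affine n (r s : R) f : nsmooth n f -> nsmooth n (fun x => f (r * x + s)).
Proof.
elim: n f => [//|n IH] f [df sf].
have D (x : R) : is_derive x 1 (fun x => f (r * x + s)) (derive1 f (r * x + s) * r).
  apply: (@is_derive_comp1 _ f (fun x => r * x + s)).
    by apply/is_deriveE.
  have := is_derive_add (is_derive_mul (is_derive_cst r x 1) (is_derive_id x 1)) (is_derive_cst s
      x 1).
  by rewrite mul0r add0r mulr1 addr0.
split; first by move=> x; case: (D x).
rewrite (_ : derive1 _ = fun x => derive1 f (r * x + s) * cst r x).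
  apply: nsmoothM; first exact: IH.
  exact: nsmooth_cst.
by apply/funext => x; have /is_deriveE[_ ->] := D x.
Qed.

(** The polynomial is a parameter because the family $p(1/x)e^{-1/x}$ is stable under
    differentiation, with $p$ replaced by $X^2(p-p')$; smoothness at 0 then follows from
    differentiability of every member. *)
Definition flat p (x : R) : R := if 0 < x then p.[x^-1] * expR (- x^-1) else 0.

Lemma poly_expR_bounded p : exists C : R, forall t, 0 <= t -> `|p.[t] * expR (- t)| <= C.
Proof.
(* Each monomial is controlled by $t^i\le i!\,e^t$. *)
exists (\sum_(i < size p) `|p`_i| * (i`!)%:R) => t t0.
rewrite horner_coef mulr_suml (le_trans (ler_norm_sum _ _ _))// ler_sum// => i _.
rewrite -mulrA normrM ler_wpM2l// ger0_norm ?mulr_ge0 ?exprn_ge0 ?expR_ge0//.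
rewrite expRN ler_pdivrMr ?expR_gt0//.
case: (val i) => [|m].
  by rewrite expr0 fact0 mul1r -[leLHS]addr0 (le_trans _ (expR_ge1Dx t))// lerD.
have f0 : 0 < (m.+1`!)%:R :> R by rewrite ltr0n fact_gt0.
rewrite mulrC -ler_pdivrMr//.
by apply: le_trans (expR_ge1Dxn m t0); rewrite lerDr.
Qed.

Lemma is_derive_flat p x : is_derive x 1 (flat p) (flat ('X^2 * (p - p^`())) x).
Proof.
have [x0|x0|x0] := ltgtP 0 x.
- rewrite /flat x0.
  have D : is_derive x 1 (fun y : R => y^-1) (- 1 / x ^+ 2).
    by apply: (@is_derive_inv _ id); rewrite ?gt_eqF.
  apply: (@near_eq_is_derive _ _ _ (fun x => p.[x^-1] * expR (- x^-1))).
    near=> y; suff y0 : 0 < y by rewrite y0.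
    by near: y; apply: lt_nbhsr.
  apply: (is_derive_eq (is_derive_mul
    (@is_derive_comp1 _ (horner p) _ _ _ _ (is_derive_poly p x^-1) D)
    (is_derive_expR_comp (is_derive_opp D)))).
  rewrite !hornerE/= ; field; lra.
- rewrite /flat ltNge (ltW x0)/=.
  apply: (near_eq_is_derive (f := cst (0 : R))).
  near=> y; suff y0 : y < 0 by rewrite ltNge (ltW y0).
  by near: y; apply: lt_nbhsl.
- rewrite -x0 /flat ltxx.
  (* The extra $X^2$ supplies the $y^2$ of the remainder: $p(1/y)=y^2\cdot(X^2p)(1/y)$. *)
  have [C HC] := poly_expR_bounded ('X^2 * p).
  have C0 : 0 <= C by apply: le_trans (normr_ge0 _) (HC 0 _).
  apply: (@is_derive_quadratic_bound _ _ _ _ C 1) => // y _.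
  rewrite ltxx !subr0 mul0r subr0; case: ltP => y0; last first.
    by rewrite normr0 mulr_ge0 ?sqr_ge0.
  have yi : 0 <= y^-1 by rewrite invr_ge0 ltW.
  have := HC _ yi; rewrite hornerM hornerXn -mulrA normrM ger0_norm ?exprn_ge0//.
  by rewrite exprVn ler_pdivrMl ?exprn_gt0// [y ^+ 2 * C]mulrC.
Unshelve. all: by end_near. Qed.

Lemma smooth_flat p : smooth (flat p).
Proof.
move=> n; elim: n p => [//|n IH] p; split; first by move=> x; case: (is_derive_flat p x).
rewrite (_ : derive1 _ = flat ('X^2 * (p - p^`()))); first exact: IH.
by apply/funext => x; have /is_deriveE[_ ->] := is_derive_flat p x.
Qed.

(** A bump on $(0,1)$, left unnormalised: its integral is the constant [step 1] below. Its rescaled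
    copies average over intervals to the right of a point. *)
Definition mollifier (x : R) : R := flat 1 x * flat 1 ((-1) * x + 1).

Lemma smooth_mollifier : smooth mollifier.
Proof.
move=> n; apply: nsmoothM; first exact: smooth_flat.
by apply: (@nsmooth_affine _ _ _ (flat 1)); exact: smooth_flat.
Qed.

Lemma mollifier_ge0 x : 0 <= mollifier x.
Proof.
by rewrite mulr_ge0//; rewrite /flat; case: ifP => // _; rewrite hornerE mul1r expR_ge0.
Qed.

Lemma mollifier_eq0 x : x <= 0 \/ 1 <= x -> mollifier x = 0.
Proof.
rewrite /mollifier /flat; case=> x01.
  by rewrite ltNge x01 mul0r.
have -> : 0 < -1 * x + 1 = false by apply/negbTE; rewrite -leNgt; lra.
by rewrite mulr0.
Qed.

Lemma mollifier_le1 x : mollifier x <= 1.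
Proof.
have H y : 0 <= flat 1 y <= 1.
  rewrite /flat; case: ltP => y0; last by rewrite lexx ler01.
  by rewrite hornerE mul1r expR_ge0 expR_le1 oppr_le0 invr_ge0 ltW.
by rewrite /mollifier mulr_ile1//; case/andP: (H x); case/andP: (H (-1 * x + 1)).
Qed.

Lemma mollifier_gt0 x : 0 < x < 1 -> 0 < mollifier x.
Proof.
move=> /andP[x0 x1]; rewrite /mollifier /flat x0.
have -> : 0 < -1 * x + 1 by lra.
by rewrite !hornerC !mul1r mulr_gt0 ?expR_gt0.
Qed.

End Smooth.

(** * Integrals over intervals *)

Section Integrals.
Variable R : realType.
Local Notation mu := (@lebesgue_measure R).
Local Notation mset := (@measurable _ (measurableTypeR R)).
Implicit Types (f g : R -> R) (x y z : R).

Definition locint f := forall x y, mu.-integrable `[x, y] (EFin \o f).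

Lemma L2P f : L2 f <->
  measurable_fun setT f /\ mu.-integrable setT (EFin \o (fun x => f x ^+ 2)).
Proof.
split=> [Lf|[mf If]].
  split; first by move: Lf; rewrite /L2 inE => /andP[+ _]; rewrite inE.
  exact: Lfun2_integrable_sqr.
rewrite /L2 inE; apply/andP; rewrite !inE/=; split=> //.
rewrite /finite_norm unlock poweR_lty//.
have /integrableP[_] := If.
congr (_ < _)%E; apply: eq_integral => x _ /=.
by rewrite powR_mulrn// ger0_norm ?sqr_ge0// real_normK ?num_real.
Qed.

Lemma measurable_L2 f : L2 f -> measurable_fun setT f.
Proof. by case/L2P. Qed.

Lemma integrable_L2M f g : L2 f -> L2 g -> mu.-integrable setT (EFin \o (fun x => f x * g x)).
Proof. by move=> Lf Lg; apply/Lfun1_integrable; exact: Lfun2_mul_Lfun1. Qed.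

Lemma integrable_sub f (A B : set R) : mset A -> mset B -> A `<=` B ->
  mu.-integrable B (EFin \o f) -> mu.-integrable A (EFin \o f).
Proof. by move=> mA mB AB; exact: integrableS. Qed.

Lemma locint_integrable f : mu.-integrable setT (EFin \o f) -> locint f.
Proof. by move=> If x y; exact: integrable_sub If. Qed.

Lemma integrable_cst_itv (r x y : R) : mu.-integrable `[x, y] (EFin \o cst r).
Proof.
apply: continuous_compact_integrable; first exact: segment_compact.
by apply: continuous_subspaceT => ?; exact: cvg_cst.
Qed.

Lemma integrable_addF f g (A : set R) : mset A ->
  mu.-integrable A (EFin \o f) -> mu.-integrable A (EFin \o g) ->
  mu.-integrable A (EFin \o (fun x => f x + g x)).
Proof. by move=> mA If Ig; have := integrableD mA If Ig. Qed.

Lemma integrable_subF f g (A : set R) : mset A ->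
  mu.-integrable A (EFin \o f) -> mu.-integrable A (EFin \o g) ->
  mu.-integrable A (EFin \o (fun x => f x - g x)).
Proof. by move=> mA If Ig; have := integrableB mA If Ig. Qed.

Lemma integrable_scaleF (r : R) f (A : set R) : mset A ->
  mu.-integrable A (EFin \o f) ->
  mu.-integrable A (EFin \o (fun x => r * f x)).
Proof. by move=> mA If; have := integrableZl mA r If. Qed.

Lemma le_integrableF f g (A : set R) : mset A -> measurable_fun A f ->
  (forall x, A x -> `|f x| <= g x) ->
  mu.-integrable A (EFin \o g) -> mu.-integrable A (EFin \o f).
Proof.
move=> mA mf fg; apply: le_integrable => //; first exact/measurable_EFinP.
by move=> x Ax /=; rewrite lee_fin (le_trans (fg x Ax))// ler_norm.
Qed.

Lemma locint_L2 f : L2 f -> locint f.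
Proof.
move=> /L2P[mf If] x y; apply: (@le_integrableF _ (fun t => f t ^+ 2 + 1)) => //.
- exact: measurable_funTS.
- move=> t _; have : 0 <= (`|f t| - 1) ^+ 2 by exact: sqr_ge0.
  have := normr_ge0 (f t); rewrite -[f t ^+ 2]real_normK ?num_real//; nra.
- apply: integrable_addF => //; last exact: integrable_cst_itv.
  exact: integrable_sub If.
Qed.

Lemma locint_continuous f : continuous f -> locint f.
Proof.
move=> cf x y; apply: continuous_compact_integrable; first exact: segment_compact.
exact: continuous_subspaceT.
Qed.

Lemma continuous_measurable f : continuous f -> measurable_fun setT f.
Proof. exact: continuous_measurable_fun. Qed.

Definition Int f x y : R := \int[mu]_(t in `[x, y]) f t.

Lemma Int_cat f x y z : mu.-integrable `[x, z] (EFin \o f) -> x <= y -> y <= z ->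
  Int f x z = Int f x y + Int f y z.
Proof.
move=> If xy yz; apply/eqP; rewrite addrC -subr_eq; apply/eqP.
rewrite /Int Rintegral_itvB ?bnd_simp//.
rewrite Rintegral_itv_obnd_cbnd//.
apply: integrable_sub If => //; apply: subset_itv; rewrite bnd_simp//.
Qed.

Lemma Int_le0 f x y : y <= x -> Int f x y = 0.
Proof.
rewrite le_eqVlt => /orP[/eqP->|yx]; rewrite /Int.
  by rewrite set_itv1 Rintegral_set1.
by rewrite set_itv_ge ?Rintegral_set0// bnd_simp -ltNge.
Qed.

Lemma Int_cst (r : R) x y : x <= y -> Int (cst r) x y = r * (y - x).
Proof.
move=> xy; rewrite /Int Rintegral_cst//= lebesgue_measure_itv/= lte_fin.
have [//|yx] := ltP x y.
have -> : y = x by apply/eqP; rewrite eq_le xy yx.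
by rewrite subrr.
Qed.

(** [Int] is 0 when its bounds are reversed, so the primitive through 0 is assembled from both
    orientations. *)
Definition sint f x : R := Int f 0 x - Int f x 0.

Lemma sintB f x y : locint f -> x <= y -> sint f y - sint f x = Int f x y.
Proof.
move=> If xy; rewrite /sint.
have [x0|x0] := lerP 0 x.
  rewrite (Int_le0 f x0) (@Int_le0 f y 0) ?(le_trans x0)// !subr0.
  by rewrite (Int_cat (If 0 y) x0 xy) addrAC subrr add0r.
rewrite (@Int_le0 f 0 x) ?ltW// sub0r opprK.
have [y0|y0] := lerP 0 y.
  by rewrite (@Int_le0 f y 0)// subr0 addrC -Int_cat// ltW.
rewrite (@Int_le0 f 0 y) ?ltW// sub0r (Int_cat (If x 0) xy (ltW y0)) addrC -addrA.
by rewrite subrr addr0.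
Qed.

Lemma is_derive_sint f x : continuous f -> is_derive x 1 (sint f) (f x).
Proof.
move=> cf; have If := locint_continuous cf.
(* The fundamental theorem needs [x] in the interior, so the base point moves from 0 to the left of
   [x]. *)
pose A := x - 1.
have H : is_derive x 1 (fun y => Int f A y) (f x).
  have xx1 : x < x + 1 by rewrite ltrDl.
  have Ax : A < x by rewrite ltrBlDr ltrDl.
  by have /is_deriveE := continuous_FTC1_closed xx1 (If _ _) Ax (cf x).
have -> : f x = f x + 0 by rewrite addr0.
apply: (near_eq_is_derive (f := fun y => Int f A y + cst (sint f A) y)).
  near=> y; rewrite /= -(@sintB f A y) ?subrK//.
  suff : A < y by move/ltW.
  by near: y; apply: lt_nbhsr; rewrite ltrBlDr ltrDl.
Unshelve. all: by end_near. Qed.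

Lemma Int_FTC f (F : R -> R) x y : continuous f -> (forall t : R, is_derive t 1 F (f t)) -> x <=
    y ->
  Int f x y = F y - F x.
Proof.
move=> cf dF; rewrite le_eqVlt => /orP[/eqP->|xy]; first by rewrite Int_le0// subrr.
rewrite /Int /Rintegral (@continuous_FTC2 _ f F)//.
- exact: continuous_subspaceT.
- have cF t : {for t, continuous F} by exact: is_derive_continuous (dF t).
  split=> [t _||]; first by case: (dF t).
  + by apply: cvg_at_right_filter; exact: cF.
  + by apply: cvg_at_left_filter; exact: cF.
- by move=> t _; have /is_deriveE[] := dF t.
Qed.

Lemma Rint_support f x y : (forall t, ~ x <= t <= y -> f t = 0) ->
  \int[mu]_t f t = Int f x y.
Proof.
move=> f0; rewrite /Int [RHS]Rintegral_mkcond; apply: eq_Rintegral => t _.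
rewrite patchE; case: ifPn => // /negP tx; apply: f0 => H; apply: tx.
by rewrite inE/= in_itv.
Qed.

Lemma integrable_support f x y : (forall t, ~ x <= t <= y -> f t = 0) ->
  mu.-integrable `[x, y] (EFin \o f) -> mu.-integrable setT (EFin \o f).
Proof.
move=> f0 If.
have mI : mset `[x, y] by exact: measurable_itv.
have := (@integrable_mkcond _ _ _ mu _ (EFin \o f) mI).1 If.
apply: eq_integrable => // t _; rewrite patchE; case: ifPn => // /negP tx.
by rewrite /= f0// => H; apply: tx; rewrite inE/= in_itv.
Qed.

Lemma ae_eq_Rintegral f g (A : set R) : mset A ->
  measurable_fun A f -> measurable_fun A g ->
  {ae mu, forall x, f x = g x} -> \int[mu]_(x in A) f x = \int[mu]_(x in A) g x.
Proof.
move=> mA mf mg fg; congr fine; apply: ae_eq_integral => //; try exact/measurable_EFinP.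
case: fg => N [mN N0 sub]; exists N; split => // x /= H; apply: sub => /= fg.
by apply: H => _; rewrite fg.
Qed.

Lemma Int_le f g x y : mu.-integrable `[x, y] (EFin \o f) ->
  mu.-integrable `[x, y] (EFin \o g) ->
  (forall t, x <= t <= y -> f t <= g t) -> Int f x y <= Int g x y.
Proof.
by move=> If Ig fg; apply: le_Rintegral => // t; rewrite /= in_itv/=; exact: fg.
Qed.

Lemma Int_ge0 f x y : (forall t, x <= t <= y -> 0 <= f t) -> 0 <= Int f x y.
Proof. by move=> f0; apply: Rintegral_ge0 => t; rewrite /= in_itv/=; exact: f0. Qed.

Lemma le_Int_Rint f (A B : set R) : mset A -> mset B -> A `<=` B ->
  mu.-integrable B (EFin \o f) -> (forall t, 0 <= f t) ->
  \int[mu]_(t in A) f t <= \int[mu]_(t in B) f t.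
Proof.
move=> mA mB AB If f0; have IA := integrable_sub mA mB AB If.
rewrite /Rintegral fine_le//; try exact: integrable_fin_num.
apply: ge0_subset_integral => //; first exact: (measurable_int mu).
by move=> t _; rewrite lee_fin.
Qed.

End Integrals.

(** * Weak derivatives *)

Section WeakDerivative.
Variable R : realType.
Local Notation mu := (@lebesgue_measure R).
Local Notation mset := (@measurable _ (measurableTypeR R)).
Implicit Types (f g : R -> R) (x y z e t : R).

Lemma Int_abs_le f x y : locint f -> `|Int f x y| <= Int (fun t => `|f t|) x y.
Proof. by move=> If; apply: le_normr_Rintegral => //; exact: If. Qed.

Lemma locint_abs f : locint f -> locint (fun t => `|f t|).
Proof. by move=> If x y; apply: integrable_norm; exact: If. Qed.

Lemma locint_cst (r : R) : locint (cst r).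
Proof. by move=> x y; exact: integrable_cst_itv. Qed.

Lemma locintB f g : locint f -> locint g -> locint (fun t => f t - g t).
Proof. by move=> If Ig x y; apply: integrable_subF. Qed.

Lemma locintD f g : locint f -> locint g -> locint (fun t => f t + g t).
Proof. by move=> If Ig x y; apply: integrable_addF. Qed.

Lemma locintZ (r : R) f : locint f -> locint (fun t => r * f t).
Proof. by move=> If x y; apply: integrable_scaleF. Qed.

Lemma IntZ (r : R) f x y : locint f -> Int (fun t => r * f t) x y = r * Int f x y.
Proof. by move=> If; rewrite /Int RintegralZl. Qed.

Lemma IntD f g x y : locint f -> locint g ->
  Int (fun t => f t + g t) x y = Int f x y + Int g x y.
Proof. by move=> If Ig; rewrite /Int RintegralD. Qed.

Lemma IntB f g x y : locint f -> locint g ->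
  Int (fun t => f t - g t) x y = Int f x y - Int g x y.
Proof. by move=> If Ig; rewrite /Int RintegralB. Qed.

Lemma eq_Int f g x y : (forall t, x <= t <= y -> f t = g t) -> Int f x y = Int g x y.
Proof. by move=> fg; apply: eq_Rintegral => t; rewrite inE/= in_itv/=; exact: fg. Qed.

Lemma locintM_bounded f h (C : R) : locint f -> measurable_fun setT f -> continuous h ->
  (forall t, `|h t| <= C) -> locint (fun t => f t * h t).
Proof.
move=> If mf ch hC x y; apply: (@le_integrableF _ _ (fun t => C * `|f t|)) => //.
- apply: measurable_funTS; apply: measurable_funM => //; exact: continuous_measurable.
- by move=> t _; rewrite normrM mulrC ler_wpM2r.
- by apply: locintZ; exact: locint_abs.
Qed.

(** Young's inequality $s|f|\le(f^2+s^2)/2$ stands in for Cauchy-Schwarz: over a length at most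
    $s^{-2}$ it gives $s\int|f|\le G+1=s\,\eta$. *)
Lemma L2_Int_small f (eta : R) : L2 f -> 0 < eta ->
  exists2 d : R, 0 < d & forall x y, x <= y <= x + d -> Int (fun t => `|f t|) x y <= eta.
Proof.
move=> Lf e0; have [mf If] := (L2P f).1 Lf.
have Ia : locint (fun t => `|f t|) by apply: locint_abs; exact: locint_L2.
have I2 : locint (fun t => f t ^+ 2) by exact: locint_integrable.
set G := \int[mu]_t (f t ^+ 2).
have G0 : 0 <= G by apply: Rintegral_ge0 => t _; exact: sqr_ge0.
pose s := (G + 1) / eta.
have s0 : 0 < s by rewrite divr_gt0// ltr_wpDl.
have s20 : 0 < s ^+ 2 by rewrite exprn_gt0.
exists (s ^+ 2)^-1; first by rewrite invr_gt0.
move=> x y /andP[xy yd].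
have : s * Int (fun t => `|f t|) x y <= 2^-1 * G + 2^-1 * (s ^+ 2 * (y - x)).
  rewrite -IntZ// -(Int_cst _ xy).
  apply: (@le_trans _ _ (Int (fun t => 2^-1 * f t ^+ 2 + 2^-1 * cst (s ^+ 2) t) x y)).
    apply: Int_le => [||t _].
    - exact: locintZ.
    - by apply: locintD; apply: locintZ => //; exact: locint_cst.
    - rewrite /= -[f t ^+ 2]real_normK ?num_real//.
      by have := sqr_ge0 (s - `|f t|); rewrite sqrrB; nra.
  rewrite IntD ?IntZ//; try exact: locintZ; try exact: locint_cst.
  - rewrite lerD2r ler_wpM2l// ?invr_ge0//.
    apply: le_Int_Rint => // t; exact: sqr_ge0.
  - by apply: locintZ; exact: locint_cst.
move=> H.
have H2 : s ^+ 2 * (y - x) <= 1.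
  by rewrite mulrC -ler_pdivlMr// div1r lerBlDl.
have : s * Int (fun t => `|f t|) x y <= G + 1 by lra.
by rewrite -ler_pdivlMl// /s invfM invrK mulrAC mulVf ?mul1r// gt_eqF// ltr_wpDl.
Qed.

Lemma continuous_sint_L2 f : L2 f -> continuous (sint f).
Proof.
move=> Lf x; have If := locint_L2 Lf.
apply/cvgrPdist_le => eta e0.
have [d d0 H] := L2_Int_small Lf e0.
near=> y.
have yd : `|x - y| <= d.
  near: y; apply/nbhs_ballP; exists d => //= z; rewrite /ball/=; exact: ltW.
have B u v : u <= v <= u + d -> `|sint f v - sint f u| <= eta.
  move=> /andP[uv vd]; rewrite sintB//; apply: le_trans (Int_abs_le _ _ If) _.
  by apply: H; rewrite uv.
have [xy|/ltW yx] := lerP x y.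
  by rewrite distrC B// xy; move: yd; rewrite distrC ler_norml; lra.
by rewrite B// yx; move: yd; rewrite ler_norml; lra.
Unshelve. all: by end_near. Qed.

Lemma L2_locally_integrable f : L2 f -> locally_integrable setT f.
Proof.
move=> Lf; split; [exact: measurable_L2|exact: openT|move=> K _ cK].
have [M [_ HM]] := compact_bounded cK.
have If : mu.-integrable `[- (M + 1), M + 1] (EFin \o f) by exact: locint_L2.
have /integrableP[_] := If; apply: le_lt_trans.
apply: ge0_subset_integral => //.
- exact: compact_measurable.
- apply/measurable_EFinP; apply: measurableT_comp => //.
  exact: measurable_funTS (measurable_L2 Lf).
- move=> t Kt; have : `|t| <= M + 1 by apply: HM => //; rewrite ltrDl.
  by rewrite /= in_itv/= ler_norml.
Qed.

Lemma lebesgue_pt_Int f x (eta : R) : L2 f -> lebesgue_pt f x -> 0 < eta ->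
  exists2 d : R, 0 < d &
    forall e, 0 < e < d -> Int (fun t => `|f t - f x|) x (x + e) <= eta * e.
Proof.
move=> Lf Hx e0.
have If : locint (fun t => `|f t - f x|).
  by apply: locint_abs; apply: locintB; [exact: locint_L2|exact: locint_cst].
(* The ball of radius $2e$ contains the closed interval $[x,x+e]$ and has measure $4e$, whence the
   factor 4. *)
have : \forall r \near (0 : R)^'+, (davg f x r < (eta / 4)%:E)%E.
  move/fine_cvgP : Hx => [Hfin].
  move/cvgrPdist_lt => /(_ (eta / 4)).
  rewrite divr_gt0// => /(_ isT) Hd.
  near=> r; have fr : davg f x r \is a fin_num by near: r.
  rewrite -(fineK fr) lte_fin.
  have : `|0 - (fine \o davg f x) r| < eta / 4 by near: r.
  by rewrite sub0r normrN /=; exact: le_lt_trans (ler_norm _).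
move=> [d /= d0 Hd]; exists (d / 2); first by rewrite divr_gt0.
move=> e /andP[e1 ed].
have e20 : 0 < 2 * e by rewrite mulr_gt0.
have := Hd (2 * e); rewrite /ball/= sub0r normrN gtr0_norm// => /(_ ltac:(lra) e20).
have Ib : mu.-integrable (ball x (2 * e)) (EFin \o (fun t => `|f t - f x|)).
  apply: integrable_sub (If (x - 2 * e) (x + 2 * e)) => //.
    exact: measurable_ball.
  by move=> t; rewrite /ball/= in_itv/= ltr_norml; lra.
rewrite /davg /iavg (lebesgue_measure_ball _ (ltW e20)).
rewrite -[X in (_ * X < _)%E](@fineK R); last by apply: (integrable_fin_num _ Ib); exact:
    measurable_ball.
set J := fine _.
rewrite inver gt_eqF ?mulrn_wgt0// -EFinM lte_fin => HJ.
apply: (@le_trans _ _ J).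
  apply: le_Int_Rint => //; first exact: measurable_ball.
  by move=> t; rewrite /ball/= in_itv/= ltr_norml; lra.
move: HJ; rewrite ltr_pdivrMl ?mulrn_wgt0// ; rewrite mulr2n; lra.
Unshelve. all: by end_near. Qed.

Definition step := sint (@mollifier R).

Lemma continuous_mollifier : continuous (@mollifier R).
Proof.
move=> x; have [D _] := smooth_mollifier R 1.
exact: is_derive_continuous (is_derive_derive1 (D x)).
Qed.

Lemma is_derive_step x : is_derive x 1 step (mollifier x).
Proof. exact: is_derive_sint continuous_mollifier. Qed.

Lemma step_MVT x y : x <= y -> exists2 z, z \in `[x, y]%R & step y - step x = mollifier z * (y -
    x).
Proof.
move=> xy; apply: MVT_segment => // [z _|]; first exact: is_derive_step.
by apply: continuous_subspaceT => z; exact: is_derive_continuous (is_derive_step z).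
Qed.

Lemma step_le0 x : x <= 0 -> step x = 0.
Proof.
move=> x0; have [z] := step_MVT x0; rewrite in_itv/= => /andP[_ z0].
rewrite mollifier_eq0 ?mul0r; last by left.
by rewrite /step /sint Int_le0// subrr sub0r => /eqP; rewrite oppr_eq0 => /eqP.
Qed.

Lemma step_ge1 x : 1 <= x -> step x = step 1.
Proof.
move=> x1; have [z] := step_MVT x1; rewrite in_itv/= => /andP[z1 _].
rewrite mollifier_eq0 ?mul0r; last by right.
by move/eqP; rewrite subr_eq0 => /eqP.
Qed.

Lemma step_homo x y : x <= y -> step x <= step y.
Proof.
move=> xy; have [z _ H] := step_MVT xy.
by rewrite -subr_ge0 H mulr_ge0 ?mollifier_ge0// subr_ge0.
Qed.

Lemma step_bounds x : 0 <= step x <= step 1.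
Proof.
have [x0|x0] := lerP x 0.
  by rewrite step_le0// lexx/= -(step_le0 (lexx 0)) step_homo.
rewrite -(step_le0 (lexx 0)) (step_homo (ltW x0))/=.
have [x1|x1] := lerP 1 x; first by rewrite (step_ge1 x1).
by rewrite step_homo// ltW.
Qed.

Lemma step1_gt0 : 0 < step 1.
Proof.
have [|z z01 H] := @MVT R step (@mollifier R) 0 1 ltr01 (fun z _ => is_derive_step z).
  by apply: continuous_subspaceT => z; exact: is_derive_continuous (is_derive_step z).
move: z01; rewrite in_itv/= => /mollifier_gt0 b0.
by rewrite -(subr0 (step 1)) -{2}(step_le0 (lexx 0)) H subr0 mulr1.
Qed.

Lemma smooth_step : smooth step.
Proof.
case=> [//|n]; split=> [x|]; first by case: (is_derive_step x).
rewrite (_ : derive1 _ = @mollifier R); first exact: smooth_mollifier.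
by apply/funext => x; have /is_deriveE[_ ->] := is_derive_step x.
Qed.

(** It climbs on $[x,x+e]$, equals [step 1] up to $y$ and descends on $[y,y+e]$, provided $e\le
    y-x$. Its derivative is a difference of two scaled bumps, so testing with it compares averages
    of $f$ near $x$ and near $y$. *)
Definition plateau e x y t := step (e^-1 * t + - (x / e)) - step (e^-1 * t + - (y / e)).

Lemma is_derive_plateau e x y t :
  is_derive t 1 (plateau e x y)
    ((mollifier (e^-1 * t + - (x / e)) - mollifier (e^-1 * t + - (y / e))) / e).
Proof.
have D z : is_derive t 1 (fun t => step (e^-1 * t + z)) (mollifier (e^-1 * t + z) / e).
  apply: (@is_derive_comp1 _ step (fun t => e^-1 * t + z)); first exact: is_derive_step.
  have := is_derive_add (is_derive_mul (is_derive_cst e^-1 t 1) (is_derive_id t 1))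
      (is_derive_cst z t 1).
  by rewrite mul0r add0r mulr1 addr0.
by apply: is_derive_eq (is_derive_sub (D _) (D _)) _; rewrite mulrBl.
Qed.

Lemma plateau_supp e x y t : 0 < e -> x <= y -> ~ (x <= t <= y + e) -> plateau e x y t = 0.
Proof.
move=> e0 xy H; rewrite /plateau.
have [tx|tx] := lerP t x.
  rewrite !step_le0 ?subrr// mulrC -mulrBl.
  - by rewrite mulr_le0_ge0 ?invr_ge0 ?(ltW e0)//; lra.
  - by rewrite mulr_le0_ge0 ?invr_ge0 ?(ltW e0)//; lra.
have ty : y + e < t by rewrite ltNge; apply/negP => ?; apply: H; rewrite ltW.
rewrite step_ge1 ?[X in _ - X]step_ge1 ?subrr//.
- by rewrite mulrC -mulrBl ler_pdivlMr//; lra.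
- by rewrite mulrC -mulrBl ler_pdivlMr//; lra.
Qed.

Lemma test_plateau e x y : 0 < e -> x <= y -> test_function (plateau e x y).
Proof.
move=> e0 xy; split.
  apply: smooth_derive1n => n; apply: nsmoothB.
    by apply: (@nsmooth_affine _ _ _ _ step); exact: smooth_step.
  by apply: (@nsmooth_affine _ _ _ _ step); exact: smooth_step.
apply: (@subclosed_compact _ _ `[x, y + e]); first exact: closed_closure.
  exact: segment_compact.
have cI : closed (`[x, y + e] : set R).
  by apply: compact_closed; [exact: Rhausdorff|exact: segment_compact].
have -> : `[x, y + e]%classic = closure (`[x, y + e]%classic : set R) by exact/closure_id.
apply: closureS => t /= Ht.
by rewrite in_itv/=; apply/negPn/negP => H; move/eqP: Ht; apply; apply: plateau_supp => //;
    exact/negP.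
Qed.

Lemma scaled_mollifier_eq0 e x t : 0 < e -> ~ x <= t <= x + e ->
  mollifier (e^-1 * t + - (x / e)) = 0.
Proof.
move=> e0 H; rewrite mollifier_eq0// mulrC -mulrBl.
have [tx|tx] := lerP t x; [left|right].
  by rewrite mulr_le0_ge0 ?invr_ge0 ?(ltW e0)//; lra.
have ty : x + e < t by rewrite ltNge; apply/negP => ?; apply: H; rewrite ltW.
by rewrite ler_pdivlMr//; lra.
Qed.

Lemma continuous_scaled_mollifier e x :
  continuous (fun t : R => mollifier (e^-1 * t + - (x / e)) / e).
Proof.
move=> t; apply: is_derive_continuous.
apply: is_derive_mul (is_derive_cst _ _ _).
have [D _] := @nsmooth_affine _ 1 e^-1 (- (x / e)) _ (smooth_mollifier R 1).
exact: is_derive_derive1 (D t).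
Qed.

(** The scaled bump has integral [step 1] and is at most $1/e$, so the error is at most the mean of
    $|f-f(x)|$ over $[x,x+e]$. *)
Lemma mollify_lebesgue_pt f x (eta : R) : L2 f -> lebesgue_pt f x -> 0 < eta ->
  exists2 d : R, 0 < d & forall e, 0 < e < d ->
    `|\int[mu]_t (f t * (mollifier (e^-1 * t + - (x / e)) / e)) - step 1 * f x| <= eta.
Proof.
move=> Lf Hx e0; have [d d0 H] := lebesgue_pt_Int Lf Hx e0; exists d => // e ed.
have ep : 0 < e by case/andP: ed.
pose b t := mollifier (e^-1 * t + - (x / e)) / e.
have cb : continuous b by exact: continuous_scaled_mollifier.
have b0 t : 0 <= b t by rewrite mulr_ge0 ?mollifier_ge0// invr_ge0 ltW.
have be t : `|b t| <= e^-1.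
  by rewrite ger0_norm// -[leRHS]mul1r ler_wpM2r ?mollifier_le1// invr_ge0 ltW.
have If := locint_L2 Lf; have mf := measurable_L2 Lf.
rewrite (@Rint_support _ _ x (x + e)); last first.
  by move=> t /(scaled_mollifier_eq0 ep) ->; rewrite mul0r mulr0.
have dF t : is_derive t 1 (fun t => step (e^-1 * t + - (x / e))) (b t).
  apply: (@is_derive_comp1 _ step (fun t => e^-1 * t + - (x / e))).
    exact: is_derive_step.
  have := is_derive_add (is_derive_mul (is_derive_cst e^-1 t 1) (is_derive_id t 1))
      (is_derive_cst (- (x / e)) t 1).
  by rewrite mul0r add0r mulr1 addr0.
have Ib : Int b x (x + e) = step 1.
  rewrite (Int_FTC cb dF); last by rewrite lerDl ltW.
  rewrite [e^-1 * (x + e)]mulrC [e^-1 * x]mulrC subrr -mulrBl.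
  by rewrite (step_le0 (lexx 0)) subr0; congr step; field; rewrite gt_eqF.
have Ifb : locint (fun t => f t * b t) by exact: locintM_bounded be.
have Ixb : locint (fun t => f x * b t) by apply: locintZ; exact: locint_continuous.
rewrite -Ib (mulrC (Int b _ _)) -IntZ; last exact: locint_continuous.
rewrite -IntB//.
apply: le_trans (Int_abs_le _ _ _) _; first exact: locintB.
apply: (@le_trans _ _ (Int (fun t => e^-1 * `|f t - f x|) x (x + e))).
  apply: Int_le => [||t _].
  - by apply: locint_abs; exact: locintB.
  - by apply: locintZ; apply: locint_abs; apply: locintB => //; exact: locint_cst.
  - by rewrite -mulrBl normrM mulrC; apply: ler_wpM2r => //; exact: be.
rewrite IntZ; last by apply: locint_abs; apply: locintB => //; exact: locint_cst.
by rewrite mulrC ler_pdivrMr// H.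
Qed.

(** The plateau differs from a multiple of the indicator of $[x,y]$ only on two ramps of length [e],
    and absolute continuity of the integral makes each of them cost at most $\eta/2$. *)
Lemma plateau_Int g x y (eta : R) : L2 g -> x < y -> 0 < eta ->
  exists2 d : R, 0 < d & forall e, 0 < e < d ->
    `|\int[mu]_t (g t * plateau e x y t) - step 1 * Int g x y| <= eta.
Proof.
move=> Lg xy e0; have Ig := locint_L2 Lg; have mg := measurable_L2 Lg.
have s0 := step1_gt0.
have [d d0 H] := L2_Int_small Lg (divr_gt0 (divr_gt0 e0 s0) (ltr0n _ 2)).
exists (Num.min d (y - x)); first by rewrite lt_min d0 subr_gt0.
move=> e; rewrite lt_min => /andP[ep /andP[ed eyx]].
rewrite (@Rint_support _ _ x (y + e)); last first.
  by move=> t Ht; rewrite plateau_supp ?mulr0// ltW.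
have cp : continuous (plateau e x y).
  by move=> t; exact: is_derive_continuous (is_derive_plateau e x y t).
have pb t : `|plateau e x y t| <= step 1.
  rewrite /plateau ler_norml.
  by have /andP[? ?] := step_bounds (e^-1 * t + - (x / e));
     have /andP[? ?] := step_bounds (e^-1 * t + - (y / e)); lra.
have Igp : locint (fun t => g t * plateau e x y t) by exact: locintM_bounded pb.
have p1 t : x + e <= t <= y -> plateau e x y t = step 1.
  move=> /andP[xt ty]; rewrite /plateau (@step_ge1 (e^-1 * t + - (x / e))); last first.
    by rewrite mulrC -mulrBl ler_pdivlMr//; lra.
  rewrite (@step_le0 (e^-1 * t + - (y / e))) ?subr0// mulrC -mulrBl.
  by rewrite mulr_le0_ge0 ?invr_ge0 ?(ltW ep)//; lra.
have p2 t : t <= y -> 0 <= plateau e x y t.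
  move=> ty; rewrite /plateau subr_ge0; apply: step_homo.
  by rewrite lerD2l lerN2 ler_pM2r ?invr_gt0// ltW.
have xe : x <= x + e by rewrite lerDl ltW.
have xey : x + e <= y by lra.
have ye : y <= y + e by rewrite lerDl ltW.
rewrite (Int_cat (Igp _ _) xe) ?(le_trans xey)// (Int_cat (Igp _ _) xey)//.
rewrite [Int g x y](Int_cat (Ig _ _) xe)//.
rewrite (@eq_Int _ (fun t => step 1 * g t) (x + e) y); last first.
  by move=> t /p1 ->; rewrite mulrC.
rewrite IntZ//.
set A := Int _ x (x + e); set B := Int _ (x + e) y; set C := Int _ y (y + e).
set D := Int g x (x + e).
have -> : A + (step 1 * B + C) - step 1 * (D + B) = (A - step 1 * D) + C by ring.
have h x0 : Int (fun t => `|g t|) x0 (x0 + e) <= eta / step 1 / 2.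
  by apply: H; rewrite lerDl lerD2l !ltW.
have hA : `|A - step 1 * D| <= eta / 2.
  rewrite /A /D -IntZ// -IntB//; last exact: locintZ.
  have I1 : locint (fun t => g t * plateau e x y t - step 1 * g t).
    by apply: locintB => //; exact: locintZ.
  apply: le_trans (Int_abs_le _ _ I1) _.
  apply: (@le_trans _ _ (Int (fun t => step 1 * `|g t|) x (x + e))).
    apply: Int_le => [||t /andP[_ te]]; first exact: locint_abs.
      by apply: locintZ; exact: locint_abs.
    rewrite mulrC -mulrBl normrM ler_wpM2r//.
    have := pb t; have := p2 t; rewrite !ler_norml => /(_ ltac:(lra)); lra.
  rewrite IntZ; last exact: locint_abs.
  have := h x; rewrite -(ler_pM2l s0) => /le_trans; apply.
  by rewrite le_eqVlt; apply/orP; left; apply/eqP; field; rewrite gt_eqF.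
have hC : `|C| <= eta / 2.
  apply: le_trans (Int_abs_le _ _ Igp) _.
  apply: (@le_trans _ _ (Int (fun t => step 1 * `|g t|) y (y + e))).
    apply: Int_le => [||t _]; first exact: locint_abs.
      by apply: locintZ; exact: locint_abs.
    by rewrite normrM mulrC ler_wpM2r.
  rewrite IntZ; last exact: locint_abs.
  have := h y; rewrite -(ler_pM2l s0) => /le_trans; apply.
  by rewrite le_eqVlt; apply/orP; left; apply/eqP; field; rewrite gt_eqF.
by apply: le_trans (ler_normD _ _) _; lra.
Qed.

(* Testing against smoothed indicators of [x, y] and letting the smoothing width tend to 0. *)
Lemma weak_derivative_Int f g x y : L2 f -> L2 g -> weak_derivative f g ->
  lebesgue_pt f x -> lebesgue_pt f y -> x < y -> f y - f x = Int g x y.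
Proof.
move=> Lf Lg W px py xy.
have s0 := step1_gt0.
suff : forall eta : R, 0 < eta -> `|step 1 * (f y - f x - Int g x y)| <= eta.
  move=> H; apply/eqP; rewrite -subr_eq0; apply/negPn/negP => n0.
  have := H (`|step 1 * (f y - f x - Int g x y)| / 2).
  have : 0 < `|step 1 * (f y - f x - Int g x y)|.
    by rewrite normr_gt0 mulf_neq0// gt_eqF.
  by move=> z0 /(_ ltac:(lra)); lra.
move=> eta e0; have e3 : 0 < eta / 3 by rewrite divr_gt0.
have [d1 d10 H1] := mollify_lebesgue_pt Lf px e3.
have [d2 d20 H2] := mollify_lebesgue_pt Lf py e3.
have [d3 d30 H3] := plateau_Int Lg xy e3.
pose e := Num.min d1 (Num.min d2 d3) / 2.
have ep : 0 < e by rewrite divr_gt0// !lt_min d10 d20.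
have [e1 e2 e4] : [/\ e < d1, e < d2 & e < d3].
  have h : e < Num.min d1 (Num.min d2 d3) by rewrite /e; rewrite /e in ep; lra.
  by move: h; rewrite !lt_min => /and3P[].
have {}H1 := H1 e; have {}H2 := H2 e; have {}H3 := H3 e.
rewrite ep in H1 H2 H3; have {}H1 := H1 e1; have {}H2 := H2 e2; have {}H3 := H3 e4.
have := W _ (test_plateau ep (ltW xy)).
have -> : derive1 (plateau e x y) =
    fun t => mollifier (e^-1 * t + - (x / e)) / e - mollifier (e^-1 * t + - (y / e)) / e.
  by apply/funext => t; have /is_deriveE[_ ->] := is_derive_plateau e x y t; rewrite mulrBl.
have Ifb z : mu.-integrable setT (EFin \o (fun t => f t * (mollifier (e^-1 * t + - (z / e)) /
    e))).
  apply: (@integrable_support _ _ z (z + e)).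
    by move=> t /(scaled_mollifier_eq0 ep) ->; rewrite mul0r mulr0.
  apply: (@locintM_bounded f (fun t => mollifier (e^-1 * t + - (z / e)) / e) e^-1).
  - exact: locint_L2.
  - exact: measurable_L2.
  - exact: continuous_scaled_mollifier.
  - move=> t; rewrite ger0_norm; last by rewrite mulr_ge0 ?mollifier_ge0// invr_ge0 ltW.
    by rewrite -[leRHS]mul1r ler_wpM2r ?mollifier_le1// invr_ge0 ltW.
under eq_Rintegral do rewrite mulrBr.
rewrite (RintegralB _ (Ifb x) (Ifb y))//.
move: H1 H2 H3.
set A := Rintegral _ _ _; set B := Rintegral _ _ _; set C := Rintegral _ _ _.
rewrite !ler_norml => /andP[a1 a2] /andP[b1 b2] /andP[c1 c2] ABC.
rewrite !mulrBr; apply/andP; split; lra.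
Qed.

Lemma ae_exists_itv (P : R -> Prop) x y : x < y -> {ae mu, forall t, P t} ->
  exists2 t, x <= t <= y & P t.
Proof.
move=> xy [N [mN N0 sub]]; apply: contrapT => H.
have : (mu `[x, y] <= mu N)%E.
  apply: le_measure; rewrite ?inE//= => t /=; rewrite in_itv/= => txy.
  by apply: sub => /= Pt; apply: H; exists t.
rewrite N0 lebesgue_measure_itv/= lte_fin xy -EFinB lee_fin.
by rewrite leNgt subr_gt0 xy.
Qed.

Lemma continuous_ae_eq f g : continuous f -> continuous g ->
  {ae mu, forall t, f t = g t} -> f = g.
Proof.
move=> cf cg fg; apply/funext => x; apply/eqP; rewrite -subr_eq0; apply/negPn/negP => n0.
have ch : continuous (fun t => f t - g t) by move=> t; apply: cvgB; [exact: cf|exact: cg].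
have /cvgrPdist_lt/(_ `|f x - g x|) := ch x; rewrite normr_gt0 => /(_ n0).
rewrite near_simpl => /nbhs_ballP[d /= d0 Hd].
have xd : x < x + d / 2 by rewrite ltrDl divr_gt0.
have [t /andP[xt td] ft] := ae_exists_itv xd fg.
have := Hd t; rewrite /ball/= => /(_ _)/wrap[|].
  by rewrite distrC ger0_norm ?subr_ge0//; lra.
by rewrite ft subrr subr0 ltxx.
Qed.

(* Integration starts at a Lebesgue point, so that the primitive of g agrees with f
   almost everywhere without adjusting a constant. *)
Lemma H1_representative f g : L2 f -> L2 g -> weak_derivative f g ->
  exists h : R -> R, [/\ continuous h, {ae mu, forall t, f t = h t} &
    forall x y, x <= y -> h y - h x = Int g x y].
Proof.
move=> Lf Lg W.
have ae := lebesgue_differentiation (L2_locally_integrable Lf).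
have [x0 px0] : exists x0, lebesgue_pt f x0.
  by have [t _ pt] := ae_exists_itv (ltr01 : 0 < 1 :> R) ae; exists t.
exists (fun x => f x0 + (sint g x - sint g x0)); split.
- move=> x; apply: cvgD; first exact: cvg_cst.
  by apply: cvgB; [exact: continuous_sint_L2|exact: cvg_cst].
- case: ae => N [mN N0 sub]; exists N; split=> // t /= H; apply: sub => /= pt; apply: H.
  have Ig := locint_L2 Lg.
  have [tx|tx|->] := ltgtP t x0; last by rewrite subrr addr0.
  + rewrite -opprB (sintB Ig (ltW tx)) -(weak_derivative_Int Lf Lg W pt px0 tx).
    by rewrite opprB addrCA subrr addr0.
  + by rewrite (sintB Ig (ltW tx)) -(weak_derivative_Int Lf Lg W px0 pt tx) addrCA subrr addr0.
- by move=> x y xy; rewrite -(sintB (locint_L2 Lg) xy); ring.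
Qed.

End WeakDerivative.

(** * The cubic potential *)

Section Potential.
Variables (R : realType) (a b c : R).
Hypotheses (ha : 0 < a) (hc : 0 < c) (hb : b ^+ 2 < 3 * (a * c)).
Implicit Types (s t v w y k : R).

Definition cubic v := a * v ^+ 3 + b * v ^+ 2 + c * v.
Definition dcubic v := 3 * a * v ^+ 2 + 2 * b * v + c.
Definition quadr v := a * v ^+ 2 + b * v + c.
(** The divided difference of the cubic, as [cubicB] records. *)
Definition slope v w := a * (v ^+ 2 + v * w + w ^+ 2) + b * (v + w) + c.
(** The minimum of $P'$, attained at $-b/(3a)$; it is positive exactly because $\sigma<3$. *)
Definition kappa := c - b ^+ 2 / (3 * a).

Lemma kappa_gt0 : 0 < kappa.
Proof. rewrite subr_gt0 ltr_pdivrMr ?mulr_gt0//. by move: hb; lra. Qed.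

(** Complete the squares in $v+w$ and $v-w$. A bound uniform in both arguments yields monotonicity
    of $P$ and continuity of its inverse at once. *)
Lemma slope_ge v w : kappa <= slope v w.
Proof.
have a0 : a != 0 by rewrite gt_eqF.
have -> : slope v w = kappa + (3 * a / 4 * (v + w + 2 * b / (3 * a)) ^+ 2 + a / 4 * (v - w) ^+ 2).
  by rewrite /slope /kappa; field.
have := ltW ha => a0'.
by rewrite lerDl addr_ge0// mulr_ge0 ?sqr_ge0// divr_ge0// mulr_ge0.
Qed.

Lemma slope_gt0 v w : 0 < slope v w.
Proof. exact: lt_le_trans kappa_gt0 (slope_ge v w). Qed.

Lemma dcubic_slope v : dcubic v = slope v v.
Proof. by rewrite /dcubic /slope; ring. Qed.

Lemma dcubic_gt0 v : 0 < dcubic v.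
Proof. by rewrite dcubic_slope slope_gt0. Qed.

Lemma quadr_gt0 v : 0 < quadr v.
Proof. by have := slope_gt0 v 0; rewrite /slope /quadr; congr (_ < _); ring. Qed.

Lemma cubicE v : cubic v = v * quadr v.
Proof. by rewrite /cubic /quadr; ring. Qed.

Lemma cubicB v w : cubic v - cubic w = slope v w * (v - w).
Proof. by rewrite /cubic /slope; ring. Qed.

Lemma cubic_lt v w : (cubic v < cubic w) = (v < w).
Proof.
by rewrite -subr_gt0 cubicB pmulr_rgt0 ?slope_gt0// subr_gt0.
Qed.

Lemma cubic_le v w : (cubic v <= cubic w) = (v <= w).
Proof. by rewrite !leNgt cubic_lt. Qed.

Lemma cubic_inj : injective cubic.
Proof. by move=> v w vw; apply/eqP; rewrite eq_le -(cubic_le v w) -(cubic_le w v) vw lexx. Qed.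

Lemma is_derive_cubic v : is_derive v 1 cubic (dcubic v).
Proof.
apply: (@is_derive_quadratic_bound _ cubic v (dcubic v) (`|3 * a * v + b| + a * 1) 1) => // w wv.
have -> : cubic w - cubic v - dcubic v * (w - v) = (3 * a * v + b + a * (w - v)) * (w - v) ^+ 2.
  by rewrite /cubic /dcubic; ring.
rewrite normrM [`|_ ^+ 2|]ger0_norm ?sqr_ge0// ler_wpM2r ?sqr_ge0//.
rewrite (le_trans (ler_normD _ _))// lerD2l normrM gtr0_norm// ler_wpM2l//; exact: ltW.
Qed.

Variable V : R -> R.
Hypothesis hV : forall s, 0 <= s -> s ^+ 2 = a * V s ^+ 3 + b * V s ^+ 2 + c * V s.

(** The even extension: [V] is constrained only on $s\ge0$, while the calculus below, notably at 0,
    needs a function on the whole line. *)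
Definition Ve s := V `|s|.

Lemma cubic_Ve s : cubic (Ve s) = s ^+ 2.
Proof. by rewrite /cubic -hV// real_normK ?num_real. Qed.

Lemma Ve_le s t : (Ve s <= Ve t) = (`|s| <= `|t|).
Proof. by rewrite -cubic_le !cubic_Ve -[s ^+ 2]real_normK ?num_real// -[t ^+ 2]real_normK
    ?num_real// ler_sqr. Qed.

Lemma Ve0 : Ve 0 = 0.
Proof. by apply: cubic_inj; rewrite cubic_Ve cubicE mul0r expr0n. Qed.

Lemma Ve_ge0 s : 0 <= Ve s.
Proof. by rewrite -Ve0 Ve_le normr0. Qed.

Lemma Ve_gt0 s : s != 0 -> 0 < Ve s.
Proof. by move=> s0; rewrite -Ve0 ltNge Ve_le normr0 normr_le0. Qed.

Lemma Ve_sqrt v : 0 <= v -> Ve (Num.sqrt (cubic v)) = v.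
Proof.
move=> v0; apply: cubic_inj; rewrite cubic_Ve sqr_sqrtr//.
by rewrite cubicE mulr_ge0// ltW// quadr_gt0.
Qed.

(** The exact difference quotient of the implicit function, from $s^2-t^2=P(V(s))-P(V(t))$;
    continuity and the derivative are read off from it. *)
Lemma VeB s t : Ve s - Ve t = (s + t) / slope (Ve s) (Ve t) * (s - t).
Proof.
have := cubicB (Ve s) (Ve t); rewrite !cubic_Ve subr_sqr => H.
apply: (mulfI (lt0r_neq0 (slope_gt0 (Ve s) (Ve t)))); rewrite -H.
by field; rewrite gt_eqF ?slope_gt0.
Qed.

Lemma continuous_Ve : continuous Ve.
Proof.
move=> s.
suff : Ve t - Ve s @[t --> s] --> (0 : R).
  move=> /(cvgD (cvg_cst (Ve s))); rewrite addr0; apply: cvg_trans.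
  by apply: near_eq_cvg; near=> t; rewrite /= /cst addrC subrK.
apply/norm_cvg0P; apply: (@squeeze_cvgr _ _ _ _ (cst 0) (fun t => `|t + s| / kappa * `|t - s|)).
- near=> t; rewrite normr_ge0/= VeB normrM normrM normfV [`|slope _ _|]gtr0_norm ?slope_gt0//.
  apply: ler_wpM2r => //; apply: ler_wpM2l => //.
  by rewrite lef_pV2 ?posrE ?kappa_gt0 ?slope_gt0// slope_ge.
- exact: cvg_cst.
- rewrite -[X in _ --> X](mulr0 (`|s + s| / kappa)) -[X in _ * X](normr0 R) -[X in _ *
    `|X|](subrr s).
  apply: cvgM; first apply: cvgM => //; [|exact: cvg_cst|].
    by apply: cvg_norm; apply: cvgD => //; exact: cvg_cst.
  by apply: cvg_norm; apply: cvgB => //; exact: cvg_cst.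
Unshelve. all: by end_near. Qed.

Lemma is_derive_Ve s : is_derive s 1 Ve (2 * s / dcubic (Ve s)).
Proof.
apply/is_derive1_caratheodory; exists (fun t => (t + s) / slope (Ve t) (Ve s)); split.
- by move=> t; rewrite VeB.
- apply: cvgM; first by apply: cvgD => //; exact: cvg_cst.
  apply: cvgV; first by rewrite gt_eqF ?slope_gt0.
  rewrite /slope; apply: cvgD; last exact: cvg_cst.
  have cV : {for s, continuous Ve} by exact: continuous_Ve.
  apply: cvgD.
    apply: cvgM; first exact: cvg_cst.
    apply: cvgD; last exact: cvg_cst.
    by apply: cvgD; [apply: cvgM|apply: cvgM => //; exact: cvg_cst].
  apply: cvgM; first exact: cvg_cst.
  by apply: cvgD => //; exact: cvg_cst.
- by rewrite dcubic_slope -mulr2n mulr_natl.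
Qed.

Definition height k s := Num.sqrt (k ^+ 2 - Ve s).

(** $R_k(y)$ of the overview, expanded so that identities about it reduce to polynomial
    arithmetic. *)
Definition action k y :=
  3 * a * (k ^+ 4 * y ^+ 3 / 3 - 2 * k ^+ 2 * y ^+ 5 / 5 + y ^+ 7 / 7)
  + 2 * b * (k ^+ 2 * y ^+ 3 / 3 - y ^+ 5 / 5) + c * y ^+ 3 / 3.

(** The primitive of $P'(k^2-y^2)$. Along the profile equation $dx=(P'/P)\,dy$ and $|u|^2=P$, so
    this is the mass gathered while the variable runs from 0 to $y$. *)
Definition halfmass k y :=
  3 * a * (k ^+ 4 * y - 2 * k ^+ 2 * y ^+ 3 / 3 + y ^+ 5 / 5)
  + 2 * b * (k ^+ 2 * y - y ^+ 3 / 3) + c * y.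

Lemma is_derive_monomial (r : R) n y :
  is_derive y 1 (fun y => r * y ^+ n) (r * (n%:R * y ^+ n.-1)).
Proof.
have := is_derive_mul (is_derive_cst r y 1) (is_derive_pow n (is_derive_id y 1)).
by rewrite mul0r add0r mulr1.
Qed.

Lemma is_derive_action k y : is_derive y 1 (action k) (dcubic (k ^+ 2 - y ^+ 2) * y ^+ 2).
Proof.
pose A := a * k ^+ 4 + 2 * b * k ^+ 2 / 3 + c / 3.
pose B := - (6 * a * k ^+ 2 / 5 + 2 * b / 5).
pose C := 3 * a / 7.
rewrite (_ : action k = fun y => A * y ^+ 3 + B * y ^+ 5 + C * y ^+ 7); last first.
  by apply/funext => z; rewrite /action /A /B /C; field.
apply: is_derive_eq (is_derive_add (is_derive_add (is_derive_monomial A 3 y)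
  (is_derive_monomial B 5 y)) (is_derive_monomial C 7 y)) _.
by rewrite /dcubic /A /B /C /=; field.
Qed.

Lemma is_derive_halfmass k y : is_derive y 1 (halfmass k) (dcubic (k ^+ 2 - y ^+ 2)).
Proof.
pose A := 3 * a * k ^+ 4 + 2 * b * k ^+ 2 + c.
pose B := - (2 * a * k ^+ 2 + 2 * b / 3).
pose C := 3 * a / 5.
rewrite (_ : halfmass k = fun y => A * y ^+ 1 + B * y ^+ 3 + C * y ^+ 5); last first.
  by apply/funext => z; rewrite /halfmass /A /B /C; field.
apply: is_derive_eq (is_derive_add (is_derive_add (is_derive_monomial A 1 y)
  (is_derive_monomial B 3 y)) (is_derive_monomial C 5 y)) _.
by rewrite /dcubic /A /B /C /=; field.
Qed.

Lemma is_derive_height k s : Ve s < k ^+ 2 ->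
  is_derive s 1 (height k) (- (s / (dcubic (Ve s) * height k s))).
Proof.
move=> sk; have h0 : 0 < k ^+ 2 - Ve s by rewrite subr_gt0.
have D : is_derive s 1 (fun s => k ^+ 2 - Ve s) (0 - 2 * s / dcubic (Ve s)).
  exact: (is_derive_sub (is_derive_cst (k ^+ 2) s 1) (is_derive_Ve s)).
have H := @is_derive_comp1 _ Num.sqrt (fun s => k ^+ 2 - Ve s) s _ _ (is_derive1_sqrt h0) D.
have -> : - (s / (dcubic (Ve s) * height k s)) =
    (2 * Num.sqrt (k ^+ 2 - Ve s))^-1 * (0 - 2 * s / dcubic (Ve s)).
  rewrite -/(height k s); field.
  by rewrite !gt_eqF ?dcubic_gt0// sqrtr_gt0.
exact: H.
Qed.

Lemma continuous_height k : continuous (height k).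
Proof.
move=> s; apply: (@continuous_comp _ _ _ (fun s => k ^+ 2 - Ve s) Num.sqrt).
  by apply: cvgB; [exact: cvg_cst|exact: continuous_Ve].
exact: sqrt_continuous.
Qed.

Lemma height_sqr k s : Ve s <= k ^+ 2 -> height k s ^+ 2 = k ^+ 2 - Ve s.
Proof. by move=> sk; rewrite sqr_sqrtr// subr_ge0. Qed.

(** The factor $P'$ cancels in the chain rule: $\frac{d}{ds}R_k(\sqrt{k^2-V(s)})=-s\sqrt{k^2-V(s)}$.
    The mean value form covers the endpoint $V(t)=k^2$ too, where [height] need not be
    differentiable. *)
Lemma action_height_MVT k s t : 0 <= s <= t -> Ve t <= k ^+ 2 ->
  exists2 z, s <= z <= t &
    action k (height k s) - action k (height k t) = z * height k z * (t - s).
Proof.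
move=> /andP[s0 st] tk.
have D z : z \in `]s, t[%R ->
    is_derive z 1 (fun z => - action k (height k z)) (z * height k z).
  rewrite in_itv/= => /andP[sz zt].
  have zk : Ve z < k ^+ 2.
    apply: lt_le_trans tk; rewrite ltNge Ve_le -ltNge !ger0_norm//; lra.
  have hz : 0 < height k z by rewrite sqrtr_gt0 subr_gt0.
  apply: is_derive_eq (is_derive_opp (@is_derive_comp1 _ (action k) (height k) z _ _
    (is_derive_action k _) (is_derive_height zk))) _.
  rewrite [k ^+ 2 - _](_ : _ = Ve z); last by rewrite height_sqr ?subKr// ltW.
  by field; rewrite !gt_eqF ?dcubic_gt0.
have [|z] := MVT_segment st D.
  apply: continuous_subspaceT => z; apply: cvgN.
  apply: (@continuous_comp _ _ _ (height k) (action k)); first exact: continuous_height.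
  exact: is_derive_continuous (is_derive_action k _).
by rewrite in_itv/= => szt H; exists z => //; rewrite -H opprK addrC.
Qed.

End Potential.

(** * Bogomolny's bound *)

Section Straddle.
Variable R : realType.
Implicit Types (f F : R -> R) (x y z s t l e d : R).

Lemma is_deriveP f x l : is_derive x 1 f l <->
  forall e, 0 < e -> exists2 d, 0 < d &
    forall y, `|y - x| < d -> `|f y - f x - l * (y - x)| <= e * `|y - x|.
Proof.
split=> [/is_derive1_caratheodory[g [fE cg gx]] e e0|H].
  have /cvgrPdist_lt/(_ e e0) := cg; rewrite near_simpl => /nbhs_ballP[d /= d0 Hd].
  exists d => // y yd; rewrite fE -gx -mulrBl normrM ler_wpM2r//.
  by rewrite distrC; apply/ltW; apply: Hd; rewrite /ball/= distrC.
apply/is_derive1_caratheodory.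
pose g z := if z == x then l else (f z - f x) / (z - x).
exists g; split; last by rewrite /g eqxx.
  move=> z; rewrite /g; have [->|zx] := eqVneq z x; first by rewrite !subrr mulr0.
  by rewrite divfK // subr_eq0.
apply/cvgrPdist_le => e e0; have [d d0 Hd] := H e e0.
rewrite near_simpl; apply/nbhs_ballP; exists d => //= y; rewrite /ball/= distrC => yd.
rewrite /g eqxx; have [_|yx] := eqVneq y x; first by rewrite subrr normr0 ltW.
have yx0 : 0 < `|y - x| by rewrite normr_gt0 subr_eq0.
have -> : l - (f y - f x) / (y - x) = - ((f y - f x - l * (y - x)) / (y - x)).
  by field; rewrite subr_eq0.
by rewrite normrN normrM normfV ler_pdivrMr// Hd.
Qed.

Lemma is_derive_straddle f x l e : is_derive x 1 f l -> 0 < e ->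
  exists2 d, 0 < d & forall s t, x - d < s -> s <= x -> x <= t -> t < x + d ->
    `|f t - f s - l * (t - s)| <= e * (t - s).
Proof.
move=> /is_deriveP H e0; have [d d0 Hd] := H e e0; exists d => // s t ds sx xt td.
have Hs := Hd s; have Ht := Hd t.
rewrite ler0_norm ?subr_le0// in Hs; rewrite ger0_norm ?subr_ge0// in Ht.
have {}Hs := Hs ltac:(lra); have {}Ht := Ht ltac:(lra).
move: Hs Ht; rewrite !ler_norml => /andP[? ?] /andP[? ?]; apply/andP; split; lra.
Qed.

(** A monotonicity test for functions without a pointwise derivative, such as those built on the
    primitive [D]: the points reachable from $A$ with loss at most $e$ per unit length have a
    supremum, and the hypothesis at that supremum carries them past it unless it is $B$. *)
Lemma straddle_homo F :
  (forall x e, 0 < e -> exists2 d, 0 < d &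
    forall s t, x - d < s -> s <= x -> x <= t -> t < x + d -> - (e * (t - s)) <= F t - F s) ->
  forall x y, x <= y -> F x <= F y.
Proof.
move=> H A B AB.
suff K e : 0 < e -> - (e * (B - A)) <= F B - F A.
  rewrite -subr_ge0; apply/ler_addgt0Pr => r r0.
  (* Adding 1 avoids a division by zero when $A=B$. *)
  have BA1 : 0 < B - A + 1 by rewrite ltr_wpDl// subr_ge0.
  have := K _ (divr_gt0 r0 BA1); rewrite mulrAC => K1.
  have : r * (B - A) / (B - A + 1) <= r.
    by rewrite ler_pdivrMr// ler_pM2l// lerDl.
  lra.
move=> e0.
pose S := [set x | A <= x <= B /\ - (e * (x - A)) <= F x - F A].
have SA : S A by split; [rewrite lexx AB|rewrite !subrr mulr0 oppr0].
have ubS : ubound S B by move=> x [/andP[]].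
have hS : has_sup S by split; [exists A|exists B].
set s := sup S.
have As : A <= s by apply: ub_le_sup => //; exists B.
have sB : s <= B by apply: ge_sup => //; exists A.
have [d d0 Hd] := H s e e0.
have [x Sx xs] : exists2 x, S x & s - d < x by apply: sup_adherent.
have xles : x <= s by apply: ub_le_sup => //; exists B.
have key t : s <= t -> t < s + d -> - (e * (t - A)) <= F t - F A.
  move=> st td; have := Hd x t xs xles st td; case: Sx => _; lra.
have [<-|sneB] := eqVneq s B; first by apply: key; rewrite ?ltrDl.
have sltB : s < B by rewrite lt_neqAle sneB.
pose t := Num.min B (s + d / 2).
have st : s < t by rewrite lt_min sltB ltrDl divr_gt0.
have td : t < s + d.
  rewrite gt_min; apply/orP; right; lra.
have : t <= s.
  apply: ub_le_sup; first by exists B.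
  split; last by apply: key => //; exact: ltW.
  by rewrite (le_trans As (ltW st))/= ge_min lexx.
by rewrite leNgt st.
Qed.

Lemma continuous_value_between f s t (v : R) : continuous f -> s <= t ->
  Num.min (f s) (f t) <= v <= Num.max (f s) (f t) -> exists2 z, s <= z <= t & f z = v.
Proof.
move=> cf st Hv; have [|z] := @IVT R f s t v st _ Hv.
  exact: continuous_subspaceT.
by rewrite in_itv/=; exists z.
Qed.

End Straddle.

Section Bogomolny.
Variables (R : realType) (a b c : R).
Hypotheses (ha : 0 < a) (hc : 0 < c) (hb : b ^+ 2 < 3 * (a * c)).
Variable V : R -> R.
Hypothesis hV : forall s, 0 <= s -> s ^+ 2 = a * V s ^+ 3 + b * V s ^+ 2 + c * V s.
Variables (k : R) (n D C : R -> R).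
Implicit Types (x y z s t e d : R).
Local Notation height := (height V).
Local Notation action := (action a b c).
Hypothesis cn : continuous n.
Hypothesis n0 : forall x, 0 <= n x.
Hypothesis nk : forall x, Ve V (n x) <= k ^+ 2.
(** Young's inequality with a free parameter [t]: this is $|n'|^2\le D'$ in integrated form, with
    neither side differentiated. *)
Hypothesis nD : forall x y t, x <= y ->
  t * `|n y - n x| <= 2^-1 * (D y - D x) + 2^-1 * (t ^+ 2 * (y - x)).
Hypothesis nC : forall x, is_derive x 1 C ((n x * height k (n x)) ^+ 2).

Let gam x := n x * height k (n x).

Let cgam : continuous gam.
Proof.
move=> x; apply: cvgM; first exact: cn.
by apply: (@continuous_comp _ _ _ n (height k)); [exact: cn|exact: (@continuous_height _ _ _ _ ha
    hb _ hV k)].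
Qed.

Let gam_ge0 x : 0 <= gam x.
Proof. by rewrite mulr_ge0// sqrtr_ge0. Qed.

Let act x := action k (height k (n x)).

(** [n] need not be differentiable, so the mean value theorem is applied in the variable $s=n$ and
    the intermediate value is pulled back to a point of $[x,y]$ by continuity. *)
Let act_MVT x y : x <= y ->
  exists2 z, x <= z <= y & act y - act x = gam z * (n x - n y).
Proof.
move=> xy; have [nxy|/ltW nyx] := lerP (n x) (n y).
  have [|v /andP[xv vy] H] := action_height_MVT ha hb hV (s := n x) (t := n y) _ (nk y).
    by rewrite n0.
  have [|z xzy nz] := @continuous_value_between _ n x y v cn xy.
    by rewrite ge_min le_max xv vy orbT.
  exists z => //; rewrite /gam nz.
  by rewrite -opprB H -mulrN opprB.
have [|v /andP[xv vy] H] := action_height_MVT ha hb hV (s := n y) (t := n x) _ (nk x).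
  by rewrite n0.
have [|z xzy nz] := @continuous_value_between _ n x y v cn xy.
  by rewrite ge_min le_max xv vy orbT.
by exists z => //; rewrite /gam nz H.
Qed.

Let gam_sqr_near x e : 0 < e ->
  exists2 d, 0 < d & forall z, `|z - x| < d -> `|gam z ^+ 2 - gam x ^+ 2| <= e.
Proof.
move=> e0.
have c2 : {for x, continuous (fun z => gam z ^+ 2)}.
  by apply: cvgM; exact: cgam.
have /cvgrPdist_le/(_ e e0) := c2; rewrite near_simpl => /nbhs_ballP[d /= d0 Hd].
exists d => // z zd; rewrite distrC; apply: Hd.
by rewrite /ball/= distrC.
Qed.

(** On a short interval $|\Delta act|=gam(z)\,|\Delta n|$, and [nD] with parameter $gam(z)$ bounds
    this by $\frac12\Delta D+\frac12gam(z)^2\Delta x$. By continuity the last term is $\frac12\Delta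
    C$ up to a small multiple of the length, which the straddling test absorbs. *)
Lemma bogomolny x y : x <= y ->
  `|act y - act x| <= 2^-1 * (D y - D x) + 2^-1 * (C y - C x).
Proof.
(* Both signs of the square are used, which is what produces the absolute value. *)
suff K (sg : R) : sg = 1 \/ sg = -1 ->
    forall x y, x <= y -> 2^-1 * D x + 2^-1 * C x + sg * act x <= 2^-1 * D y + 2^-1 * C y + sg *
        act y.
  move=> xy; have := K 1 (or_introl erefl) x y xy; have := K (-1) (or_intror erefl) x y xy.
  rewrite ler_norml !mul1r !mulN1r => ? ?; apply/andP; split; lra.
move=> sg1; apply: straddle_homo => {x y} x e e0.
have [d1 d10 H1] := gam_sqr_near x e0.
have [d2 d20 H2] := is_derive_straddle (nC x) e0.
exists (Num.min d1 d2); first by rewrite lt_min d10.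
move=> s t; rewrite ltrBlDr -ltrBlDl lt_min => /andP[s1 s2] sx xt.
rewrite -ltrBlDl lt_min => /andP[t1 t2].
have st := le_trans sx xt.
have [z /andP[sz zt] Hact] := act_MVT st.
have := H2 s t; rewrite ltrBlDr -ltrBlDl => /(_ s2 sx xt); rewrite -ltrBlDl => /(_ t2).
have := nD (gam z) st.
have := H1 z; rewrite ltr_norml => /(_ ltac:(apply/andP; split; lra)).
rewrite !ler_norml => /andP[_ g1] h /andP[g2 _].
have h1 : `|act t - act s| = gam z * `|n t - n s|.
  by rewrite Hact normrM ger0_norm// distrC.
have h2 : gam z ^+ 2 * (t - s) <= (gam x ^+ 2 + e) * (t - s).
  by rewrite ler_wpM2r ?subr_ge0//; lra.
have h3 : - `|act t - act s| <= sg * act t - sg * act s.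
  rewrite -mulrBr; case: sg1 => ->; rewrite ?mul1r ?mulN1r.
    by rewrite lerNl -normrN ler_norm.
  by rewrite lerN2 ler_norm.
rewrite -/(gam x) in g2; lra.
Qed.

(* No chain rule for weakly differentiable functions is needed: equality on every
   subinterval forces the difference quotients q of n to satisfy (q + gam)^2 -> 0. *)
Lemma bogomolny_eq x1 :
  (forall x y, x1 <= x -> x <= y -> act y - act x = 2^-1 * (D y - D x) + 2^-1 * (C y - C x)) ->
  forall x, x1 < x -> is_derive x 1 n (- (n x * height k (n x))).
Proof.
move=> Heq x x1x; rewrite -/(gam x).
have key s t : x1 <= s -> s < t -> exists2 z, s <= z <= t &
    ((n s - n t) - gam z * (t - s)) ^+ 2 <= (gam z ^+ 2 * (t - s) - (C t - C s)) * (t - s).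
  move=> x1s st; have [z szt Hz] := act_MVT (ltW st); exists z => //.
  have := Heq s t x1s (ltW st); rewrite Hz => E.
  have ts : 0 < t - s by rewrite subr_gt0.
  (* The optimal parameter: it turns the hypothesis into $(\Delta n)^2\le\Delta D\,\Delta t$. *)
  have := nD (`|n t - n s| / (t - s)) (ltW st).
  set w := `|n t - n s|.
  have -> : w / (t - s) * w = w ^+ 2 / (t - s) by rewrite mulrAC expr2.
  have -> : (w / (t - s)) ^+ 2 * (t - s) = w ^+ 2 / (t - s) by field; rewrite gt_eqF.
  rewrite /w real_normK ?num_real// => H.
  have H2 : (n t - n s) ^+ 2 <= (D t - D s) * (t - s).
    by rewrite -ler_pdivrMr//; lra.
  have : (D t - D s) * (t - s) = (2 * (gam z * (n s - n t)) - (C t - C s)) * (t - s).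
    by congr (_ * _); lra.
  have -> : (n s - n t - gam z * (t - s)) ^+ 2 = (n t - n s) ^+ 2 - 2 * (gam z * (n s - n t)) *
      (t - s) + gam z ^+ 2 * (t - s) * (t - s) by ring.
  lra.
apply/is_deriveP => e e0.
have e20 : 0 < e / 2 by rewrite divr_gt0.
(* The variation of $gam^2$ and the linearisation of [C] each cost this much, $(e/2)^2$ together. *)
have e40 : 0 < (e / 2) ^+ 2 / 2 by rewrite divr_gt0// exprn_gt0.
have [d1 d10 H1] := gam_sqr_near x e40.
have [d2 d20 H2] := is_derive_straddle (nC x) e40.
have cx : {for x, continuous gam} by exact: cgam.
have /cvgrPdist_le/(_ _ e20) := cx.
rewrite near_simpl => /nbhs_ballP[d3 /= d30 H3].
exists (Num.min (Num.min d1 d2) (Num.min d3 (x - x1))).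
  by rewrite !lt_min d10 d20 d30 subr_gt0.
have main s t : x1 <= s -> x - d1 < s -> x - d2 < s -> x - d3 < s -> s <= x -> x <= t ->
    t < x + d1 -> t < x + d2 -> t < x + d3 -> s < t ->
    `|n t - n s + gam x * (t - s)| <= e * (t - s).
  move=> s0 s1 s2 s3 sx xt t1 t2 t3 st.
  have ts : 0 < t - s by rewrite subr_gt0.
  have [z /andP[sz zt] Hz] := key s t s0 st.
  have := H1 z; rewrite ltr_norml => /(_ ltac:(apply/andP; split; lra)).
  have := H2 s t s2 sx xt t2.
  have : `|gam x - gam z| <= e / 2.
    by apply: H3; rewrite /ball/= ltr_norml; apply/andP; split; lra.
  rewrite -/(gam x) !ler_norml => /andP[g1 g2] /andP[g3 g4] /andP[g5 g6].
  have h : (gam z ^+ 2 * (t - s) - (C t - C s)) * (t - s) <= (e / 2 * (t - s)) ^+ 2.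
    have -> : (e / 2 * (t - s)) ^+ 2 = (e / 2) ^+ 2 * (t - s) * (t - s) by ring.
    rewrite ler_pM2r//.
    have : gam z ^+ 2 * (t - s) <= (gam x ^+ 2 + (e / 2) ^+ 2 / 2) * (t - s).
      by rewrite ler_pM2r//; lra.
    lra.
  have : `|n s - n t - gam z * (t - s)| <= e / 2 * (t - s).
    have et : 0 <= e / 2 * (t - s) by rewrite mulr_ge0// ltW.
    rewrite -ler_sqr ?nnegrE// real_normK ?num_real//.
    exact: le_trans Hz h.
  rewrite !ler_norml => /andP[f1 f2].
  have := ler_pM2r ts (- (e / 2)) (gam x - gam z).
  have := ler_pM2r ts (gam x - gam z) (e / 2).
  rewrite g1 g2 => u1 u2; apply/andP; split; lra.
move=> y; rewrite !lt_min => /andP[/andP[y1 y2] /andP[y3 y4]].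
move: y1 y2 y3 y4; rewrite !ltr_norml => /andP[? ?] /andP[? ?] /andP[? ?] /andP[? ?].
have [yx|xy|->] := ltgtP y x.
- have := main y x ltac:(lra) ltac:(lra) ltac:(lra) ltac:(lra) (ltW yx) (lexx _) ltac:(lra)
    ltac:(lra) ltac:(lra) yx.
  rewrite [`|y - x|]ler0_norm ?subr_le0 ?(ltW yx)// opprB.
  by rewrite -normrN; congr (`|_| <= _); ring.
- have := main x y ltac:(lra) ltac:(lra) ltac:(lra) ltac:(lra) (lexx _) (ltW xy) ltac:(lra)
    ltac:(lra) ltac:(lra) xy.
  rewrite [`|y - x|]ger0_norm ?subr_ge0 ?(ltW xy)//.
  by congr (`|_| <= _); ring.
- by rewrite !subrr mulr0 subrr normr0 mulr0.
Qed.

End Bogomolny.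

(** * The reduced energy *)

Section ReducedEnergy.
Variables (R : realType) (a b c : R).
Hypotheses (ha : 0 < a) (hc : 0 < c) (hb : b ^+ 2 < 3 * (a * c)).
Implicit Types (k l p q t x y : R).

Definition frequency_mass k := 2 * halfmass a b c k k.
Definition reduced_energy l k := 2 * action a b c k k - l / 2 * k ^+ 2.
Definition argmin l : set R :=
  [set k | 0 < k /\ forall x, 0 < x -> reduced_energy l k <= reduced_energy l x].

Local Notation lam := frequency_mass.
Local Notation hh := reduced_energy.

Lemma lamE k : lam k = 2 * k * (8 / 5 * a * (k ^+ 2) ^+ 2 + 4 / 3 * b * k ^+ 2 + c).
Proof. by rewrite /lam /halfmass; field. Qed.

Lemma hhE l k : hh l k =
  k ^+ 2 * (2 * k * (8 / 35 * a * (k ^+ 2) ^+ 2 + 4 / 15 * b * k ^+ 2 + c / 3) - l / 2).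
Proof. by rewrite /hh /action; field. Qed.

Lemma hh_shift l l' k : hh l' k = hh l k - (l' - l) / 2 * k ^+ 2.
Proof. by rewrite /hh; field. Qed.

Lemma is_derive_hh l k : is_derive k 1 (hh l) (k * (lam k - l)).
Proof.
rewrite (_ : hh l = fun k => 16 / 35 * a * k ^+ 7 + 8 / 15 * b * k ^+ 5
    + 2 / 3 * c * k ^+ 3 + - (l / 2) * k ^+ 2); last first.
  by apply/funext => x; rewrite hhE; field.
apply: is_derive_eq (is_derive_add (is_derive_add (is_derive_add
  (is_derive_monomial _ 7 k) (is_derive_monomial _ 5 k)) (is_derive_monomial _ 3 k))
  (is_derive_monomial _ 2 k)) _.
by rewrite lamE /=; field.
Qed.

Lemma is_derive_lam k :
  is_derive k 1 lam (2 * (8 * a * (k ^+ 2) ^+ 2 + 4 * b * k ^+ 2 + c)).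
Proof.
rewrite (_ : lam = fun k => 16 / 5 * a * k ^+ 5 + 8 / 3 * b * k ^+ 3 + 2 * c * k ^+ 1); last
    first.
  by apply/funext => x; rewrite lamE; field.
apply: is_derive_eq (is_derive_add (is_derive_add
  (is_derive_monomial _ 5 k) (is_derive_monomial _ 3 k)) (is_derive_monomial _ 1 k)) _.
by rewrite /=; field.
Qed.

Lemma continuous_hh l : continuous (hh l).
Proof. by move=> k; exact: is_derive_continuous (is_derive_hh l k). Qed.

Lemma hh_MVT l x y : x < y -> exists2 z, x < z < y & hh l y - hh l x = z * (lam z - l) * (y - x).
Proof.
move=> xy; have [|z] := MVT xy (fun z _ => is_derive_hh l z).
  by apply: continuous_subspaceT; exact: continuous_hh.
by rewrite in_itv/=; exists z.
Qed.

Lemma lam_MVT x y : x < y -> exists2 z, x < z < y &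
  lam y - lam x = 2 * (8 * a * (z ^+ 2) ^+ 2 + 4 * b * z ^+ 2 + c) * (y - x).
Proof.
move=> xy; have [|z] := MVT xy (fun z _ => is_derive_lam z).
  by apply: continuous_subspaceT => z; exact: is_derive_continuous (is_derive_lam z).
by rewrite in_itv/=; exists z.
Qed.

Let a0 : a != 0. Proof. by rewrite gt_eqF. Qed.

(** [m] is twice the minimum of the quadratic factor of [lamE] in the variable $k^2$, positive
    whenever $\sigma<18/5$. It confines the minimisers of mass $l$ to $k\le l/m$. *)
Lemma lam_lower : exists2 m : R, 0 < m & forall k, 0 <= k -> m * k <= lam k.
Proof.
exists (2 * (c - 5 * b ^+ 2 / (18 * a))).
  rewrite mulr_gt0// subr_gt0 ltr_pdivrMr ?mulr_gt0//; move: hb (mulr_gt0 ha hc); lra.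
move=> k k0; rewrite lamE.
have -> : 8 / 5 * a * (k ^+ 2) ^+ 2 + 4 / 3 * b * k ^+ 2 + c =
  8 / 5 * a * (k ^+ 2 + 5 * b / (12 * a)) ^+ 2 + (c - 5 * b ^+ 2 / (18 * a)) by field.
rewrite [2 * (c - _) * k]mulrAC ler_wpM2l ?mulr_ge0// lerDr.
by rewrite mulr_ge0 ?sqr_ge0// mulr_ge0// ltW.
Qed.

(** Coercivity with a constant independent of the mass, by the same completion of the square; the
    constant is positive whenever $\sigma<30/7$. *)
Lemma hh_lower : exists2 m : R, 0 < m &
  forall l k, 0 <= k -> k ^+ 2 * (m * k - l / 2) <= hh l k.
Proof.
exists (2 * (c / 3 - 7 * b ^+ 2 / (90 * a))).
  rewrite mulr_gt0// subr_gt0 ltr_pdivrMr ?mulr_gt0//; move: hb (mulr_gt0 ha hc); lra.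
move=> l k k0; rewrite hhE ler_wpM2l ?sqr_ge0// lerD2r.
have -> : 8 / 35 * a * (k ^+ 2) ^+ 2 + 4 / 15 * b * k ^+ 2 + c / 3 =
  8 / 35 * a * (k ^+ 2 + 7 * b / (12 * a)) ^+ 2 + (c / 3 - 7 * b ^+ 2 / (90 * a)) by field.
rewrite [2 * (_ - _) * k]mulrAC ler_wpM2l ?mulr_ge0// lerDr.
by rewrite mulr_ge0 ?sqr_ge0// mulr_ge0// ltW.
Qed.

Lemma hh0 l : hh l 0 = 0.
Proof. by rewrite hhE expr0n mul0r. Qed.

Lemma hh_neg l : 0 < l -> exists2 x, 0 < x & hh l x < 0.
Proof.
move=> l0; pose S := 8 / 35 * a + 4 / 15 * `|b| + c / 3.
have S0 : 0 < S.
  by rewrite ltr_wpDl ?divr_gt0// addr_ge0 ?mulr_ge0// ltW.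
(* On $(0,1]$ the constant [S] bounds the polynomial factor of [hhE], so here the positive term is
   at most $l/4$, below the $l/2$ that is subtracted. *)
pose x := Num.min 1 (l / (8 * S)).
have x0 : 0 < x by rewrite lt_min ltr01 divr_gt0// mulr_gt0.
have x1 : x <= 1 by rewrite ge_min lexx.
have xl : x <= l / (8 * S) by rewrite ge_min lexx orbT.
exists x => //; rewrite hhE pmulr_rlt0 ?exprn_gt0//.
have x2 : x ^+ 2 <= 1 by rewrite expr_le1// ltW.
have x20 : 0 <= x ^+ 2 by rewrite sqr_ge0.
have x4 : (x ^+ 2) ^+ 2 <= 1 by rewrite expr_le1.
have H : 8 / 35 * a * (x ^+ 2) ^+ 2 + 4 / 15 * b * x ^+ 2 + c / 3 <= S.
  rewrite lerD2r; apply: lerD.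
    by rewrite -[leRHS]mulr1 ler_wpM2l// mulr_ge0// ltW.
  rewrite -[leLHS]mulrA ler_wpM2l// ?divr_ge0//.
  rewrite -[leRHS]mulr1; apply: le_trans (ler_norm _) _.
  by rewrite normrM [`|x ^+ 2|]ger0_norm// ler_wpM2l.
have : 2 * x * (8 / 35 * a * (x ^+ 2) ^+ 2 + 4 / 15 * b * x ^+ 2 + c / 3) <= 2 * x * S.
  by rewrite ler_wpM2l// mulr_ge0// ltW.
have : 2 * x * S <= l / 4.
  move: xl; rewrite ler_pdivlMr ?mulr_gt0//; lra.
lra.
Qed.

Lemma argmin_nonempty l : 0 < l -> argmin l !=set0.
Proof.
move=> l0; have [m m0 Hm] := hh_lower; have [x x0 hx] := hh_neg l0.
(* Beyond [K] the lower bound is nonnegative, hence at least the value 0 at $k=0$, so the minimum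
   over $[0,K]$ is global; [hh_neg] keeps it away from 0. *)
pose K := l / (2 * m).
have K0 : 0 <= K by rewrite divr_ge0// ltW// mulr_gt0.
have [|p] := @EVT_min R (hh l) 0 K K0.
  by apply: continuous_subspaceT; exact: continuous_hh.
rewrite in_itv/= => /andP[p0 pK] Hp.
have Hall y : 0 <= y -> hh l p <= hh l y.
  move=> y0; have [yK|Ky] := lerP y K; first by apply: Hp; rewrite in_itv/= y0.
  apply: (@le_trans _ _ 0).
    by rewrite -(hh0 l); apply: Hp; rewrite in_itv/= lexx.
  apply: le_trans (Hm l y y0); rewrite mulr_ge0 ?sqr_ge0//.
  move: Ky; rewrite ltr_pdivrMr ?mulr_gt0//; lra.
exists p; split; last by move=> y /ltW; exact: Hall.
rewrite lt_neqAle p0 andbT; apply/eqP => p00.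
by have := Hall x (ltW x0); rewrite -p00 hh0 leNgt hx.
Qed.

Lemma argmin_mass l k : argmin l k -> lam k = l.
Proof.
move=> [k0 Hk].
have H : is_derive k 1 (hh l) 0.
  apply: (@derive1_at_min _ (hh l) (k / 2) (k * 2) k); first lra.
  - by move=> t _; case: (is_derive_hh l t).
  - by rewrite in_itv/=; lra.
  - by move=> t; rewrite in_itv/= => /andP[t1 _]; apply: Hk; lra.
have [_ e1] := is_derive_hh l k; have [_] := H; rewrite e1.
by move/eqP; rewrite mulf_eq0 gt_eqF//= subr_eq0 => /eqP.
Qed.

(** The mass enters only through $-l\,k^2/2$, so adding the two minimality inequalities leaves
    $(l'-l)(k'^2-k^2)\ge0$. *)
Lemma argmin_homo l l' k k' : l < l' -> argmin l k -> argmin l' k' -> k <= k'.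
Proof.
move=> ll' [k0 Hk] [k'0 Hk'].
have := Hk _ k'0; have := Hk' _ k0; rewrite !(hh_shift l l') => H1 H2.
have : (l' - l) / 2 * k ^+ 2 <= (l' - l) / 2 * k' ^+ 2 by lra.
by rewrite ler_pM2l ?divr_gt0 ?subr_gt0// ler_sqr ?nnegrE //; exact: ltW.
Qed.

(* The derivative of the reduced energy at [z] is [z (lam z - l)], negative just after [k]. *)
Lemma argmin_not_decreasing l k y : argmin l k -> k < y ->
  ~ (forall z, k < z < y -> lam z < lam k).
Proof.
move=> Hk ky H; have [z /andP[kz zy] Hz] := hh_MVT l ky.
have lz := H z; rewrite kz zy (argmin_mass Hk) in lz; have {}lz := lz isT.
case: Hk => k0 Hk; have := Hk y (lt_trans k0 ky).
rewrite -subr_ge0 Hz leNgt => /negP; apply.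
rewrite -mulrA pmulr_rlt0 ?(lt_trans k0)// nmulr_rlt0 ?subr_lt0// subr_gt0//.
Qed.

Lemma argmin_unique_of_injective l k :
  (forall x y, 0 < x -> x < y -> lam x < lam y) -> argmin l k -> argmin l = [set k].
Proof.
move=> H Hk; apply/seteqP; split=> [y Hy|y ->//].
have [yk|ky|//] := ltgtP y k.
  by have := H _ _ Hy.1 yk; rewrite (argmin_mass Hy) (argmin_mass Hk) ltxx.
by have := H _ _ Hk.1 ky; rewrite (argmin_mass Hy) (argmin_mass Hk) ltxx.
Qed.

Lemma lam_increasing : b ^+ 2 <= 2 * (a * c) \/ 0 <= b ->
  forall x y, 0 < x -> x < y -> lam x < lam y.
Proof.
move=> hyp.
have step x y : 0 < x -> x < y ->
    (forall z, x < z < y -> 0 < 8 * a * (z ^+ 2) ^+ 2 + 4 * b * z ^+ 2 + c) -> lam x < lam y.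
  move=> x0 xy H; rewrite -subr_gt0; have [z Hz ->] := lam_MVT xy.
  by rewrite mulr_gt0 ?subr_gt0// mulr_gt0// H.
case: hyp => [sb|b0] x y x0 xy; last first.
  apply: step => // z /andP[xz _]; rewrite ltr_wpDl// addr_ge0//.
    by rewrite mulr_ge0 ?sqr_ge0// mulr_ge0// ltW.
  by rewrite mulr_ge0 ?sqr_ge0// mulr_ge0.
have E z : 8 * a * (z ^+ 2) ^+ 2 + 4 * b * z ^+ 2 + c =
    8 * a * (z ^+ 2 + b / (4 * a)) ^+ 2 + (2 * (a * c) - b ^+ 2) / (2 * a) by field.
have E0 : 0 <= (2 * (a * c) - b ^+ 2) / (2 * a).
  by rewrite divr_ge0 ?subr_ge0// mulr_ge0// ltW.
have pos z : z ^+ 2 != - (b / (4 * a)) -> 0 < 8 * a * (z ^+ 2) ^+ 2 + 4 * b * z ^+ 2 + c.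
  move=> zn; rewrite E ltr_pwDl//.
  have sq0 : 0 < (z ^+ 2 + b / (4 * a)) ^+ 2.
    by rewrite lt_neqAle sqr_ge0 andbT eq_sym sqrf_eq0 addr_eq0.
  by rewrite pmulr_lgt0// mulr_gt0.
(* the derivative vanishes at most at [m], where the two monotone pieces are glued *)
pose m := Num.sqrt (- (b / (4 * a))).
have nm z : 0 < z -> z != m -> z ^+ 2 != - (b / (4 * a)).
  move=> z0; apply: contra => /eqP zE.
  by rewrite /m -zE sqrtr_sqr ger0_norm// ltW.
have [xm|mx] := ltP x m; last first.
  apply: step => // z /andP[xz _]; apply: pos; apply: nm; first exact: lt_trans xz.
  by rewrite gt_eqF// (le_lt_trans mx).
have [my|ym] := ltP m y; last first.
  apply: step => // z /andP[xz zy]; apply: pos; apply: nm; first exact: lt_trans xz.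
  by rewrite lt_eqF// (lt_le_trans zy).
apply: (@lt_trans _ _ (lam m)).
  apply: step => // z /andP[xz zy]; apply: pos; apply: nm; first exact: lt_trans xz.
  by rewrite lt_eqF.
apply: step => //; first exact: lt_trans xm.
move=> z /andP[xz zy]; apply: pos; apply: nm; first exact: lt_trans (lt_trans x0 xm) xz.
by rewrite gt_eqF.
Qed.

(** * The bistable case: [sigma] above 2 and [b] negative *)

Section Bistable.
Hypotheses (sb : 2 * (a * c) < b ^+ 2) (b0 : b < 0).

(** [t1] and [t2] are the roots of $8aX^2+4bX+c$, both positive as $b<0$; [k1] and [k2] are thus the
    critical points of [lam] on the half-line. *)
Let disc := Num.sqrt (b ^+ 2 - 2 * (a * c)).
Let t1 := (- b - disc) / (4 * a).
Let t2 := (- b + disc) / (4 * a).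
Let k1 := Num.sqrt t1.
Let k2 := Num.sqrt t2.

Let disc0 : 0 < disc. Proof. by rewrite sqrtr_gt0 subr_gt0. Qed.
Let discE : disc ^+ 2 = b ^+ 2 - 2 * (a * c). Proof. by rewrite sqr_sqrtr// subr_ge0 ltW. Qed.
Let disc_b : disc < - b.
Proof.
rewrite -ltr_sqr ?nnegrE ?oppr_ge0 ?(ltW b0) ?(ltW disc0)// discE sqrrN.
by rewrite ltrBlDr ltrDl !mulr_gt0.
Qed.
Let t10 : 0 < t1. Proof. by rewrite divr_gt0 ?mulr_gt0// subr_gt0. Qed.
Let t12 : t1 < t2.
Proof. by rewrite ltr_pM2r ?invr_gt0 ?mulr_gt0// ltrD2l; move: disc0; lra. Qed.
Let k10 : 0 < k1. Proof. by rewrite sqrtr_gt0. Qed.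
Let k12 : k1 < k2. Proof. by rewrite ltr_sqrt// (lt_trans t10). Qed.
Let k20 : 0 < k2. Proof. exact: lt_trans k12. Qed.
Let k1E : k1 ^+ 2 = t1. Proof. by rewrite sqr_sqrtr// ltW. Qed.
Let k2E : k2 ^+ 2 = t2. Proof. by rewrite sqr_sqrtr// ltW// (lt_trans t10). Qed.

Let dlamE z : 8 * a * (z ^+ 2) ^+ 2 + 4 * b * z ^+ 2 + c = 8 * a * ((z ^+ 2 - k1 ^+ 2) * (z ^+ 2
    - k2 ^+ 2)).
Proof.
rewrite k1E k2E /t1 /t2.
have -> : (z ^+ 2 - (- b - disc) / (4 * a)) * (z ^+ 2 - (- b + disc) / (4 * a)) =
  (z ^+ 2) ^+ 2 + b / (2 * a) * z ^+ 2 + (b ^+ 2 - disc ^+ 2) / (16 * a ^+ 2) by field.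
by rewrite discE; field.
Qed.

Let lam_step x y (sg : R) : x < y ->
  (forall z, x < z < y -> 0 < sg * ((z ^+ 2 - k1 ^+ 2) * (z ^+ 2 - k2 ^+ 2))) ->
  0 < sg * (lam y - lam x).
Proof.
move=> xy H; have [z Hz ->] := lam_MVT xy; rewrite dlamE.
have -> : sg * (2 * (8 * a * ((z ^+ 2 - k1 ^+ 2) * (z ^+ 2 - k2 ^+ 2))) * (y - x)) =
  16 * a * (y - x) * (sg * ((z ^+ 2 - k1 ^+ 2) * (z ^+ 2 - k2 ^+ 2))) by ring.
by rewrite mulr_gt0 ?H// !mulr_gt0// subr_gt0.
Qed.

Let lam_left x y : 0 < x -> x < y -> y <= k1 -> lam x < lam y.
Proof.
move=> x0 xy yk; rewrite -subr_gt0 -[ltRHS]mul1r; apply: lam_step => // z /andP[xz zy].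
rewrite mul1r nmulr_rgt0.
  rewrite subr_lt0 ltr_sqr ?nnegrE ?(ltW k20)//; last exact: ltW (lt_trans x0 xz).
  by rewrite (lt_trans zy)// (le_lt_trans yk).
rewrite subr_lt0 ltr_sqr ?nnegrE ?(ltW k10)//; last exact: ltW (lt_trans x0 xz).
exact: lt_le_trans zy yk.
Qed.

Let lam_right x y : k2 <= x -> x < y -> lam x < lam y.
Proof.
move=> kx xy; rewrite -subr_gt0 -[ltRHS]mul1r; apply: lam_step => // z /andP[xz zy].
have kz := le_lt_trans kx xz; have z0 := lt_trans k20 kz.
rewrite mul1r pmulr_rgt0 subr_gt0 ltr_sqr ?nnegrE ?(ltW z0) ?(ltW k10) ?(ltW k20)//.
exact: lt_trans k12 kz.
Qed.

Let lam_middle x y : k1 <= x -> x < y -> y <= k2 -> lam y < lam x.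
Proof.
move=> kx xy yk; rewrite -subr_gt0 -[lam x - _]opprB -mulN1r; apply: lam_step => // z /andP[xz
    zy].
have kz := le_lt_trans kx xz; have z0 := lt_trans k10 kz.
rewrite mulN1r -mulrN opprB pmulr_rgt0 subr_gt0 ltr_sqr ?nnegrE ?(ltW z0) ?(ltW k10) ?(ltW k20)//.
exact: lt_le_trans zy yk.
Qed.

Let argmin_dichotomy l k : argmin l k -> k <= k1 \/ k2 <= k.
Proof.
move=> Hk; have [|kk1] := leP k k1; [by left|have [|kk2] := leP k2 k; [by right|]].
exfalso; apply: (argmin_not_decreasing Hk kk2) => z /andP[kz zk].
by apply: lam_middle => //; exact: ltW.
Qed.

Let argmin_left_unique l p q : argmin l p -> argmin l q -> p <= k1 -> q <= k1 -> p = q.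
Proof.
move=> Hp Hq pk qk; have [pq|qp|//] := ltgtP p q.
  by have := lam_left Hp.1 pq qk; rewrite (argmin_mass Hp) (argmin_mass Hq) ltxx.
by have := lam_left Hq.1 qp pk; rewrite (argmin_mass Hp) (argmin_mass Hq) ltxx.
Qed.

Let argmin_right_unique l p q : argmin l p -> argmin l q -> k2 <= p -> k2 <= q -> p = q.
Proof.
move=> Hp Hq pk qk; have [pq|qp|//] := ltgtP p q.
  by have := lam_right pk pq; rewrite (argmin_mass Hp) (argmin_mass Hq) ltxx.
by have := lam_right qk qp; rewrite (argmin_mass Hp) (argmin_mass Hq) ltxx.
Qed.

(** The switching mass is the supremum of the masses that have a minimiser on the left branch.
    Minimisers for nearby masses, left ones from below and right ones from above, are compared with
    the minimum at [l2] over a compact piece of each branch, which replaces the extraction of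
    limits. *)
Let argmin_two : exists l2 p q, [/\ 0 < l2, p <= k1, k2 <= q, argmin l2 p & argmin l2 q].
Proof.
have [m m0 Hm] := lam_lower.
pose A := [set l | 0 < l /\ exists2 p, argmin l p & p <= k1].
have ubA : ubound A (lam k1).
  move=> l [l0 [p Hp pk]]; rewrite -(argmin_mass Hp).
  have [pk'|kp|->//] := ltgtP p k1; last by rewrite leNgt kp in pk.
  by apply/ltW/lam_left => //; exact: Hp.1.
(* A minimiser beyond [k1] would have mass above $m\,k_1$, so at this small mass every minimiser is
   on the left. *)
have A0 : A (m * k1 / 2).
  have l0 : 0 < m * k1 / 2 by rewrite divr_gt0// mulr_gt0.
  split=> //; have [p Hp] := argmin_nonempty l0; exists p => //.
  rewrite leNgt; apply/negP => kp.
  have := Hm p (ltW Hp.1); rewrite (argmin_mass Hp).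
  have : m * k1 < m * p by rewrite ltr_pM2l.
  have := mulr_gt0 m0 k10; lra.
have hA : has_sup A by split; [exists (m * k1 / 2)|exists (lam k1)].
set l2 := sup A.
have l20 : 0 < l2.
  apply: (lt_le_trans A0.1); apply: ub_le_sup => //; by exists (lam k1).
have small (x y r : R) : 0 <= r -> (forall e, 0 < e -> x <= y + e * r) -> x <= y.
  move=> r0 H; apply/ler_addgt0Pr => e e0.
  have r1 : 0 < r + 1 by rewrite ltr_wpDl.
  have := H _ (divr_gt0 e0 r1); move=> /le_trans; apply.
  by rewrite lerD2l mulrAC ler_pdivrMr// ler_pM2l// lerDl.
have [x0 x00 hx0] := hh_neg l20.
have [|p] := @EVT_min R (hh l2) 0 k1 (ltW k10).
  by apply: continuous_subspaceT; exact: continuous_hh.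
rewrite in_itv/= => /andP[p0 pk] Hp.
have Hpall x : 0 < x -> hh l2 p <= hh l2 x.
  move=> xp; apply: (@small _ _ (x ^+ 2 / 2)); first by rewrite divr_ge0 ?sqr_ge0.
  move=> e e0; have [l [l0 [r Hr rk]] ll2] : exists2 l, A l & l2 - e < l by apply: sup_adherent.
  have lel : l <= l2 by apply: ub_le_sup; [exists (lam k1)|split=> //; exists r].
  have := Hp r; rewrite in_itv/= (ltW Hr.1) rk => /(_ isT) /le_trans; apply.
  have := Hr.2 x xp; rewrite (hh_shift l l2 r) (hh_shift l l2 x).
  have : 0 <= (l2 - l) / 2 * r ^+ 2 by rewrite mulr_ge0 ?sqr_ge0// divr_ge0// subr_ge0.
  have : (l2 - l) * (x ^+ 2 / 2) <= e * (x ^+ 2 / 2).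
    by rewrite ler_wpM2r ?divr_ge0 ?sqr_ge0//; lra.
  lra.
(* For masses up to [l2 + 1], [lam_lower] keeps all minimisers below [K], so the right branch may be
   truncated there. *)
pose K := Num.max k2 ((l2 + 1) / m).
have k2K : k2 <= K by rewrite le_max lexx.
have [|q] := @EVT_min R (hh l2) k2 K k2K.
  by apply: continuous_subspaceT; exact: continuous_hh.
rewrite in_itv/= => /andP[qk qK] Hq.
have Hqall x : 0 < x -> hh l2 q <= hh l2 x.
  move=> xp; apply: (@small _ _ (K ^+ 2 / 2)); first by rewrite divr_ge0 ?sqr_ge0.
  move=> e e0; pose l := l2 + Num.min e 1.
  have min0 : 0 < Num.min e 1 by rewrite lt_min e0 ltr01.
  have mine : Num.min e 1 <= e by rewrite ge_min lexx.
  have min1 : Num.min e 1 <= 1 by rewrite ge_min lexx orbT.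
  have ll2 : l2 < l by rewrite ltrDl.
  have lE : l - l2 = Num.min e 1 by rewrite /l addrAC subrr add0r.
  have l0 := lt_trans l20 ll2.
  have [r Hr] := argmin_nonempty l0.
  have rk : k2 <= r.
    have [rk1|//] := argmin_dichotomy Hr.
    have : l <= l2 by apply: ub_le_sup; [exists (lam k1)|split=> //; exists r].
    by rewrite leNgt ll2.
  have rK : r <= K.
    rewrite le_max; apply/orP; right; rewrite ler_pdivlMr// mulrC.
    apply: le_trans (Hm r (ltW Hr.1)) _; rewrite (argmin_mass Hr) /l; lra.
  have := Hq r; rewrite in_itv/= rk rK => /(_ isT) /le_trans; apply.
  have := Hr.2 x xp; rewrite (hh_shift l2 l r) (hh_shift l2 l x) lE.
  have : 0 <= Num.min e 1 / 2 * x ^+ 2 by rewrite mulr_ge0 ?sqr_ge0// divr_ge0// ltW.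
  have : Num.min e 1 / 2 * r ^+ 2 <= e * (K ^+ 2 / 2).
    suff : Num.min e 1 * r ^+ 2 <= e * K ^+ 2 by lra.
    apply: ler_pM; rewrite ?sqr_ge0 ?(ltW min0)//.
    by rewrite ler_sqr ?nnegrE ?(ltW Hr.1)// (le_trans (ltW k20)).
  lra.
exists l2, p, q; split=> //; split=> //; last exact: lt_le_trans k20 qk.
rewrite lt_neqAle p0 andbT; apply/eqP => p00.
by have := Hpall _ x00; rewrite -p00 hh0 leNgt hx0.
Qed.

Lemma argmin_bistable : exists l2 p q, [/\ 0 < l2, p != q, argmin l2 = [set p; q] &
  forall l, 0 < l -> l <> l2 -> exists k, argmin l = [set k]].
Proof.
have [l2 [p [q [l20 pk qk Hp Hq]]]] := argmin_two.
exists l2, p, q; split=> //.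
- by rewrite lt_eqF// (le_lt_trans pk)// (lt_le_trans k12).
- apply/seteqP; split=> [r Hr|r [->|->]//].
  have [rk|rk] := argmin_dichotomy Hr; [left|right].
    exact: argmin_left_unique Hr Hp rk pk.
  exact: argmin_right_unique Hr Hq rk qk.
move=> l l0 /eqP ll2; have [k Hk] := argmin_nonempty l0; exists k.
(* By [argmin_homo], minimisers for a mass below [l2] are at most [p] and those for a mass above
   [l2] at least [q]; hence the two outer branches never compete. *)
have no_two x y : argmin l x -> argmin l y -> x <= k1 -> k2 <= y -> False.
  move=> Hx Hy xk yk; move: ll2; rewrite neq_lt => /orP[ll2|ll2].
    have := argmin_homo ll2 Hy Hp; rewrite leNgt (le_lt_trans pk)//.
    exact: lt_le_trans k12 yk.
  have := argmin_homo ll2 Hq Hx; rewrite leNgt (le_lt_trans xk)//.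
  exact: lt_le_trans k12 qk.
apply/seteqP; split=> [r Hr|r ->//].
have [rk|rk] := argmin_dichotomy Hr; have [kk|kk] := argmin_dichotomy Hk.
- exact: argmin_left_unique Hr Hk rk kk.
- by case: (no_two _ _ Hr Hk rk kk).
- by case: (no_two _ _ Hk Hr kk rk).
- exact: argmin_right_unique Hr Hk rk kk.
Qed.

End Bistable.

End ReducedEnergy.

(** * The profiles *)

Section EvenIntegral.
Variable R : realType.
Local Notation mu := (@lebesgue_measure R).

(** Nonnegativity lets the improper integral be computed in the extended reals first; its finite
    value then yields integrability. *)
Lemma even_integral_FTC (f F : R -> R) (l : R) : (forall x, 0 <= f x) -> continuous f ->
  (forall x, f (- x) = f x) -> (forall x : R, is_derive x 1 F (f x)) ->
  F x @[x --> +oo] --> l -> F 0 = 0 ->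
  mu.-integrable setT (EFin \o f) /\ \int[mu]_x f x = 2 * l.
Proof.
move=> f0 cf ef dF Fl F0.
have H : (\int[mu]_x (f x)%:E = (2 * l)%:E)%E.
  rewrite ge0_symfun_integralT//; last by move=> x; rewrite /= ef.
  rewrite (_ : [set x : R | 0 <= x] = `[0, +oo[%classic); last first.
    by apply/seteqP; split=> x /=; rewrite in_itv/= andbT.
  have d0 x : 0 < x -> derivable F x 1 by move=> _; case: (dF x).
  have F0r : F x @[x --> 0^'+] --> F 0.
    by apply: cvg_at_right_filter; exact: is_derive_continuous (dF 0).
  have dE : {in `]0, +oo[%R, derive1 F =1 f} by move=> x _; have /is_deriveE[] := dF x.
  rewrite (ge0_continuous_FTC2y (fun x _ => f0 x) (continuous_subspaceT cf) Fl d0 F0r dE).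
  by rewrite F0 sube0 EFinM.
split; last by rewrite /Rintegral H.
apply/integrableP; split.
  by apply/measurable_EFinP; exact: continuous_measurable.
under eq_integral do rewrite /= ger0_norm//.
by rewrite H ltry.
Qed.

End EvenIntegral.

Section Profile.
Variables (R : realType) (a b c : R).
Hypotheses (ha : 0 < a) (hc : 0 < c) (hb : b ^+ 2 < 3 * (a * c)).
Variable k : R.
Hypothesis k0 : 0 < k.
Implicit Types (x y z s t e d : R).

Local Notation cubic := (cubic a b c).
Local Notation dcubic := (dcubic a b c).
Local Notation quadr := (quadr a b c).

Let speed y := cubic (k ^+ 2 - y ^+ 2) / dcubic (k ^+ 2 - y ^+ 2).

(** With $v=k^2-y^2$ and $P(v)=v\,q(v)$, the inverse speed is $P'/P=1/v+q'(v)/q(v)$. This is the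
    second summand, continuous on the whole line because $q>0$. *)
Let smooth_part y := (2 * a * (k ^+ 2 - y ^+ 2) + b) / quadr (k ^+ 2 - y ^+ 2).

(* [travel] is the time that the profile equation [y' = speed y] needs to go from 0 to y;
   its logarithmic part comes from the simple zeros of [speed] at [k] and [-k]. *)
Let travel y := ln ((k + y) / (k - y)) / (2 * k) + sint smooth_part y.

Let sqrB_gt0 y : - k < y -> y < k -> 0 < k ^+ 2 - y ^+ 2.
Proof. by move=> h1 h2; rewrite subr_sqr mulr_gt0//; lra. Qed.

Let dcubic0 v : 0 < dcubic v. Proof. exact: dcubic_gt0. Qed.
Let quadr0 v : 0 < quadr v. Proof. exact: quadr_gt0. Qed.

Let continuous_smooth_part : continuous smooth_part.
Proof.
move=> y.
have cv : {for y, continuous (fun y => k ^+ 2 - y ^+ 2)}.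
  apply: cvgB; first exact: cvg_cst.
  by apply: cvgM; exact: cvg_id.
apply: cvgM.
  by apply: cvgD; [apply: cvgM; [exact: cvg_cst|exact: cv]|exact: cvg_cst].
apply: cvgV; first by rewrite gt_eqF// quadr0.
apply: cvgD; last exact: cvg_cst.
by apply: cvgD; [apply: cvgM; [exact: cvg_cst|apply: cvgM; exact: cv]|apply: cvgM; [exact:
    cvg_cst|exact: cv]].
Qed.

Let speed_gt0 y : - k < y -> y < k -> 0 < speed y.
Proof. by move=> h1 h2; rewrite divr_gt0// cubicE mulr_gt0// sqrB_gt0. Qed.

Let is_derive_travel y : - k < y -> y < k -> is_derive y 1 travel (speed y)^-1.
Proof.
move=> h1 h2; have p1 : 0 < k + y by lra.
have p2 : 0 < k - y by lra.
have D1 : is_derive y 1 (fun y => (k + y) / (k - y)) _ :=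
  is_derive_mul (is_derive_add (is_derive_cst k y 1) (is_derive_id y 1))
   (@is_derive_inv _ (fun y => k - y) y _ (lt0r_neq0 p2) (is_derive_sub (is_derive_cst k y 1)
       (is_derive_id y 1))).
have D2 := @is_derive_comp1 _ (@ln R) (fun y => (k + y) / (k - y)) y _ _ (is_derive1_ln (divr_gt0
    p1 p2)) D1.
have D3 := is_derive_add (is_derive_mul D2 (is_derive_cst (2 * k)^-1 y 1)) (is_derive_sint y
    continuous_smooth_part).
apply: is_derive_eq D3 _.
rewrite /speed [RHS]invf_div cubicE /smooth_part mulr0 addr0 /cst.
have -> : dcubic (k ^+ 2 - y ^+ 2) = quadr (k ^+ 2 - y ^+ 2) +
    (k ^+ 2 - y ^+ 2) * (2 * a * (k ^+ 2 - y ^+ 2) + b) by rewrite /dcubic /quadr; ring.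
have := gt_eqF (quadr0 (k ^+ 2 - y ^+ 2)).
have := gt_eqF (sqrB_gt0 h1 h2).
set q := quadr _ => v0 q0.
have -> : k ^+ 2 - y ^+ 2 = (k - y) * (k + y) by ring.
field.
by rewrite q0 !gt_eqF.
Qed.

Let travel_lt y z : - k < y -> y < z -> z < k -> travel y < travel z.
Proof.
move=> h1 yz h2.
have [t|t|s] := MVT yz (f := travel) (df := fun t => (speed t)^-1).
- by rewrite in_itv/= => /andP[h3 h4]; apply: is_derive_travel; lra.
- apply: continuous_in_subspaceT => u; rewrite inE/= in_itv/= => /andP[h3 h4].
  apply: is_derive_continuous (is_derive_travel _ _); lra.
rewrite in_itv/= => /andP[h3 h4] H.
by rewrite -subr_gt0 H mulr_gt0 ?subr_gt0// invr_gt0 speed_gt0//; lra.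
Qed.

Let travelN y : - k < y -> y < k -> travel (- y) = - travel y.
Proof.
move=> h1 h2; rewrite /travel opprK opprD; congr (_ + _).
  rewrite -mulNr -lnV ?posrE ?divr_gt0//; [by rewrite invf_div|lra|lra].
apply/eqP; rewrite -subr_eq0 opprK; apply/eqP.
have -> : 0 = sint smooth_part (- 0) + sint smooth_part 0.
  by rewrite oppr0 /sint subrr addr0.
apply: (@is_derive_0_is_cst _ (fun y => sint smooth_part (- y) + sint smooth_part y)) => z.
apply: is_derive_eq (is_derive_add (@is_derive_comp1 _ (sint smooth_part) (fun y => - y) z _ _
  (is_derive_sint _ continuous_smooth_part) (is_derive_opp (is_derive_id z 1)))
  (is_derive_sint z continuous_smooth_part)) _.
by rewrite /smooth_part sqrrN mulrN1 addNr.
Qed.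

Let travel0 : travel 0 = 0.
Proof. by rewrite /travel subr0 addr0 divff ?gt_eqF// ln1 mul0r /sint subrr addr0. Qed.

Let travel_onto_ge0 x : 0 <= x -> exists y, [/\ - k < y, y < k & travel y = x].
Proof.
move=> x0.
have [|z _ Hz] := @EVT_min R (sint smooth_part) 0 k (ltW k0).
  apply: continuous_subspaceT => z.
  exact: is_derive_continuous (is_derive_sint z continuous_smooth_part).
pose M := x + `|sint smooth_part z|.
have M0 : 0 <= M by rewrite addr_ge0.
pose E := expR (2 * k * M).
have E1 : 1 <= E by rewrite -expR0 ler_expR mulr_ge0// mulr_ge0// ltW.
have E0 : 0 < E + 1 by lra.
(* The solution of $(k+w)/(k-w)=E$: the logarithmic part of [travel] equals [M] there, which
   outweighs the minimum of the smooth part. *)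
pose w := k * (E - 1) / (E + 1).
have w0 : 0 <= w by rewrite divr_ge0 ?mulr_ge0 ?subr_ge0// ltW.
have wk : w < k by rewrite ltr_pdivrMr// ltr_pM2l//; lra.
have tw : x <= travel w.
  rewrite /travel.
  have -> : (k + w) / (k - w) = E.
    have E1n : E + 1 != 0 by rewrite gt_eqF.
    have -> : k + w = 2 * k * E / (E + 1) by rewrite /w; field.
    have -> : k - w = 2 * k / (E + 1) by rewrite /w; field.
    by field; rewrite E1n gt_eqF.
  rewrite /E expRK mulrAC divff ?mul1r; last by rewrite mulf_neq0 ?gt_eqF.
  have := Hz w; rewrite in_itv/= w0 (ltW wk) => /(_ isT).
  have := ler_norm (- sint smooth_part z); rewrite normrN /M; lra.
have [||u] := @IVT R travel 0 w x w0.
- apply: continuous_in_subspaceT => u; rewrite inE/= in_itv/= => /andP[h3 h4].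
  apply: is_derive_continuous (is_derive_travel _ _); lra.
- by rewrite travel0 ge_min le_max x0 tw orbT.
by rewrite in_itv/= => /andP[u0 uw] Hu; exists u; split=> //; lra.
Qed.

Let travel_onto x : exists y, [/\ - k < y, y < k & travel y = x].
Proof.
have [/travel_onto_ge0//|x0] := lerP 0 x.
have [|y [h1 h2 H]] := @travel_onto_ge0 (- x); first by rewrite oppr_ge0 ltW.
by exists (- y); split; [lra|lra|rewrite travelN// H opprK].
Qed.

(** The global solution of $y'=speed(y)$ through 0, obtained by inverting [travel] rather than from
    an existence theorem. The default of [xget] never occurs, as [travel] maps $(-k,k)$ onto the
    line. *)
Definition trajectory x := xget 0 [set y | [/\ - k < y, y < k & travel y = x]].

Local Notation Y := trajectory.

Let YP x : [/\ - k < Y x, Y x < k & travel (Y x) = x].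
Proof. exact: (xgetPex 0 (travel_onto x)). Qed.
Let Y_gt x : - k < Y x. Proof. by case: (YP x). Qed.
Let Y_lt x : Y x < k. Proof. by case: (YP x). Qed.
Let travelK x : travel (Y x) = x. Proof. by case: (YP x). Qed.
Let YK y : - k < y -> y < k -> Y (travel y) = y.
Proof.
move=> h1 h2.
have [yz|zy|//] := ltgtP (Y (travel y)) y.
  by have := travel_lt (Y_gt _) yz h2; rewrite travelK ltxx.
by have := travel_lt h1 zy (Y_lt _); rewrite travelK ltxx.
Qed.

Let YN x : Y (- x) = - Y x.
Proof.
have h1 := Y_gt x; have h2 := Y_lt x.
rewrite -{1}(travelK x) -travelN// YK//; lra.
Qed.

Let Y0 : Y 0 = 0.
Proof. by rewrite -travel0 YK//; move: k0; lra. Qed.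

Let is_derive_Y x : is_derive x 1 Y (speed (Y x)).
Proof.
have h1 := Y_gt x; have h2 := Y_lt x.
rewrite -{1}(travelK x) -(invrK (speed (Y x))).
have near_in (P : R -> Prop) : (forall y, - k < y -> y < k -> P y) -> \forall y \near (Y x), P y.
  move=> H; near=> y; apply: H.
    by near: y; apply: lt_nbhsr.
  by near: y; apply: lt_nbhsl.
apply: (@is_derive_inverse _ travel Y).
- by apply: near_in => y; exact: YK.
- by apply: near_in => y y1 y2; exact: is_derive_continuous (is_derive_travel y1 y2).
- exact: is_derive_travel.
- by rewrite invr_eq0 gt_eqF// speed_gt0.
Unshelve. all: by end_near. Qed.

Let Y_cvg : Y x @[x --> +oo] --> k.
Proof.
apply/cvgrPdist_le => e e0.
pose y := Num.max 0 (k - e).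
have yk : y < k by rewrite gt_max k0/= ltrBlDr ltrDl.
have y0 : 0 <= y by rewrite le_max lexx.
have ye : k - e <= y by rewrite le_max lexx orbT.
near=> x.
have xy : travel y < x by near: x; apply: nbhs_pinfty_gt; exact: num_real.
have yx : y <= Y x.
  rewrite leNgt; apply/negP => Yy; have h := travel_lt (Y_gt x) Yy yk.
  by have := lt_trans h xy; rewrite travelK ltxx.
have := Y_lt x => Yk; rewrite ger0_norm; lra.
Unshelve. all: by end_near. Qed.

Definition profile x := Num.sqrt (cubic (k ^+ 2 - Y x ^+ 2)).

Local Notation phi := profile.

Let v_gt0 x : 0 < k ^+ 2 - Y x ^+ 2.
Proof. exact: sqrB_gt0. Qed.

Let cubic_v_gt0 x : 0 < cubic (k ^+ 2 - Y x ^+ 2).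
Proof. by rewrite cubicE mulr_gt0// v_gt0. Qed.

Lemma profile_gt0 x : 0 < phi x.
Proof. by rewrite sqrtr_gt0. Qed.

Lemma profile_even x : phi (- x) = phi x.
Proof. by rewrite /phi YN sqrrN. Qed.

Lemma profile_sqr x : phi x ^+ 2 = cubic (k ^+ 2 - Y x ^+ 2).
Proof. by rewrite sqr_sqrtr// ltW. Qed.

Lemma profile0 : phi 0 = Num.sqrt (cubic (k ^+ 2)).
Proof. by rewrite /phi Y0 expr0n subr0. Qed.

(** [Y] is odd and carries the sign that [height] loses, so one formula holds on both sides of the
    maximum and nothing is glued at 0. *)
Lemma is_derive_profile x : is_derive x 1 phi (- (Y x * phi x)).
Proof.
have D1 : is_derive x 1 (fun x => k ^+ 2 - Y x ^+ 2) _ :=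
  is_derive_sub (is_derive_cst (k ^+ 2) x 1) (is_derive_pow 2 (is_derive_Y x)).
have D2 := @is_derive_comp1 _ cubic (fun x => k ^+ 2 - Y x ^+ 2) x _ _
  (is_derive_cubic b c ha _) D1.
have D3 := @is_derive_comp1 _ Num.sqrt (fun x => cubic (k ^+ 2 - Y x ^+ 2)) x _ _
  (is_derive1_sqrt (cubic_v_gt0 x)) D2.
apply: is_derive_eq D3 _.
have p0 := profile_gt0 x.
have d0 := dcubic0 (k ^+ 2 - Y x ^+ 2).
have -> : Num.sqrt (cubic (k ^+ 2 - Y x ^+ 2)) = phi x by [].
rewrite /speed -profile_sqr /=.
move: p0 d0; set d := dcubic _; set p := phi x => p0 d0.
by field; rewrite !gt_eqF.
Qed.

Lemma continuous_profile : continuous phi.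
Proof. by move=> x; exact: is_derive_continuous (is_derive_profile x). Qed.

Lemma continuous_trajectory : continuous Y.
Proof. by move=> x; exact: is_derive_continuous (is_derive_Y x). Qed.

Local Notation mu := (@lebesgue_measure R).

(** The chain rule gives $(halfmass_k(Y))'=P'\cdot P/P'=\phi^2$, and $Y\to k$ at infinity. *)
Lemma profile_mass : mu.-integrable setT (EFin \o (fun x => phi x ^+ 2)) /\
  \int[mu]_x (phi x ^+ 2) = frequency_mass a b c k.
Proof.
apply: (@even_integral_FTC R (fun x => phi x ^+ 2) (fun x => halfmass a b c k (Y x)) (halfmass a
    b c k k)).
- by move=> x; exact: sqr_ge0.
- by move=> x; apply: cvgM; exact: continuous_profile.
- by move=> x; rewrite profile_even.
- move=> x; apply: is_derive_eq (@is_derive_comp1 _ (halfmass a b c k) Y x _ _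
    (is_derive_halfmass a b c k (Y x)) (is_derive_Y x)) _.
  by rewrite profile_sqr /speed mulrCA divff ?mulr1// gt_eqF.
- have H : {for k, continuous (halfmass a b c k)}.
    exact: (is_derive_continuous (is_derive_halfmass a b c k k)).
  exact: (cvg_comp _ _ Y_cvg H).
- by rewrite Y0 /halfmass; ring.
Qed.

(** A version on a bounded interval, for the mass comparison that excludes an off-centre maximum. *)
Lemma profile_mass_half e : 0 < e -> exists2 z : R, 0 <= z &
  frequency_mass a b c k - e <= 2 * Int (fun x => phi x ^+ 2) 0 z.
Proof.
move=> e0; have e2 : 0 < e / 2 by rewrite divr_gt0.
have H : {for k, continuous (halfmass a b c k)}.
  exact: (is_derive_continuous (is_derive_halfmass a b c k k)).
have cphi2 : continuous (fun x => phi x ^+ 2) by move=> x; apply: cvgM; exact: continuous_profile.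
have dF x : is_derive x 1 (fun x => halfmass a b c k (Y x)) (phi x ^+ 2).
  apply: is_derive_eq (@is_derive_comp1 _ (halfmass a b c k) Y x _ _
    (is_derive_halfmass a b c k (Y x)) (is_derive_Y x)) _.
  by rewrite profile_sqr /speed mulrCA divff ?mulr1// gt_eqF.
have /cvgrPdist_le/(_ _ e2) Hz := cvg_comp _ _ Y_cvg H.
have [z [z0 zle]] : exists z : R, 0 < z /\ `|halfmass a b c k k - halfmass a b c k (Y z)| <= e /
    2.
  near (+oo : set_system R) => z; exists z; split; near: z; last exact: Hz.
  by apply: nbhs_pinfty_gt; exact: num_real.
exists z; first exact: ltW.
rewrite (Int_FTC cphi2 dF (ltW z0)) Y0.
have -> : halfmass a b c k 0 = 0 by rewrite /halfmass; ring.
by have := le_trans (ler_norm _) zle; rewrite /frequency_mass; lra.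
Unshelve. all: by end_near. Qed.

Lemma profile_action : mu.-integrable setT (EFin \o (fun x => (Y x * phi x) ^+ 2)) /\
  \int[mu]_x ((Y x * phi x) ^+ 2) = 2 * action a b c k k.
Proof.
apply: (@even_integral_FTC R (fun x => (Y x * phi x) ^+ 2) (fun x => action a b c k (Y x))
    (action a b c k k)).
- by move=> x; exact: sqr_ge0.
- move=> x; have cc : {for x, continuous (fun x => Y x * phi x)}.
    by apply: cvgM; [exact: continuous_trajectory|exact: continuous_profile].
  by apply: cvgM; exact: cc.
- by move=> x; rewrite profile_even YN mulNr sqrrN.
- move=> x; apply: is_derive_eq (@is_derive_comp1 _ (action a b c k) Y x _ _
    (is_derive_action a b c k (Y x)) (is_derive_Y x)) _.
  by rewrite exprMn profile_sqr /speed; field; rewrite gt_eqF.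
- have H : {for k, continuous (action a b c k)}.
    exact: (is_derive_continuous (is_derive_action a b c k k)).
  exact: (cvg_comp _ _ Y_cvg H).
- by rewrite Y0 /action; ring.
Qed.

Variable V : R -> R.
Hypothesis hV : forall s, 0 <= s -> s ^+ 2 = a * V s ^+ 3 + b * V s ^+ 2 + c * V s.

Lemma Ve_profile x : Ve V (phi x) = k ^+ 2 - Y x ^+ 2.
Proof. by rewrite (Ve_sqrt ha hb hV)// ltW. Qed.

(** The right-hand side is not Lipschitz at the maximum, where the constant also solves the
    equation. The strict inequality beyond [x1] rules out waiting there; then [travel] composed with
    the height has derivative 1, which determines [n]. *)
Lemma profile_unique (n : R -> R) x1 : continuous n -> (forall x, 0 < n x) ->
  Ve V (n x1) = k ^+ 2 -> (forall x, x1 < x -> Ve V (n x) < k ^+ 2) ->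
  (forall x, x1 < x -> is_derive x 1 n (- (n x * height V k (n x)))) ->
  forall x, x1 <= x -> n x = phi (x - x1).
Proof.
move=> cn n0 nx1 nlt dn x xx1.
pose y t := height V k (n t).
have cy : continuous y.
  move=> t; apply: (@continuous_comp _ _ _ n (height V k)); first exact: cn.
  exact: (@continuous_height _ _ _ _ ha hb _ hV k).
have yle t : x1 <= t -> Ve V (n t) <= k ^+ 2.
  by rewrite le_eqVlt => /orP[/eqP<-|/nlt/ltW//]; rewrite nx1.
have y1 : y x1 = 0 by rewrite /y /height nx1 subrr sqrtr0.
have ysq t : x1 <= t -> y t ^+ 2 = k ^+ 2 - Ve V (n t) by move=> /yle; exact: height_sqr.
have yge t : 0 <= y t by rewrite sqrtr_ge0.
have ylt t : x1 <= t -> y t < k.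
  move=> tx; rewrite -ltr_sqr ?nnegrE ?yge ?(ltW k0)// ysq//.
  by rewrite ltrBlDr ltrDl (Ve_gt0 ha hb hV)// gt_eqF.
have ygt t : - k < y t by apply: lt_le_trans (yge t); rewrite oppr_lt0.
have T1 : travel (y x) = x - x1.
  have [t|t|z] := MVT_segment xx1 (f := fun t => travel (y t)) (df := cst 1).
  - rewrite in_itv/= => /andP[tx1 _].
    have Dy := @is_derive_comp1 _ (height V k) n t _ _ (is_derive_height ha hb hV (nlt t tx1))
        (dn t tx1).
    have D := @is_derive_comp1 _ travel y t _ _ (is_derive_travel (ygt t) (ylt t (ltW tx1))) Dy.
    apply: is_derive_eq D _.
    have vE : k ^+ 2 - y t ^+ 2 = Ve V (n t) by rewrite (ysq t (ltW tx1)) subKr.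
    have yt : y t != 0 by rewrite gt_eqF// sqrtr_gt0 subr_gt0 nlt.
    rewrite /speed vE (cubic_Ve hV) -/(y t); field.
    by rewrite yt !gt_eqF.
  - apply: continuous_in_subspaceT => u; rewrite inE/= in_itv/= => /andP[h3 h4].
    apply: (@continuous_comp _ _ _ y travel); first exact: cy.
    by apply: is_derive_continuous (is_derive_travel _ _); [exact: ygt|exact: ylt].
  by rewrite y1 travel0 subr0 mul1r.
rewrite /phi -T1 YK//; last exact: ylt.
rewrite ysq// subKr (cubic_Ve hV) sqrtr_sqr gtr0_norm//.
Qed.

End Profile.

(** * Decay and modulus of functions in H^1 *)

Section Decay.
Variable R : realType.
Local Notation mu := (@lebesgue_measure R).
Implicit Types (f n D : R -> R) (x y t e : R).

(** The primitive is monotone and bounded. Beyond a point where it is within [e] of its supremum, or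
    before one where it is within [e] of its infimum, it can vary by at most [e]. *)
Lemma Int_tail f e : mu.-integrable setT (EFin \o f) -> (forall x, 0 <= f x) -> 0 < e ->
  exists2 A : R, 0 <= A & forall x y, x <= y -> A <= x \/ y <= - A -> Int f x y <= e.
Proof.
move=> If f0 e0; have Lf := locint_integrable If.
set I := \int[mu]_x f x.
have bI x y : x <= y -> 0 <= sint f y - sint f x <= I.
  by move=> xy; rewrite sintB// Int_ge0//=; apply: le_Int_Rint.
have s0 : sint f 0 = 0 by rewrite /sint subrr.
have bound x : - I <= sint f x <= I.
  have [x0|/ltW x0] := lerP 0 x; have := bI _ _ x0; rewrite s0 => /andP[? ?]; apply/andP; split;
      lra.
pose S := range (sint f).
have hS : has_sup S.
  by split; [exists (sint f 0), 0|exists I => _ [x _ <-]; case/andP: (bound x)].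
have hI : has_inf S.
  by split; [exists (sint f 0), 0|exists (- I) => _ [x _ <-]; case/andP: (bound x)].
have [_ [p _ <-] Hp] := sup_adherent e0 hS.
have [_ [q _ <-] Hq] := inf_adherent e0 hI.
exists (Num.max `|p| `|q|); first by rewrite le_max normr_ge0.
move=> x y xy H; rewrite -sintB//; case: H.
  rewrite ge_max => /andP[px _]; have /andP[h _] := bI p x (le_trans (ler_norm _) px).
  have : sint f y <= sup S by apply: ub_le_sup; [case: hS|exists y].
  lra.
rewrite lerNr ge_max => /andP[_ H]; have yq : y <= q.
  by have := ler_norm (- q); rewrite normrN; lra.
have /andP[h _] := bI y q yq.
have : inf S <= sint f x by apply: ge_inf; [case: hI|exists x].
lra.
Qed.

Lemma decay n D (G : R) : (forall x, 0 <= n x) -> continuous n ->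
  mu.-integrable setT (EFin \o (fun x => n x ^+ 2)) ->
  (forall x y, x <= y -> D y - D x <= G) ->
  (forall x y t, x <= y ->
    t * `|n y - n x| <= 2^-1 * (D y - D x) + 2^-1 * (t ^+ 2 * (y - x))) ->
  forall e, 0 < e -> exists2 A : R, 0 <= A & forall x, A <= `|x| -> n x <= e.
Proof.
move=> n0 cn In2 DG nD e e0.
have G0 : 0 <= G by have := DG 0 0 (lexx _); rewrite subrr.
(* Over a length $d=t^{-2}$ this parameter gives $t\,|\Delta n|\le G+1$, an oscillation of at most
   $e/2$. *)
pose t := 2 * (G + 1) / e.
have t0 : 0 < t by rewrite divr_gt0// mulr_gt0//; lra.
pose d := (t ^+ 2)^-1.
have d0 : 0 < d by rewrite invr_gt0 exprn_gt0.
have uc x y : x <= y -> y <= x + d -> `|n y - n x| <= e / 2.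
  move=> xy yd; have := nD x y t xy; have := DG x y xy.
  have : t ^+ 2 * (y - x) <= 1.
    by rewrite mulrC -ler_pdivlMr ?exprn_gt0// div1r lerBlDl.
  move=> h1 h2 h3; have : t * `|n y - n x| <= G + 1 by lra.
  rewrite /t mulrAC ler_pdivrMr// => h4.
  rewrite -(@ler_pM2l _ (2 * (G + 1))) ?mulr_gt0//; lra.
have e2 : 0 < (e / 2) ^+ 2 * d / 2 by rewrite divr_gt0// mulr_gt0// exprn_gt0// divr_gt0.
have [A A0 HA] := Int_tail In2 (fun x => sqr_ge0 (n x)) e2.
(* The margin [d] keeps $[x,x+d]$ inside the tail for negative [x] as well. *)
exists (A + d); first by rewrite addr_ge0// ltW.
move=> x Ax; rewrite leNgt; apply/negP => enx.
have xd : x <= x + d by rewrite lerDl ltW.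
have side : A <= x \/ x + d <= - A.
  have [x0|x0] := lerP 0 x; [left|right].
    by move: Ax; rewrite ger0_norm//; lra.
  by move: Ax; rewrite ltr0_norm//; lra.
have := HA x (x + d) xd side.
apply/negP; rewrite -ltNge.
have : Int (cst ((e / 2) ^+ 2)) x (x + d) <= Int (fun x => n x ^+ 2) x (x + d).
  apply: Int_le => [||y /andP[xy yd]]; first exact: locint_cst.
    exact: locint_integrable.
  have := uc x y xy yd; rewrite ler_norml => /andP[h _].
  by rewrite /= ler_sqr ?nnegrE ?divr_ge0 ?(ltW e0)//; lra.
rewrite Int_cst// addrAC subrr add0r; apply: lt_le_trans.
have : 0 < (e / 2) ^+ 2 * d by rewrite mulr_gt0// exprn_gt0// divr_gt0.
lra.
Qed.

(** The rightmost maximiser is taken, from the compact set of maximisers; strictness beyond it is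
    what [profile_unique] requires. *)
Lemma decay_max n x0 : (forall x, 0 <= n x) -> continuous n -> 0 < n x0 ->
  (forall e, 0 < e -> exists2 A : R, 0 <= A & forall x, A <= `|x| -> n x <= e) ->
  exists x1, (forall x, n x <= n x1) /\ forall x, x1 < x -> n x < n x1.
Proof.
move=> n0 cn p0 dec.
have [A A0 HA] := dec (n x0 / 2) (divr_gt0 p0 (ltr0n _ 2)).
have out x : n x0 <= n x -> `|x| <= A.
  move=> h; rewrite leNgt; apply/negP => /ltW /HA; lra.
have AA : - A <= A by rewrite (le_trans _ A0)// oppr_le0.
have [|m mA Hm] := @EVT_max R n (- A) A AA; first exact: continuous_subspaceT.
have x0A : x0 \in `[- A, A]%R by rewrite in_itv/= -ler_norml out.
have Hmax x : n x <= n m.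
  have [xA|] := boolP (x \in `[- A, A]%R); first exact: Hm.
  rewrite in_itv/= -ler_norml => /negP H.
  rewrite leNgt; apply/negP => h; apply: H; apply: out.
  exact: le_trans (Hm _ x0A) (ltW h).
pose S := [set x | n x = n m].
have cS : compact S.
  apply: (@subclosed_compact _ S `[- A, A]).
  - have -> : S = n @^-1` [set n m] by [].
    by apply: closed_comp => //; exact: closed_eq.
  - exact: segment_compact.
  - by move=> x Sx; rewrite /= in_itv/= -ler_norml; apply: out; rewrite Sx.
have S0 : S !=set0 by exists m.
have cid : {within S, continuous (@id R)}.
  by apply: continuous_subspaceT => x; exact: cvg_id.
have [c cS' Hc] := @compact_EVT_max R R id S S0 cS cid.
have nc : n c = n m by move: cS'; rewrite inE.
exists c; split=> [x|x cx]; rewrite nc// lt_neqAle Hmax andbT; apply/eqP => h.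
by have := Hc x; rewrite inE => /(_ h); rewrite leNgt cx.
Qed.

End Decay.

(** * The modulus of a complex-valued function *)

Section Modulus.
Variable R : realType.
Local Notation mu := (@lebesgue_measure R).
Implicit Types (f g h : R -> R) (u : R -> R[i]) (x y t : R).

Lemma cabsE (z : R[i]) : cabs z = Num.sqrt (complex.Re z ^+ 2 + complex.Im z ^+ 2).
Proof. by case: z. Qed.

Lemma cabs_sqr (z : R[i]) : cabs z ^+ 2 = complex.Re z ^+ 2 + complex.Im z ^+ 2.
Proof. by rewrite cabsE sqr_sqrtr// addr_ge0 ?sqr_ge0. Qed.

Lemma cabs_ge0 (z : R[i]) : 0 <= cabs z.
Proof. by rewrite cabsE sqrtr_ge0. Qed.

Lemma wderivP u : H1 u -> L2_derivatives u (wderiv u).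
Proof. by move=> [_ ex]; exact: xgetPex. Qed.

Lemma L2_ae f h : L2 f -> continuous h -> {ae mu, forall t, f t = h t} -> L2 h.
Proof.
move=> Lf ch fh; have [mf If] := (L2P f).1 Lf.
have mh := continuous_measurable ch.
apply/L2P; split => //; have /integrableP[_ fin] := If.
apply/integrableP; split.
  by apply/measurable_EFinP; exact: measurable_funX.
apply: le_lt_trans fin; rewrite le_eqVlt; apply/orP; left; apply/eqP.
apply: ge0_ae_eq_integral => //.
- apply: measurableT_comp => //; apply/measurable_EFinP; exact: measurable_funX.
- apply: measurableT_comp => //; apply/measurable_EFinP; exact: measurable_funX.
- case: fh => N [mN N0 sub]; exists N; split=> // x /= H; apply: sub => /= E.
  by apply: H => _; rewrite /= E.
Qed.

Lemma cauchy_schwarz2 (p1 p2 q1 q2 : R) :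
  p1 * q1 + p2 * q2 <= Num.sqrt (p1 ^+ 2 + p2 ^+ 2) * Num.sqrt (q1 ^+ 2 + q2 ^+ 2).
Proof.
apply: le_trans (ler_norm _) _; rewrite -sqrtr_sqr -sqrtrM ?addr_ge0 ?sqr_ge0//.
rewrite ler_wsqrtr//; have : 0 <= (p1 * q2 - p2 * q1) ^+ 2 by exact: sqr_ge0.
by lra.
Qed.

Section Representative.
Variables (h1 h2 g1 g2 : R -> R).
Hypotheses (ch1 : continuous h1) (ch2 : continuous h2).
Hypotheses (Lg1 : L2 g1) (Lg2 : L2 g2).
Hypothesis hg1 : forall x y, x <= y -> h1 y - h1 x = Int g1 x y.
Hypothesis hg2 : forall x y, x <= y -> h2 y - h2 x = Int g2 x y.

Definition modulus x := Num.sqrt (h1 x ^+ 2 + h2 x ^+ 2).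
Definition gradient_sqr x := g1 x ^+ 2 + g2 x ^+ 2.

Lemma modulus_sqr x : modulus x ^+ 2 = h1 x ^+ 2 + h2 x ^+ 2.
Proof. by rewrite sqr_sqrtr// addr_ge0 ?sqr_ge0. Qed.

Lemma modulus_ge0 x : 0 <= modulus x.
Proof. exact: sqrtr_ge0. Qed.

Lemma continuous_modulus : continuous modulus.
Proof.
move=> x; apply: (@continuous_comp _ _ _ (fun x => h1 x ^+ 2 + h2 x ^+ 2) Num.sqrt).
  by apply: cvgD; apply: cvgM; [exact: ch1|exact: ch1|exact: ch2|exact: ch2].
exact: sqrt_continuous.
Qed.

Lemma integrable_gradient_sqr : mu.-integrable setT (EFin \o gradient_sqr).
Proof. by apply: integrable_addF => //; [have [] := (L2P g1).1 Lg1|have [] := (L2P g2).1 Lg2].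
    Qed.

(** Project $(h_1,h_2)$ on a fixed vector of length at most $|t|$ and apply Young's inequality under
    the integral. The vector is parallel to the endpoint value of larger modulus, so Cauchy-Schwarz
    turns the projected increment into that of the modulus, and zeros of $u$ cause no trouble. *)
Lemma modulus_lipschitz x y t : x <= y ->
  t * `|modulus y - modulus x| <=
    2^-1 * (sint gradient_sqr y - sint gradient_sqr x) + 2^-1 * (t ^+ 2 * (y - x)).
Proof.
move=> xy.
have Id := locint_integrable integrable_gradient_sqr.
have lin (al be : R) : al ^+ 2 + be ^+ 2 <= t ^+ 2 ->
    al * (h1 y - h1 x) + be * (h2 y - h2 x) <=
    2^-1 * (sint gradient_sqr y - sint gradient_sqr x) + 2^-1 * (t ^+ 2 * (y - x)).
  move=> abt; rewrite hg1// hg2// (sintB Id xy).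
  have L1 := locint_L2 Lg1; have L2' := locint_L2 Lg2.
  rewrite -!IntZ// -IntD; [|exact: locintZ|exact: locintZ].
  rewrite -(Int_cst _ xy) -IntZ; last exact: locint_cst.
  rewrite -IntD; [|exact: locintZ|by apply: locintZ; exact: locint_cst].
  apply: Int_le => [||s _].
  - by apply: locintD; exact: locintZ.
  - by apply: locintD; apply: locintZ => //; exact: locint_cst.
  - rewrite /= /gradient_sqr.
    by have := sqr_ge0 (g1 s - al); have := sqr_ge0 (g2 s - be); rewrite !sqrrB; lra.
have zero : t * `|modulus y - modulus x| <= 0 -> t * `|modulus y - modulus x| <=
    2^-1 * (sint gradient_sqr y - sint gradient_sqr x) + 2^-1 * (t ^+ 2 * (y - x)).
  move=> h; apply: le_trans h _; have := lin 0 0; rewrite !mul0r addr0; apply.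
  by rewrite expr0n addr0 sqr_ge0.
have [t0|/ltW t0] := lerP t 0; first by apply: zero; rewrite mulr_le0_ge0.
have cs := cauchy_schwarz2.
have [yx|yx|yx] := ltgtP (modulus y) (modulus x).
- have p0 : 0 < modulus x by apply: le_lt_trans yx; exact: modulus_ge0.
  apply: le_trans (lin (- t * h1 x / modulus x) (- t * h2 x / modulus x) _); last first.
    rewrite le_eqVlt; apply/orP; left; apply/eqP.
    rewrite !exprMn -mulrDl sqrrN -mulrDr exprVn -modulus_sqr mulfK//.
    by rewrite expf_neq0// gt_eqF.
  have -> : - t * h1 x / modulus x * (h1 y - h1 x) + - t * h2 x / modulus x * (h2 y - h2 x)
    = t * ((h1 x ^+ 2 + h2 x ^+ 2) - (h1 x * h1 y + h2 x * h2 y)) / modulus x by ring.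
  rewrite -modulus_sqr -mulrA ler_wpM2l// ler_pdivlMr// ltr0_norm ?subr_lt0//.
  have := cs (h1 x) (h2 x) (h1 y) (h2 y); rewrite -/(modulus x) -/(modulus y).
  by rewrite opprB mulrBl -expr2; lra.
- have p0 : 0 < modulus y by apply: le_lt_trans yx; exact: modulus_ge0.
  apply: le_trans (lin (t * h1 y / modulus y) (t * h2 y / modulus y) _); last first.
    rewrite le_eqVlt; apply/orP; left; apply/eqP.
    rewrite !exprMn -mulrDl -mulrDr exprVn -modulus_sqr mulfK//.
    by rewrite expf_neq0// gt_eqF.
  have -> : t * h1 y / modulus y * (h1 y - h1 x) + t * h2 y / modulus y * (h2 y - h2 x)
    = t * ((h1 y ^+ 2 + h2 y ^+ 2) - (h1 y * h1 x + h2 y * h2 x)) / modulus y by ring.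
  rewrite -modulus_sqr -mulrA ler_wpM2l// ler_pdivlMr// gtr0_norm ?subr_gt0//.
  have := cs (h1 y) (h2 y) (h1 x) (h2 x); rewrite -/(modulus x) -/(modulus y).
  by rewrite mulrBl -expr2; lra.
- by apply: zero; rewrite yx subrr normr0 mulr0.
Qed.

End Representative.

Lemma H1_modulus u : H1 u -> exists h1 h2 g1 g2 : R -> R,
  [/\ continuous h1 /\ continuous h2, L2 g1 /\ L2 g2,
      (forall x y, x <= y -> h1 y - h1 x = Int g1 x y) /\
      (forall x y, x <= y -> h2 y - h2 x = Int g2 x y),
      {ae mu, forall x, complex.Re (u x) = h1 x} /\ {ae mu, forall x, complex.Im (u x) = h2 x} &
      g1 = (fun x => complex.Re (wderiv u x)) /\ g2 = (fun x => complex.Im (wderiv u x))].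
Proof.
move=> Hu; have [[L1 L2'] [W1 W2]] := wderivP Hu; have [[Lu1 Lu2] _] := Hu.
have [h1 [ch1 ae1 I1]] := H1_representative Lu1 L1 W1.
have [h2 [ch2 ae2 I2]] := H1_representative Lu2 L2' W2.
by exists h1, h2, (fun x => complex.Re (wderiv u x)), (fun x => complex.Im (wderiv u x)).
Qed.

Lemma ae_Rintegral_comp (F : R -> R) u h1 h2 : continuous F -> L2C u ->
  continuous h1 -> continuous h2 ->
  {ae mu, forall x, complex.Re (u x) = h1 x} -> {ae mu, forall x, complex.Im (u x) = h2 x} ->
  \int[mu]_x F (cabs (u x)) = \int[mu]_x F (modulus h1 h2 x).
Proof.
move=> cF [Lu1 Lu2] c1 c2 ae1 ae2.
have mF := continuous_measurable cF.
apply: ae_eq_Rintegral => //.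
- apply: (@measurableT_comp _ _ _ _ _ _ F) => //.
  rewrite (_ : (fun x => cabs (u x)) = Num.sqrt \o
    (fun x => complex.Re (u x) ^+ 2 + complex.Im (u x) ^+ 2)); last first.
    by apply/funext => x; rewrite /= cabsE.
  apply: measurableT_comp; first exact: (continuous_measurable (@sqrt_continuous R)).
  by apply: measurable_funD; apply: measurable_funX; exact: measurable_L2.
- apply: continuous_measurable => x.
  apply: (@continuous_comp _ _ _ (modulus h1 h2) F); last exact: cF.
  exact: continuous_modulus.
case: ae1 => N1 [mN1 N10 sub1]; case: ae2 => N2 [mN2 N20 sub2].
exists (N1 `|` N2); split; [exact: measurableU|exact: null_set_setU|].
move=> x /= H; apply: contrapT => /not_orP[n1 n2]; apply: H.
have E1 : complex.Re (u x) = h1 x by apply: contrapT => E; apply: n1; apply: sub1.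
have E2 : complex.Im (u x) = h2 x by apply: contrapT => E; apply: n2; apply: sub2.
by rewrite cabsE E1 E2.
Qed.

End Modulus.

(** * Ground states *)

Section LowerBound.
Variables (R : realType) (a b c : R).
Hypotheses (ha : 0 < a) (hc : 0 < c) (hb : b ^+ 2 < 3 * (a * c)).
Variable V : R -> R.
Hypothesis hV : forall s, 0 <= s -> s ^+ 2 = a * V s ^+ 3 + b * V s ^+ 2 + c * V s.
Local Notation mu := (@lebesgue_measure R).
Implicit Types (u : R -> R[i]) (n D C : R -> R) (x y t e k l : R).
Local Notation E := (energy (potential V)).
Local Notation height := (height V).
Local Notation action := (action a b c).
Local Notation hh := (reduced_energy a b c).

(* [n] is the modulus of the function, [D] and [C] are primitives of the two halves of the
   integrand of [2 E + k^2 M], and [k^2] is the value of [V] at the maximum of [n]. *)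
Record bogomolny_data (l e : R) n D C k : Prop := BogomolnyData {
  bd_k : 0 < k;
  bd_cont : continuous n;
  bd_ge0 : forall x, 0 <= n x;
  bd_le : forall x, Ve V (n x) <= k ^+ 2;
  bd_D : forall x y t, x <= y ->
    t * `|n y - n x| <= 2^-1 * (D y - D x) + 2^-1 * (t ^+ 2 * (y - x));
  bd_C : forall x, is_derive x 1 C ((n x * height k (n x)) ^+ 2);
  bd_max : exists2 x1, Ve V (n x1) = k ^+ 2 & forall x, x1 < x -> Ve V (n x) < k ^+ 2;
  bd_decay : forall r, 0 < r -> exists2 A : R, 0 <= A & forall x, A <= `|x| -> n x <= r;
  bd_energy : forall x y, x <= y ->
    2^-1 * (D y - D x) + 2^-1 * (C y - C x) <= e + k ^+ 2 / 2 * l;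
  bd_mass : mu.-integrable setT (EFin \o (fun x => n x ^+ 2)) /\ \int[mu]_x (n x ^+ 2) = l }.

Lemma potential_abs s : 0 <= s -> potential V s = - (s ^+ 2 * Ve V s / 2).
Proof. by move=> s0; rewrite /potential /Ve ger0_norm. Qed.

(** The maximum gives $V(n)\le k^2$, so the potential term is dominated by $k^2n^2/2$ and
    integrable. This is what allows the energy to be split and recombined. *)
Lemma bogomolny_dataP u l : 0 < l -> mass_sphere l u ->
  exists n D C k, bogomolny_data l (E u) n D C k /\
    (exists h1 h2, [/\ n = modulus h1 h2, continuous h1 /\ continuous h2,
      {ae mu, forall x, complex.Re (u x) = h1 x} & {ae mu, forall x, complex.Im (u x) = h2 x}]).
Proof.
move=> l0 [Hu Hm].
have [h1 [h2 [g1 [g2 [[c1 c2] [L1 L2'] [I1 I2] [ae1 ae2] [gE1 gE2]]]]]] := H1_modulus Hu.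
have [[Lu1 Lu2] _] := Hu.
pose n := modulus h1 h2; pose d := gradient_sqr g1 g2.
have cn : continuous n by exact: continuous_modulus.
have n0 x : 0 <= n x by exact: modulus_ge0.
have Id : mu.-integrable setT (EFin \o d) by exact: integrable_gradient_sqr.
have d0 x : 0 <= d x by rewrite addr_ge0 ?sqr_ge0.
have In2 : mu.-integrable setT (EFin \o (fun x => n x ^+ 2)).
  under eq_fun do rewrite modulus_sqr.
  apply: integrable_addF => //.
    by have [] := (L2P h1).1 (L2_ae Lu1 c1 ae1).
  by have [] := (L2P h2).1 (L2_ae Lu2 c2 ae2).
have csq : continuous (fun s : R => s ^+ 2) by move=> s; apply: cvgM; exact: cvg_id.
have massE : \int[mu]_x (n x ^+ 2) = l.
  by rewrite -Hm /mass (ae_Rintegral_comp csq (conj Lu1 Lu2) c1 c2 ae1 ae2).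
have nD x y t (xy : x <= y) := modulus_lipschitz L1 L2' I1 I2 t xy.
have DG x y : x <= y -> sint d y - sint d x <= \int[mu]_x d x.
  move=> xy; rewrite sintB//; last exact: locint_integrable.
  exact: le_Int_Rint.
have dec := decay n0 cn In2 DG nD.
have [x0 nx0] : exists x0, 0 < n x0.
  apply/not_existsP => H; have := l0; rewrite -massE.
  rewrite (_ : (fun x => n x ^+ 2) = cst 0); first by rewrite /Rintegral integral0 ltxx.
  apply/funext => x; have := n0 x; rewrite le_eqVlt => /orP[/eqP<-|/H//].
  by rewrite expr0n.
have [x1 [max1 max2]] := decay_max n0 cn nx0 dec.
have n1 : 0 < n x1 by apply: lt_le_trans nx0 (max1 x0).
pose k := Num.sqrt (Ve V (n x1)).
have V1 : 0 < Ve V (n x1) by rewrite (Ve_gt0 ha hb hV)// gt_eqF.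
have kE : k ^+ 2 = Ve V (n x1) by rewrite sqr_sqrtr// ltW.
have k0 : 0 < k by rewrite sqrtr_gt0.
have Vle x : Ve V (n x) <= k ^+ 2.
  by rewrite kE (Ve_le ha hb hV) !ger0_norm.
pose gam2 x := (n x * height k (n x)) ^+ 2.
have cV : continuous (Ve V) by exact: (@continuous_Ve _ _ _ _ ha hb _ hV).
have cgam : continuous gam2.
  move=> x; apply: (@continuous_comp _ _ _ (fun x => n x * height k (n x)) (fun s => s ^+ 2));
      last exact: csq.
  apply: cvgM; first exact: cn.
  by apply: (@continuous_comp _ _ _ n (height k)); [exact: cn|exact: (@continuous_height _ _ _ _
      ha hb _ hV k)].
(* $n^2(k^2-V(n))=k^2n^2+2G(n)$: hence [C] carries the potential energy and the mass term
   together. *)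
have gam2E x : gam2 x = k ^+ 2 * n x ^+ 2 + 2 * (- (n x ^+ 2 * Ve V (n x) / 2)).
  by rewrite /gam2 exprMn height_sqr//; field.
have cpot : continuous (fun s : R => - (s ^+ 2 * Ve V s / 2)).
  move=> s; apply: cvgN; apply: cvgM; last exact: cvg_cst.
  by apply: cvgM; [exact: csq|exact: cV].
have mpot : measurable_fun setT (fun x => - (n x ^+ 2 * Ve V (n x) / 2)).
  apply: continuous_measurable => x.
  by apply: (@continuous_comp _ _ _ n (fun s : R => - (s ^+ 2 * Ve V s / 2))); [exact: cn|exact:
      cpot].
have Ipot : mu.-integrable setT (EFin \o (fun x => - (n x ^+ 2 * Ve V (n x) / 2))).
  apply: (@le_integrableF _ _ (fun x => k ^+ 2 / 2 * n x ^+ 2)) => //; last exact: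
      integrable_scaleF.
  move=> x _; rewrite normrN ger0_norm; last first.
    by rewrite divr_ge0// mulr_ge0 ?sqr_ge0// (Ve_ge0 ha hb hV).
  have : n x ^+ 2 * Ve V (n x) <= n x ^+ 2 * k ^+ 2 by rewrite ler_wpM2l ?sqr_ge0.
  by lra.
have Igam : mu.-integrable setT (EFin \o gam2).
  rewrite (_ : gam2 = fun x => k ^+ 2 * n x ^+ 2 + 2 * (- (n x ^+ 2 * Ve V (n x) / 2))); last
      first.
    by apply/funext => x; rewrite gam2E.
  by apply: integrable_addF => //; exact: integrable_scaleF.
have energyE : E u = 2^-1 * \int[mu]_x d x + \int[mu]_x (- (n x ^+ 2 * Ve V (n x) / 2)).
  rewrite /energy; congr (_ * _ + _).
    by apply: eq_Rintegral => x _; rewrite cabs_sqr /d /gradient_sqr gE1 gE2.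
  rewrite -(ae_Rintegral_comp cpot (conj Lu1 Lu2) c1 c2 ae1 ae2).
  by apply: eq_Rintegral => x _; rewrite potential_abs// cabs_ge0.
have gam_total : \int[mu]_x gam2 x = k ^+ 2 * l + 2 * \int[mu]_x (- (n x ^+ 2 * Ve V (n x) / 2)).
  under eq_Rintegral do rewrite gam2E.
  rewrite RintegralD//; [|exact: integrable_scaleF|exact: integrable_scaleF].
  by rewrite !RintegralZl// massE.
exists n, (sint d), (sint gam2), k; split; last by exists h1, h2.
split=> //.
- by move=> x; exact: is_derive_sint.
- exists x1 => // x /max2 nx; rewrite kE ltNge (Ve_le ha hb hV) -ltNge !ger0_norm//.
- move=> x y xy; have := DG x y xy.
  have : sint gam2 y - sint gam2 x <= \int[mu]_x gam2 x.
    rewrite sintB//; last exact: locint_continuous.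
    by apply: le_Int_Rint => // t; exact: sqr_ge0.
  rewrite energyE gam_total; lra.
Qed.

Section Data.
Variables (l e k : R) (n D C : R -> R).
Hypothesis bd : bogomolny_data l e n D C k.

Let act x := action k (height k (n x)).

Let bog x y (xy : x <= y) : `|act y - act x| <= 2^-1 * (D y - D x) + 2^-1 * (C y - C x).
Proof.
exact: (bogomolny ha hb hV (bd_cont bd) (bd_ge0 bd) (bd_le bd) (bd_D bd) (bd_C bd)).
Qed.

Let act_limit r : 0 < r -> exists2 A : R, 0 <= A & forall x, A <= `|x| -> action k k - act x <= r.
Proof.
move=> r0.
have ca : {for 0, continuous (fun s => action k (height k s))}.
  apply: (@continuous_comp _ _ _ (height k) (action k)).
    exact: (@continuous_height _ _ _ _ ha hb _ hV k).
  exact: (is_derive_continuous (is_derive_action a b c k _)).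
have h0 : height k 0 = k.
  by rewrite /height (Ve0 ha hb hV) subr0 sqrtr_sqr gtr0_norm// (bd_k bd).
have /cvgrPdist_le/(_ r r0) := ca; rewrite near_simpl h0 => /nbhs_ballP[d /= d0 Hd].
have [A A0 HA] := bd_decay bd (divr_gt0 d0 (ltr0n _ 2)).
exists A => // x Ax; apply: le_trans (ler_norm _) _; apply: Hd.
have nx := HA x Ax; have n0 := bd_ge0 bd x.
by rewrite /ball/= sub0r normrN ger0_norm//; move: d0; lra.
Qed.

Let act_max x : Ve V (n x) = k ^+ 2 -> act x = 0.
Proof. by move=> h; rewrite /act /height h subrr sqrtr0 /action; ring. Qed.

(** [act] tends to $R_k(k)$ at both ends and vanishes at the maximum, so its total variation is at
    least $2R_k(k)$. *)
Lemma energy_ge : hh l k <= e.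
Proof.
suff : 2 * action k k <= e + k ^+ 2 / 2 * l by rewrite /hh; lra.
apply/ler_addgt0Pr => r r0; have r2 : 0 < r / 2 by rewrite divr_gt0.
have [x1 hx1 _] := bd_max bd.
have [A A0 HA] := act_limit r2.
pose y := Num.max A `|x1|.
have Ay : A <= `|y| by rewrite ger0_norm ?le_max ?lexx// A0.
have y1 : x1 <= y by rewrite le_max ler_norm orbT.
have y2 : - y <= x1 by rewrite lerNl le_max -[`|x1|]normrN ler_norm orbT.
have HA1 := HA y Ay; have := HA (- y); rewrite normrN => /(_ Ay) HA2.
have := bog y1; have := bog y2; have := bd_energy bd (le_trans y2 y1).
rewrite (act_max hx1) !ler_norml => h /andP[h1 h2] /andP[h3 h4]; lra.
Qed.

(** The slack in [bogomolny] is nonnegative on every interval and adds up over $[-q,x_1]$,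
    $[x_1,x]$, $[x,y]$ and $[y,q]$. Equality of the total as $q$ grows leaves none for $[x,y]$. *)
Lemma energy_eq x1 : e = hh l k -> Ve V (n x1) = k ^+ 2 ->
  forall x, x1 < x -> is_derive x 1 n (- (n x * height k (n x))).
Proof.
move=> eE hx1.
apply: (bogomolny_eq ha hb hV (bd_cont bd) (bd_ge0 bd) (bd_le bd) (bd_D bd) (bd_C bd)) => x y x1x
    xy.
have := bog xy; rewrite -/(act x) -/(act y) ler_norml => /andP[_ up].
apply/eqP; rewrite eq_le up/=.
apply/ler_addgt0Pr => r r0; have r2 : 0 < r / 2 by rewrite divr_gt0.
have [A A0 HA] := act_limit r2.
pose q := Num.max A (Num.max `|x1| `|y|).
have Aq : A <= `|q| by rewrite ger0_norm ?le_max ?lexx// A0.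
have q1 : y <= q by rewrite !le_max ler_norm !orbT.
have q2 : - q <= x1 by rewrite lerNl !le_max -[`|x1|]normrN ler_norm !orbT.
have HA1 := HA q Aq; have := HA (- q); rewrite normrN => /(_ Aq) HA2.
have := bog q1; have := bog q2; have := bog x1x.
have := bd_energy bd (le_trans q2 (le_trans x1x (le_trans xy q1))).
rewrite eE /hh (act_max hx1) !ler_norml => h /andP[_ h2] /andP[h3 _] /andP[_ h5].
lra.
Qed.

End Data.

End LowerBound.

(** * Classical derivatives as weak derivatives *)

Section ClassicalDerivative.
Variable R : realType.
Local Notation mu := (@lebesgue_measure R).
Implicit Types (f g : R -> R) (x y t : R).

Lemma weak_derivative_C1 f g : continuous g -> (forall x, is_derive x 1 f (g x)) ->
  weak_derivative f g.
Proof.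
move=> cg df phi [sphi cphi].
have cf : continuous f by move=> x; exact: is_derive_continuous (df x).
have dphi x : is_derive x 1 phi (derive1 phi x) := is_derive_derive1 (sphi 0%N x).
have cp : continuous phi by move=> x; exact: is_derive_continuous (dphi x).
have cdp : continuous (derive1 phi).
  by move=> x; exact: is_derive_continuous (is_derive_derive1 (sphi 1%N x)).
have [M [_ HM]] := compact_bounded cphi.
pose A := `|M| + 1.
have A0 : 0 < A by rewrite ltr_wpDl.
have out t : A <= `|t| -> phi t = 0.
  move=> At; apply: contrapT => /eqP pt.
  have : `|t| <= `|M| + 2^-1.
    by apply: HM; [rewrite (le_lt_trans (ler_norm M))// ltrDl|apply: subset_closure].
  by move: At; rewrite /A; lra.
have out' t : A < `|t| -> derive1 phi t = 0.
  move=> At; have H : is_derive t 1 phi 0.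
    apply: (near_eq_is_derive (f := cst 0)); near=> s.
    rewrite /= out//; apply: ltW; near: s.
    have cn : {for t, continuous (fun s : R => `|s|)} by exact: norm_continuous.
    by have /cn := lt_nbhsr At.
  by have /is_deriveE[] := H.
have nA t : ~ - A <= t <= A -> A < `|t|.
  by move=> H; rewrite ltNge; apply/negP; rewrite ler_norml => /andP[? ?]; apply: H; apply/andP.
rewrite (@Rint_support _ (fun t => f t * derive1 phi t) (- A) A); last first.
  by move=> t /nA /out' ->; rewrite mulr0.
rewrite (@Rint_support _ (fun t => g t * phi t) (- A) A); last first.
  by move=> t /nA /ltW /out ->; rewrite mulr0.
apply/eqP; rewrite -addr_eq0.
have c1 : continuous (fun t => f t * derive1 phi t) by move=> x; apply: cvgM; [exact: cf|exact:
    cdp].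
have c2 : continuous (fun t => g t * phi t) by move=> x; apply: cvgM; [exact: cg|exact: cp].
rewrite addrC -IntD; [|exact: locint_continuous|exact: locint_continuous].
have c3 : continuous (fun t => g t * phi t + f t * derive1 phi t).
  by move=> x; apply: cvgD; [exact: c2|exact: c1].
have AA : - A <= A by rewrite (le_trans _ (ltW A0))// oppr_le0 ltW.
rewrite (Int_FTC c3 (fun t => is_derive_mul (df t) (dphi t)) AA).
by rewrite !out ?normrN ?gtr0_norm// !mulr0 subrr.
Unshelve. all: by end_near. Qed.

(** Apply it to a difference of two weak derivatives: at a Lebesgue point the vanishing averages
    force the value 0. It identifies [wderiv], which is only a choice, with a classical
    derivative. *)
Lemma Int_eq0_ae g : L2 g -> (forall x y, x <= y -> Int g x y = 0) -> {ae mu, forall x, g x = 0}.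
Proof.
move=> Lg H; have Ig := locint_L2 Lg.
have [N [mN N0 sub]] := lebesgue_differentiation (L2_locally_integrable Lg).
exists N; split => // x /= gx; apply: sub => /= px; apply: gx.
apply/eqP; rewrite -normr_le0; apply/ler_addgt0Pr => eta e0; rewrite add0r.
have [d d0 Hd] := lebesgue_pt_Int Lg px e0.
have d2 : 0 < d / 2 by rewrite divr_gt0.
have := Hd (d / 2); rewrite d2/= => /(_ ltac:(lra)).
have xd : x <= x + d / 2 by rewrite lerDl ltW.
have Igx : locint (fun t => g t - g x) by apply: locintB => //; exact: locint_cst.
move/(le_trans (Int_abs_le x (x + d / 2) Igx)).
rewrite (@IntB _ g (cst (g x)))//; last exact: locint_cst.
rewrite H// Int_cst// sub0r normrN normrM addrAC subrr add0r (gtr0_norm d2).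
by rewrite ler_pM2r.
Qed.

End ClassicalDerivative.

(** * Standing waves and positive symmetric minima *)

Section StandingWaves.
Variables (R : realType) (a b c : R).
Hypotheses (ha : 0 < a) (hc : 0 < c) (hb : b ^+ 2 < 3 * (a * c)).
Variable V : R -> R.
Hypothesis hV : forall s, 0 <= s -> s ^+ 2 = a * V s ^+ 3 + b * V s ^+ 2 + c * V s.
Local Notation mu := (@lebesgue_measure R).
Implicit Types (u : R -> R[i]) (x y t k l : R).
Local Notation E := (energy (potential V)).
Local Notation hh := (reduced_energy a b c).
Local Notation argmin := (argmin a b c).
Local Notation phi := (profile a b c).
Local Notation Y := (trajectory a b c).

Definition standing_wave k : R -> R[i] := fun x => (phi k x)%:C%C.

Section OneWave.
Variable k : R.
Hypothesis k0 : 0 < k.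

Let cphi : continuous (phi k). Proof. exact: continuous_profile. Qed.
Let cY : continuous (Y k). Proof. exact: continuous_trajectory. Qed.
Let dphi x := - (Y k x * phi k x).
Let cdphi : continuous dphi.
Proof. by move=> x; apply: cvgN; apply: cvgM; [exact: cY|exact: cphi]. Qed.
Let phi_gt0 x : 0 < phi k x. Proof. exact: profile_gt0. Qed.

Let L2phi : L2 (phi k).
Proof.
by apply/L2P; split; [exact: continuous_measurable|case: (profile_mass ha hb k0)].
Qed.

Let L2dphi : L2 dphi.
Proof.
apply/L2P; split; first exact: continuous_measurable.
under eq_fun do rewrite sqrrN.
by case: (profile_action ha hb k0).
Qed.

Let L20 : L2 (fun _ : R => 0 : R).
Proof.
apply/L2P; split; first exact: measurable_cst.
rewrite (_ : _ \o _ = cst 0%E); first exact: integrable0.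
by apply/funext => x; rewrite /= expr0n.
Qed.

Lemma standing_wave_H1 : H1 (standing_wave k).
Proof.
split; first by split.
exists (fun x => (dphi x)%:C%C); split; first by split.
split=> /=; apply: weak_derivative_C1 => //.
- by move=> x; exact: (is_derive_profile ha hb k0).
- by move=> x; exact: cvg_cst.
Qed.

Lemma standing_wave_mass : mass (standing_wave k) = frequency_mass a b c k.
Proof.
rewrite -(profile_mass ha hb k0).2; apply: eq_Rintegral => x _.
by rewrite cabs_sqr /= expr0n addr0.
Qed.

Lemma cabs_standing_wave x : cabs (standing_wave k x) = phi k x.
Proof. by rewrite cabsE /= expr0n addr0 sqrtr_sqr gtr0_norm. Qed.

Lemma standing_wave_energy : E (standing_wave k) = hh (frequency_mass a b c k) k.
Proof.
have Hu := standing_wave_H1.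
have [h1 [h2 [g1 [g2 [[c1 c2] [L1 L2'] [I1 I2] [ae1 ae2] [gE1 gE2]]]]]] := H1_modulus Hu.
have h1E : phi k = h1 by apply: continuous_ae_eq.
have h2E : (fun=> 0) = h2 by apply: continuous_ae_eq => // x; exact: cvg_cst.
have dI x y : x <= y -> Int dphi x y = phi k y - phi k x.
  by move=> xy; apply: Int_FTC => // t; exact: is_derive_profile.
have ae_g1 : {ae mu, forall x, g1 x = dphi x}.
  have L : L2 (fun x => g1 x - dphi x).
    apply/L2P; split; first by apply: measurable_funB; exact: measurable_L2.
    have sq x : (g1 x - dphi x) ^+ 2 = (g1 x ^+ 2 + dphi x ^+ 2) - 2 * (g1 x * dphi x) by ring.
    under eq_fun do rewrite sq.
    apply: integrable_subF => //.
      by apply: integrable_addF => //; [case: (L2P g1).1|case: (L2P dphi).1].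
    by apply: integrable_scaleF => //; exact: integrable_L2M.
  have : {ae mu, forall x, g1 x - dphi x = 0}.
    apply: Int_eq0_ae => // x y xy.
    by rewrite IntB ?dI -?I1 -?h1E ?subrr//; exact: locint_L2.
  case=> N [mN N0 sub]; exists N; split=> // x /= H; apply: sub => /= /eqP.
  by rewrite subr_eq0 => /eqP.
have ae_g2 : {ae mu, forall x, g2 x = 0}.
  by apply: Int_eq0_ae => // x y xy; rewrite -I2// -h2E subrr.
have grad : \int[mu]_x (cabs (wderiv (standing_wave k) x) ^+ 2) = 2 * action a b c k k.
  rewrite -(profile_action ha hb k0).2.
  transitivity (\int[mu]_x (g1 x ^+ 2 + g2 x ^+ 2)).
    by apply: eq_Rintegral => x _; rewrite cabs_sqr gE1 gE2.
  apply: ae_eq_Rintegral => //.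
  - by apply: measurable_funD; apply: measurable_funX; exact: measurable_L2.
  - apply: continuous_measurable => x.
    have cc : {for x, continuous (fun x => Y k x * phi k x)} by apply: cvgM; [exact: cY|exact:
        cphi].
    by apply: cvgM; exact: cc.
  - case: ae_g1 => N1 [mN1 N10 sub1]; case: ae_g2 => N2 [mN2 N20 sub2].
    exists (N1 `|` N2); split; [exact: measurableU|exact: null_set_setU|].
    move=> x /= H; apply: contrapT => /not_orP[n1 n2]; apply: H.
    have -> : g1 x = dphi x by apply: contrapT => e; apply: n1; apply: sub1.
    have -> : g2 x = 0 by apply: contrapT => e; apply: n2; apply: sub2.
    by rewrite expr0n addr0 /dphi sqrrN.
(* As $V(\phi)=k^2-Y^2$, the potential is $-\frac{k^2}{2}\phi^2+\frac12(Y\phi)^2$, so both integrals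
   are already known. *)
have pot : \int[mu]_x potential V (cabs (standing_wave k x)) =
    - (k ^+ 2 / 2) * frequency_mass a b c k + 2^-1 * (2 * action a b c k k).
  have [I m] := profile_mass ha hb k0; have [I' m'] := profile_action ha hb k0.
  rewrite -m -m' -!RintegralZl// -RintegralD//; [|exact: integrable_scaleF|exact:
      integrable_scaleF].
  apply: eq_Rintegral => x _.
  rewrite cabs_standing_wave potential_abs ?(ltW (phi_gt0 x))// (Ve_profile ha hb k0 hV).
  by field.
by rewrite /energy grad pot /reduced_energy; field.
Qed.

End OneWave.

Lemma mass_sphere_energy_ge l u : 0 < l -> mass_sphere l u ->
  exists2 k, 0 < k & hh l k <= E u.
Proof.
move=> l0 Su; have [n [D [C [k [bd _]]]]] := bogomolny_dataP ha hb hV l0 Su.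
by exists k; [exact: (bd_k bd)|exact: (energy_ge ha hb hV bd)].
Qed.

Lemma standing_wave_ground_state l k : 0 < l -> argmin l k ->
  ground_states (potential V) l (standing_wave k).
Proof.
move=> l0 Hk; have k0 := Hk.1; have lam := argmin_mass Hk.
have Sk : mass_sphere l (standing_wave k).
  by split; [exact: standing_wave_H1|rewrite /= standing_wave_mass].
split=> //; apply/eqP; rewrite eq_le; apply/andP; split; last first.
  by apply: ereal_inf_lbound; exists (standing_wave k).
apply: le_ereal_inf_tmp => _ [v Sv <-]; rewrite lee_fin.
have [k' k'0 Hv] := mass_sphere_energy_ge l0 Sv.
by rewrite standing_wave_energy// lam (le_trans _ Hv)//; apply: Hk.2.
Qed.

(** To the right of the last maximum $x_1$ the function is a translated half-profile, and by
    symmetry so is its mirror image left of $-x_1$. These two halves already carry the whole mass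
    [l], so a gap between $-x_1$ and $x_1$, where $n>0$, would exceed it. *)
Lemma H1rp_eq_profile l e k n D C : bogomolny_data V l e n D C k ->
  e = hh l k -> frequency_mass a b c k = l -> (forall x, 0 < n x) ->
  (forall x, n (- x) = n x) -> n = phi k.
Proof.
move=> bd eE kl n0 ne.
have k0 := bd_k bd; have cn := bd_cont bd; have [x1 hx1 hlt] := bd_max bd.
have H := profile_unique ha hb k0 hV cn n0 hx1 hlt (energy_eq ha hb hV bd eE hx1).
have x10 : 0 <= x1.
  rewrite leNgt; apply/negP => x10.
  by have := hlt (- x1); rewrite ne hx1 ltxx => /(_ ltac:(lra)).
suff x1E : x1 = 0.
  apply/funext => x; have pos y : 0 <= y -> n y = phi k y.
    by move=> y0; rewrite H x1E ?subr0.
  have [/pos//|/ltW x0] := lerP 0 x.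
  by rewrite -ne -(profile_even ha hb k0) pos// oppr_ge0.
apply/eqP; rewrite eq_le x10 andbT leNgt; apply/negP => x1p.
have [In2 nl] := bd_mass bd.
have L2n := locint_integrable In2.
have cphi : continuous (phi k) by exact: continuous_profile.
have cphi2 : continuous (fun x => phi k x ^+ 2) by move=> x; apply: cvgM; exact: cphi.
pose P := sint (fun x => phi k x ^+ 2).
have dP x : is_derive x 1 P (phi k x ^+ 2) by exact: is_derive_sint.
have lp := locint_continuous cphi2.
have right z : 0 <= z -> Int (fun x => n x ^+ 2) x1 (x1 + z) = Int (fun x => phi k x ^+ 2) 0 z.
  move=> z0; rewrite (@eq_Int _ _ (fun x => phi k (x - x1) ^+ 2)); last first.
    by move=> t /andP[xt _]; rewrite H.
  have cs : continuous (fun x => phi k (x - x1) ^+ 2).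
    move=> x; apply: (@continuous_comp _ _ _ (fun x => x - x1) (fun x => phi k x ^+ 2)); last
        exact: cphi2.
    by apply: cvgB; [exact: cvg_id|exact: cvg_cst].
  have ds t : is_derive t 1 (fun x => P (x - x1)) (phi k (t - x1) ^+ 2).
    apply: is_derive_eq (@is_derive_comp1 _ P (fun x => x - x1) t _ _ (dP _)
      (is_derive_sub (is_derive_id t 1) (is_derive_cst x1 t 1))) _.
    by rewrite subr0 mulr1.
  rewrite (Int_FTC cs ds); last by rewrite lerDl.
  have -> : x1 + z - x1 = z by ring.
  by rewrite subrr /P sintB.
have left z : 0 <= z -> Int (fun x => n x ^+ 2) (- (x1 + z)) (- x1) = Int (fun x => phi k x ^+ 2)
    0 z.
  move=> z0; rewrite (@eq_Int _ _ (fun x => phi k (- x - x1) ^+ 2)); last first.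
    by move=> t /andP[_ tx]; rewrite -ne H//; lra.
  have cs : continuous (fun x => phi k (- x - x1) ^+ 2).
    move=> x; apply: (@continuous_comp _ _ _ (fun x => - x - x1) (fun x => phi k x ^+ 2)); last
        exact: cphi2.
    by apply: cvgB; [apply: cvgN; exact: cvg_id|exact: cvg_cst].
  have ds t : is_derive t 1 (fun x => - P (- x - x1)) (phi k (- t - x1) ^+ 2).
    apply: is_derive_eq (is_derive_opp (@is_derive_comp1 _ P (fun x => - x - x1) t _ _ (dP _)
      (is_derive_sub (is_derive_opp (is_derive_id t 1)) (is_derive_cst x1 t 1)))) _.
    by rewrite subr0 mulrN1 opprK.
  rewrite (Int_FTC cs ds); last by rewrite lerN2 lerDl.
  have -> : - - x1 - x1 = 0 by ring.
  have -> : - - (x1 + z) - x1 = z by ring.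
  by rewrite opprK addrC /P sintB.
have xx : - x1 <= x1 by lra.
have [|m mI Hm] := EVT_min xx (f := n); first exact: continuous_subspaceT.
have mid : 0 < Int (fun x => n x ^+ 2) (- x1) x1.
  have : Int (cst (n m ^+ 2)) (- x1) x1 <= Int (fun x => n x ^+ 2) (- x1) x1.
    apply: Int_le => [||t tI]; [exact: locint_cst|exact: L2n|].
    by rewrite /= ler_sqr ?nnegrE ?(ltW (n0 _))//; apply: Hm; rewrite in_itv.
  rewrite Int_cst; last by lra.
  by apply: lt_le_trans; rewrite mulr_gt0 ?exprn_gt0 ?n0//; lra.
set I := Int _ _ _ in mid.
(* Truncation loses half of the mass [I] of the gap, so the truncated halves and the gap together
   still exceed [l]. *)
have [z z0 Hz] := profile_mass_half ha hb k0 (divr_gt0 mid (ltr0n R 2)).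
have total : Int (fun x => n x ^+ 2) (- (x1 + z)) (x1 + z) <= l.
  by rewrite -nl; apply: le_Int_Rint => // t; exact: sqr_ge0.
move: total; rewrite (@Int_cat _ _ _ (- x1)); [|exact: L2n|lra|lra].
rewrite (@Int_cat _ _ (- x1) x1); [|exact: L2n|lra|lra].
rewrite right// left// -/I; move: Hz; rewrite kl; lra.
Qed.

Lemma positive_symmetric_minimaE l : 0 < l ->
  positive_symmetric_minima (potential V) l = standing_wave @` argmin l.
Proof.
move=> l0; apply/seteqP; split=> [u|_ [k Hk <-]]; last first.
  have k0 := Hk.1; split; first exact: standing_wave_ground_state.
  split.
  - exact: standing_wave_H1.
  - by exists (phi k) => //; exact: continuous_profile.
  - by move=> x; rewrite /=; exact: profile_gt0.
  - by move=> x; rewrite /standing_wave (profile_even ha hb k0).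
move=> [[Su Eu] [Hu [w cw wE] upos ueven]].
have [n [D [C [k [bd [h1 [h2 [nE [c1 c2] ae1 ae2]]]]]]]] := bogomolny_dataP ha hb hV l0 Su.
have w0 x : 0 < w x by have := upos x; rewrite wE.
have h1E : w = h1.
  apply: continuous_ae_eq => //; case: ae1 => N [mN N0 sub]; exists N; split=> // x /= H.
  by apply: sub => /= e; apply: H; rewrite -e wE.
have h2E : (fun=> 0) = h2.
  apply: continuous_ae_eq => //; first by move=> x; exact: cvg_cst.
  case: ae2 => N [mN N0 sub]; exists N; split=> // x /= H.
  by apply: sub => /= e; apply: H; rewrite -e wE.
have nw : n = w.
  apply/funext => x; rewrite nE /modulus -h1E -h2E expr0n addr0 sqrtr_sqr gtr0_norm//.
have [p Hp] := argmin_nonempty ha hc hb l0.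
have lower := energy_ge ha hb hV bd.
(* A standing wave is the competitor; with the lower bound this squeezes the energy of [u] and makes
   its own [k] a minimiser. *)
have upper : E u <= hh l p.
  have Sp := standing_wave_ground_state l0 Hp.
  have -> : hh l p = E (standing_wave p) by rewrite standing_wave_energy ?(argmin_mass Hp)//;
      exact: Hp.1.
  by rewrite -lee_fin Eu Sp.2.
have pk := Hp.2 k (bd_k bd).
have Hk : argmin l k.
  split; first exact: bd_k bd.
  by move=> y y0; apply: le_trans (Hp.2 y y0); exact: le_trans lower upper.
have eE : E u = hh l k by apply/eqP; rewrite eq_le lower (le_trans upper pk).
exists k => //.
have nphi : n = phi k.
  apply: (H1rp_eq_profile bd eE (argmin_mass Hk)); first by rewrite nw.
  by move=> x; have := ueven x; rewrite nw !wE => /(congr1 (@complex.Re R)).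
by apply/funext => x; rewrite wE -nw nphi.
Qed.

(** The value at 0 determines the parameter, since $V(\phi_k(0))=k^2$. Hence counting minima is
    counting minimisers of the reduced energy. *)
Lemma standing_wave_inj k k' : 0 < k -> 0 < k' -> standing_wave k = standing_wave k' -> k = k'.
Proof.
move=> k0 k'0 /(congr1 (fun u => complex.Re (u 0))) /=.
rewrite !profile0// => /(congr1 (fun s => Ve V s)).
by rewrite !(Ve_sqrt ha hb hV) ?sqr_ge0// => /eqP; rewrite eqrXn2 ?(ltW k0) ?(ltW k'0)// => /eqP.
Qed.

End StandingWaves.

(** * Counting the minima *)

Unset Implicit Arguments.

Theorem theorem1p2 (R : realType) (a b c : R) (ha : 0 < a) (hc : 0 < c)
    (hsigma : b ^+ 2 / (a * c) < 3)
    (V : R -> R) (hV0 : V 0 = 0)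
    (hV : forall s : R, 0 <= s ->
       s ^+ 2 = a * V s ^+ 3 + b * V s ^+ 2 + c * V s) :
  let sigma := b ^+ 2 / (a * c) in
  let K := positive_symmetric_minima (potential V) in
  [/\ 0 < sigma <= 2 ->
        forall lambda : R, 0 < lambda -> (K lambda #= `I_1)%card,
      2 < sigma < 3 -> b < 0 ->
        exists lambda2 : R,
          [/\ 0 < lambda2,
              (K lambda2 #= `I_2)%card,
              forall lambda : R, 0 < lambda -> (K lambda #= `I_2)%card ->
                lambda = lambda2
            & forall lambda : R, 0 < lambda -> lambda <> lambda2 ->
                (K lambda #= `I_1)%card]
    & 2 < sigma < 3 -> 0 < b ->
        forall lambda : R, 0 < lambda -> (K lambda #= `I_1)%card].
Proof.
move=> sigma K.
have ac : 0 < a * c by rewrite mulr_gt0.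
have hb : b ^+ 2 < 3 * (a * c) by rewrite -ltr_pdivrMr.
have K1 l k : 0 < l -> argmin a b c l = [set k] -> (K l #= `I_1)%card.
  move=> l0 Hk; rewrite /K (positive_symmetric_minimaE ha hc hb hV l0) Hk image_set1.
  exact: card_set1.
have mono : b ^+ 2 <= 2 * (a * c) \/ 0 <= b ->
    forall l : R, 0 < l -> (K l #= `I_1)%card.
  move=> hyp l l0; have [k Hk] := argmin_nonempty ha hc hb l0.
  exact: K1 l0 (argmin_unique_of_injective (lam_increasing ha hc hyp) Hk).
split.
- by move=> /andP[_ s2]; apply: mono; left; rewrite -ler_pdivrMr.
- move=> /andP[s2 _] b0.
  have sb : 2 * (a * c) < b ^+ 2 by rewrite -ltr_pdivlMr.
  have [l2 [p [q [l20 pq Hpq H1]]]] := argmin_bistable ha hc hb sb b0.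
  have card1 l : 0 < l -> l <> l2 -> (K l #= `I_1)%card.
    by move=> l0 ll2; have [k Hk] := H1 l l0 ll2; exact: K1 l0 Hk.
  exists l2; split => //.
    have [p0 q0] : 0 < p /\ 0 < q.
      have Hp : argmin a b c l2 p by rewrite Hpq; left.
      have Hq : argmin a b c l2 q by rewrite Hpq; right.
      by split; [exact: Hp.1|exact: Hq.1].
    rewrite /K (positive_symmetric_minimaE ha hc hb hV l20) Hpq.
    apply/eq_cardSP; exists (standing_wave a b c p); first by exists p => //; left.
    rewrite (_ : _ `\ _ = [set standing_wave a b c q]); first exact: card_set1.
    apply/seteqP; split=> [_ [[r [->|->] <-]] //= []//|_ ->].
    split; first by exists q => //; right.
    by move=> /= /(standing_wave_inj ha hb hV q0 p0) qp; rewrite qp eqxx in pq.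
  move=> l l0 KI2; apply: contrapT => ll2.
  have := card1 l l0 ll2; rewrite card_eq_sym => K1l.
  by have /card_eq_II := card_eq_trans K1l KI2.
- by move=> _ b0; apply: mono; right; exact: ltW.
Qed.
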